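(* Let $\mathbb{F}$ be $\mathbb{R}$, $\mathbb{C}$ or $\mathbb{H}$. Let $V$ be a real algebraic variety and let $X\subseteq V$ be a compact subset. Then each topological $\mathbb{F}$-vector bundle on $X$ is topologically isomorphic to a piecewise-algebraic $\mathbb{F}$-vector bundle on $X$, which is uniquely determined up to piecewise-algebraic isomorphism.
   Context: A real algebraic variety is a locally ringed space isomorphic to an algebraic subset of $\mathbb{R}^m$ (for some $m$) endowed with the Zariski topology and the sheaf of real-valued regular functions; its morphisms are called regular maps. All topological notions refer to the Euclidean topology unless ''Zariski'' is specified. A stratification of $V$ is a finite collection of pairwise disjoint Zariski locally closed subvarieties of $V$ (some possibly empty) whose union is $V$. $\mathbb{F}$-vector spaces are left vector spaces ($\mathbb{H}$ denotes the quaternions). For a space $X$, $\varepsilon_X^n(\mathbb{F})$ is the product $\mathbb{F}$-vector bundle with total space $X\times\mathbb{F}^n$. If $Z_0$ is a real algebraic variety, an algebraic $\mathbb{F}$-vector subbundle of $\varepsilon_{Z_0}^n(\mathbb{F})$ has its usual meaning (a subbundle which, Zariski locally on $Z_0$, has a frame consisting of regular sections), and algebraic morphisms between such bundles are the bundle morphisms that are regular maps of total spaces. Let $X\subseteq V$ be any subset with Zariski closure $Z$ in $V$. An algebraic $\mathbb{F}$-vector bundle on $X$ (algebraic $\mathbb{F}$-vector subbundle of $\varepsilon_X^n(\mathbb{F})$) is a topological $\mathbb{F}$-vector subbundle $\xi$ of $\varepsilon_X^n(\mathbb{F})$, for some $n$, for which there exist a Zariski open neighborhood $Z_0\subseteq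 Z$ of $X$ and an algebraic $\mathbb{F}$-vector subbundle $\tilde\xi$ of $\varepsilon_{Z_0}^n(\mathbb{F})$ with $\tilde\xi|_X=\xi$; the pair $(Z_0,\tilde\xi)$ is called an algebraic extension of $\xi$. An algebraic morphism $\varphi\colon\xi\to\eta$ of algebraic $\mathbb{F}$-vector bundles on $X$ is a topological morphism for which there exist algebraic extensions $(Z_0,\tilde\xi)$, $(Z_0,\tilde\eta)$ and an algebraic morphism $\tilde\varphi\colon\tilde\xi\to\tilde\eta$ restricting to $\varphi$ over $X$. For a stratification $\mathcal{S}$ of $V$, a piecewise $\mathcal{S}$-algebraic $\mathbb{F}$-vector bundle on $X$ is a topological $\mathbb{F}$-vector subbundle $\xi$ of $\varepsilon_X^n(\mathbb{F})$, for some $n$, such that for every $S\in\mathcal{S}$ and each connected component $\Sigma$ of $X\cap S$ the restriction $\xi|_\Sigma$ is an algebraic $\mathbb{F}$-vector subbundle of $\varepsilon_\Sigma^n(\mathbb{F})$. A piecewise $\mathcal{S}$-algebraic morphism of such bundles is a topological morphism whose restriction over each such $\Sigma$ is an algebraic morphism. A piecewise-algebraic $\mathbb{F}$-vector bundle on $X$ is a piecewise $\mathcal{T}$-algebraic one for some stratification $\mathcal{T}$ of $V$. A piecewise-algebraic morphism $\xi\to\eta$ is a piecewise $\mathcal{T}$-algebraic morphism for some stratification $\mathcal{T}$ of $V$ such that both $\xi$ and $\eta$ are piecewise $\mathcal{T}$-algebraic. These form a category; a piecewise-algebraic isomorphism is an isomorphism in it. *)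

(* Defs.v *)
From HB Require Import structures.
From mathcomp Require Import all_boot all_order all_algebra.
From mathcomp Require Import complex.
From mathcomp Require Import all_classical all_reals all_analysis.
From mathcomp Require Import ring.
From mathcomp Require mpoly.

Set Implicit Arguments.
Unset Strict Implicit.
Unset Printing Implicit Defensive.

Import Order.TTheory GRing.Theory Num.Theory.
Import numFieldNormedType.Exports.
Local Open Scope classical_set_scope.
Local Open Scope ring_scope.

Record quaternion (R : Type) : Type :=
  Quaternion { qre : R; qim_i : R; qim_j : R; qim_k : R }.

Definition tuple_of_quaternion (R : Type) (x : quaternion R) : R * R * R * R :=
  (qre x, qim_i x, qim_j x, qim_k x).

Definition quaternion_of_tuple (R : Type) (t : R * R * R * R) : quaternion R :=
  Quaternion t.1.1.1 t.1.1.2 t.1.2 t.2.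

Lemma tuple_of_quaternionK (R : Type) :
  cancel (@tuple_of_quaternion R) (@quaternion_of_tuple R).
Proof. by case. Qed.

HB.instance Definition _ (R : choiceType) :=
  Choice.copy (quaternion R) (can_type (@tuple_of_quaternionK R)).

Definition quaternion_zero (R : comNzRingType) : quaternion R :=
  Quaternion 0 0 0 0.

Definition quaternion_one (R : comNzRingType) : quaternion R :=
  Quaternion 1 0 0 0.

Definition quaternion_opp (R : comNzRingType) (x : quaternion R) :
    quaternion R :=
  Quaternion (- qre x) (- qim_i x) (- qim_j x) (- qim_k x).

Definition quaternion_add (R : comNzRingType) (x y : quaternion R) :
    quaternion R :=
  Quaternion (qre x + qre y) (qim_i x + qim_i y)
             (qim_j x + qim_j y) (qim_k x + qim_k y).

(* Hamilton's product: i^2 = j^2 = k^2 = ijk = -1. *)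
Definition quaternion_mul (R : comNzRingType) (x y : quaternion R) :
    quaternion R :=
  Quaternion
    (qre x * qre y - qim_i x * qim_i y - qim_j x * qim_j y - qim_k x * qim_k y)
    (qre x * qim_i y + qim_i x * qre y + qim_j x * qim_k y - qim_k x * qim_j y)
    (qre x * qim_j y - qim_i x * qim_k y + qim_j x * qre y + qim_k x * qim_i y)
    (qre x * qim_k y + qim_i x * qim_j y - qim_j x * qim_i y + qim_k x * qre y).

Lemma quaternion_addA (R : comNzRingType) : associative (@quaternion_add R).
Proof. by move=> x y z; rewrite /quaternion_add /= !addrA. Qed.

Lemma quaternion_addC (R : comNzRingType) : commutative (@quaternion_add R).
Proof. by move=> x y; congr Quaternion; rewrite addrC. Qed.

Lemma quaternion_add0 (R : comNzRingType) :
  left_id (quaternion_zero R) (@quaternion_add R).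
Proof. by case=> a b c d; rewrite /quaternion_add /= !add0r. Qed.

Lemma quaternion_addN (R : comNzRingType) :
  left_inverse (quaternion_zero R) (@quaternion_opp R) (@quaternion_add R).
Proof. by case=> a b c d; rewrite /quaternion_add /= !addNr. Qed.

HB.instance Definition _ (R : comNzRingType) :=
  GRing.isZmodule.Build (quaternion R) (@quaternion_addA R)
    (@quaternion_addC R) (@quaternion_add0 R) (@quaternion_addN R).

Lemma quaternion_mulA (R : comNzRingType) : associative (@quaternion_mul R).
Proof. by move=> x y z; congr Quaternion; rewrite /=; ring. Qed.

Lemma quaternion_mul1 (R : comNzRingType) :
  left_id (quaternion_one R) (@quaternion_mul R).
Proof. by case=> a b c d; congr Quaternion; rewrite /=; ring. Qed.

Lemma quaternion_mulr1 (R : comNzRingType) :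
  right_id (quaternion_one R) (@quaternion_mul R).
Proof. by case=> a b c d; congr Quaternion; rewrite /=; ring. Qed.

Lemma quaternion_mulDl (R : comNzRingType) :
  left_distributive (@quaternion_mul R) (@quaternion_add R).
Proof. by move=> x y z; congr Quaternion; rewrite /=; ring. Qed.

Lemma quaternion_mulDr (R : comNzRingType) :
  right_distributive (@quaternion_mul R) (@quaternion_add R).
Proof. by move=> x y z; congr Quaternion; rewrite /=; ring. Qed.

Lemma quaternion_one_neq0 (R : comNzRingType) :
  quaternion_one R != quaternion_zero R.
Proof. by apply/eqP => -[] /eqP; rewrite oner_eq0. Qed.

HB.instance Definition _ (R : comNzRingType) :=
  GRing.Zmodule_isNzRing.Build (quaternion R) (@quaternion_mulA R)
    (@quaternion_mul1 R) (@quaternion_mulr1 R) (@quaternion_mulDl R)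
    (@quaternion_mulDr R) (@quaternion_one_neq0 R).

Variant scalar_kind : Set := Reals | Complexes | Quaternions.

Definition scalar_ring (R : realType) (F : scalar_kind) : nzRingType :=
  match F with
  | Reals => R
  | Complexes => complex R
  | Quaternions => quaternion R
  end.

Definition scalars (R : realType) (F : scalar_kind) : Type := scalar_ring R F.

HB.instance Definition _ (R : realType) (F : scalar_kind) :=
  GRing.NzRing.copy (scalars R F) (scalar_ring R F).

Definition scalar_dim (F : scalar_kind) : nat :=
  match F with Reals => 1 | Complexes => 2 | Quaternions => 4 end.

Definition scalar_coords (R : realType) (F : scalar_kind) :
    scalars R F -> 'rV[R]_(scalar_dim F) :=
  match F with
  | Reals => fun x : R => \row_j [:: x]`_j
  | Complexes => fun z : complex R =>
      \row_j [:: complex.Re z; complex.Im z]`_j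
  | Quaternions => fun q : quaternion R =>
      \row_j [:: qre q; qim_i q; qim_j q; qim_k q]`_j
  end.

(* With this, F^n, i.e. 'rV[scalars R F]_n, has both its library left module
   structure and its library product topology. *)
HB.instance Definition _ (R : realType) (F : scalar_kind) :=
  Topological.copy (scalars R F) (initial_topology (@scalar_coords R F)).

Definition realify (R : realType) (F : scalar_kind) (n : nat)
    (v : 'rV[scalars R F]_n) : 'rV[R]_(n * scalar_dim F) :=
  mxvec (\matrix_(i < n, j < scalar_dim F) scalar_coords (v 0 i) 0 j).

(* A set with a (Zariski) topology and a sheaf of real-valued functions. The
   sections over an open set U are represented by total functions, whose values
   outside U are irrelevant; [regular_fun] is only meaningful on open sets. *)
Record function_space (R : realType) : Type := FunctionSpace {
  carrier :> Type;
  zariski_open : set (set carrier);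
  regular_fun : set carrier -> set (carrier -> R)
}.

Section FunctionSpaces.
Context {R : realType}.
Implicit Types X Y : function_space R.

Definition zariski_closed X (A : set X) : Prop := zariski_open (~` A).

Definition zariski_closure X (A : set X) : set X :=
  [set x | forall C : set X, zariski_closed C -> A `<=` C -> C x].

Definition zariski_locally_closed X (A : set X) : Prop :=
  exists O C : set X, [/\ zariski_open O, zariski_closed C & A = O `&` C].

Definition regular_map X Y (f : X -> Y) : Prop :=
  forall O : set Y, zariski_open O ->
    zariski_open (f @^-1` O) /\
    forall h, regular_fun O h -> regular_fun (f @^-1` O) (h \o f).

Definition isomorphic_spaces X Y : Prop :=
  exists (f : X -> Y) (g : Y -> X),
    [/\ regular_map f, regular_map g, cancel f g & cancel g f].

(* The structure induced on T by an injection i : T -> X: open sets are traces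
   of open sets, and regular functions are locally restrictions of regular
   functions on X. *)
Definition induced_space (T : Type) X (i : T -> X) : function_space R :=
  let opn := [set i @^-1` O | O in @zariski_open R X] in
  @FunctionSpace R T opn
    (fun U => [set f | opn U /\ forall t, U t ->
       exists (O : set X) (g : X -> R),
         [/\ zariski_open O, O (i t), regular_fun O g &
             forall s, U s -> O (i s) -> f s = g (i s)]]).

Definition subset_space X (A : set X) : function_space R :=
  @induced_space (set_type A) X set_val.

Definition regular_on X Y (A : set X) (f : X -> Y) : Prop :=
  @regular_map (subset_space A) Y (fun a => f (set_val a)).

(* Finite sums of products a(x) b(y) with a regular on U and b regular on W. *)
Definition product_tensor X Y (U : set X) (W : set Y) : set (X * Y -> R) :=
  [set h | exists (k : nat) (a : 'I_k -> X -> R) (b : 'I_k -> Y -> R),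
     [/\ forall i, regular_fun U (a i), forall i, regular_fun W (b i) &
         forall p, h p = \sum_(i < k) a i p.1 * b i p.2]].

Definition product_basic_open X Y (U : set X) (W : set Y) (h : X * Y -> R) :
    set (X * Y) :=
  [set p | [/\ U p.1, W p.2 & h p != 0]].

(* The product of affine varieties: the sets D(h) form a basis of the Zariski
   topology, and a regular function is locally of the form g / h. *)
Definition product_space X Y : function_space R :=
  let opn : set (set (X * Y)) := [set O | forall p, O p ->
    exists (U : set X) (W : set Y) (h : X * Y -> R),
      [/\ zariski_open U, zariski_open W, product_tensor U W h,
          product_basic_open U W h p & product_basic_open U W h `<=` O]] in
  @FunctionSpace R (X * Y)%type opn
    (fun O => [set f | opn O /\ forall p, O p ->
       exists (U : set X) (W : set Y) (g h : X * Y -> R),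
         [/\ zariski_open U /\ zariski_open W,
             product_tensor U W g /\ product_tensor U W h,
             product_basic_open U W h p, product_basic_open U W h `<=` O &
             forall q, product_basic_open U W h q -> f q = g q / h q]]).

Definition poly_eval (N : nat) (P : mpoly.mpoly N R) (x : 'rV[R]_N) : R :=
  mpoly.meval (fun i => x 0 i) P.

Definition algebraic_subset (N : nat) (A : set 'rV[R]_N) : Prop :=
  exists S : set (mpoly.mpoly N R),
    A = [set x | forall P, S P -> poly_eval P x = 0].

Definition affine_space (N : nat) : function_space R :=
  let opn : set (set 'rV[R]_N) := [set O | algebraic_subset (~` O)] in
  @FunctionSpace R 'rV[R]_N opn
    (fun U => [set f | opn U /\ forall x, U x ->
       exists (P Q : mpoly.mpoly N R) (O : set 'rV[R]_N),
         [/\ opn O, O x & forall y, U y -> O y ->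
             poly_eval Q y != 0 /\ f y = poly_eval P y / poly_eval Q y]]).

Definition real_algebraic_variety (V : function_space R) : Prop :=
  exists (N : nat) (A : set (affine_space N)),
    algebraic_subset A /\ isomorphic_spaces V (subset_space A).

End FunctionSpaces.

HB.instance Definition _ (R : realType) (V : function_space R) :=
  gen_eqMixin (carrier V).
HB.instance Definition _ (R : realType) (V : function_space R) :=
  gen_choiceMixin (carrier V).

Definition global_evaluation (R : realType) (V : function_space R) (x : V) :
    {ptws {f : V -> R | regular_fun setT f} -> R} :=
  fun f => sval f x.

(* The Euclidean topology: the coarsest one for which all regular functions
   V -> R are continuous. On an algebraic subset of R^N it is the topology
   induced by that of R^N. *)
HB.instance Definition _ (R : realType) (V : function_space R) :=
  Topological.copy (carrier V) (initial_topology (@global_evaluation R V)).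

Section VectorBundles.
Context {R : realType} (F : scalar_kind).

(* A family of F-vector spaces over (a subset of) B, before any axiom. The total
   space is a subset of an ambient space, which allows for both abstract bundles
   and subbundles of product bundles. The operations only matter within the
   fibers of the total space. *)
Record vector_family (B : topologicalType) : Type := VectorFamily {
  ambient : topologicalType;
  total_set : set ambient;
  bundle_proj : ambient -> B;
  fadd : ambient -> ambient -> ambient;
  fscale : scalars R F -> ambient -> ambient
}.

Arguments total_set {B} xi : rename.
Arguments bundle_proj {B} xi : rename.

(* h : (X `&` U) x F^r -> E|_U is a fiberwise linear homeomorphism over X `&` U
   with inverse e |-> (bundle_proj xi e, k e). *)
Definition trivialization (B : topologicalType) (X : set B)
    (xi : vector_family B) (U : set B) (r : nat)
    (h : B * 'rV[scalars R F]_r -> ambient xi)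
    (k : ambient xi -> 'rV[scalars R F]_r) : Prop :=
  [/\ {within (X `&` U) `*` setT, continuous h},
      {within total_set xi `&` bundle_proj xi @^-1` U, continuous k},
      (forall x v, X x -> U x ->
         [/\ total_set xi (h (x, v)), bundle_proj xi (h (x, v)) = x &
             k (h (x, v)) = v]),
      (forall e, total_set xi e -> U (bundle_proj xi e) ->
         h (bundle_proj xi e, k e) = e) &
      (forall x, X x -> U x ->
         (forall v w, h (x, v + w) = fadd (h (x, v)) (h (x, w))) /\
         (forall a v, h (x, a *: v) = fscale a (h (x, v))))].

(* The vector space axioms on the fibers follow from local triviality. The rank
   is locally constant. *)
Definition vector_bundle (B : topologicalType) (X : set B)
    (xi : vector_family B) : Prop :=
  [/\ (forall e, total_set xi e -> X (bundle_proj xi e)),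
      {within total_set xi, continuous (bundle_proj xi)} &
      forall x, X x -> exists U : set B, open U /\ U x /\
        exists (r : nat) h k, @trivialization B X xi U r h k].

Definition bundle_morphism (B : topologicalType) (xi eta : vector_family B)
    (phi : total_set xi -> total_set eta) : Prop :=
  [/\ continuous phi,
      (forall e,
         bundle_proj eta (set_val (phi e)) = bundle_proj xi (set_val e)),
      (forall e1 e2 e3,
         bundle_proj xi (set_val e1) = bundle_proj xi (set_val e2) ->
         set_val e3 = fadd (set_val e1) (set_val e2) ->
         set_val (phi e3) = fadd (set_val (phi e1)) (set_val (phi e2))) &
      (forall a e1 e2, set_val e2 = fscale a (set_val e1) ->
         set_val (phi e2) = fscale a (set_val (phi e1)))].

Definition topologically_isomorphic (B : topologicalType)
    (xi eta : vector_family B) : Prop :=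
  exists (phi : total_set xi -> total_set eta)
         (psi : total_set eta -> total_set xi),
    [/\ bundle_morphism phi, bundle_morphism psi,
        cancel phi psi & cancel psi phi].

End VectorBundles.

Arguments vector_family : clear implicits.

Section PiecewiseAlgebraicBundles.
Context {R : realType} (F : scalar_kind) {V : function_space R}.
Local Notation Fn n := 'rV[scalars R F]_n.

Definition subfamily (n : nat) (E : set (V * Fn n)) : vector_family R F V :=
  @VectorFamily R F V (V * Fn n : topologicalType)%type E fst
    (fun e e' => (e.1, e.2 + e'.2)) (fun a e => (e.1, a *: e.2)).

Definition topological_subbundle (n : nat) (X : set V) (E : set (V * Fn n)) :
    Prop :=
  vector_bundle X (subfamily E).

Definition restriction (n : nat) (E : set (V * Fn n)) (X : set V) :
    set (V * Fn n) :=
  E `&` (X `*` setT).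

Definition vector_space (n : nat) : function_space R :=
  @induced_space R (Fn n) (affine_space (n * scalar_dim F)) (@realify R F n).

Definition total_space (n : nat) (E : set (V * Fn n)) : function_space R :=
  @subset_space R (product_space V (vector_space n)) E.

(* The rows of s are regular sections of E over A which form a frame. *)
Definition regular_frame (n : nat) (E : set (V * Fn n)) (A : set V) (r : nat)
    (s : 'I_r -> V -> Fn n) : Prop :=
  (forall i, @regular_on R V (vector_space n) A (s i)) /\
  forall x, A x ->
    (forall v, E (x, v) <-> exists c : 'I_r -> scalars R F,
                              v = \sum_(i < r) c i *: s i x) /\
    (forall c : 'I_r -> scalars R F,
       \sum_(i < r) c i *: s i x = 0 -> forall i, c i = 0).

(* For Z0 a Zariski locally closed subvariety of V. *)
Definition algebraic_subbundle (n : nat) (Z0 : set V) (E : set (V * Fn n)) :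
    Prop :=
  topological_subbundle Z0 E /\
  forall z, Z0 z -> exists O : set V, [/\ zariski_open O, O z &
    exists r s, @regular_frame n E (Z0 `&` O) r s].

Definition algebraic_subbundle_morphism (n p : nat) (E : set (V * Fn n))
    (E' : set (V * Fn p)) (phi : set_type E -> set_type E') : Prop :=
  @bundle_morphism R F V (subfamily E) (subfamily E') phi /\
  @regular_map R (total_space E) (total_space E') phi.

Definition zariski_neighborhood_in_closure (X Z0 : set V) : Prop :=
  X `<=` Z0 /\
  exists O : set V, zariski_open O /\ Z0 = zariski_closure X `&` O.

Definition algebraic_extension (n : nat) (X : set V) (E : set (V * Fn n))
    (Z0 : set V) (Et : set (V * Fn n)) : Prop :=
  [/\ zariski_neighborhood_in_closure X Z0, algebraic_subbundle Z0 Et &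
      restriction Et X = E].

Definition algebraic_bundle (n : nat) (X : set V) (E : set (V * Fn n)) : Prop :=
  topological_subbundle X E /\ exists Z0 Et, algebraic_extension X E Z0 Et.

(* When E is a subset of Et, this says that phit extends phi. *)
Definition agree (n p : nat) (E Et : set (V * Fn n)) (E' Et' : set (V * Fn p))
    (phi : set_type E -> set_type E') (phit : set_type Et -> set_type Et') :
    Prop :=
  forall e et, set_val e = set_val et -> set_val (phi e) = set_val (phit et).

Definition algebraic_morphism (n p : nat) (X : set V) (E : set (V * Fn n))
    (E' : set (V * Fn p)) (phi : set_type E -> set_type E') : Prop :=
  @bundle_morphism R F V (subfamily E) (subfamily E') phi /\
  exists Z0 Et Et' (phit : set_type Et -> set_type Et'),
    [/\ algebraic_extension X E Z0 Et, algebraic_extension X E' Z0 Et',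
        algebraic_subbundle_morphism phit & agree phi phit].

Definition stratification (S : set (set V)) : Prop :=
  [/\ finite_set S, (forall A, S A -> zariski_locally_closed A),
      trivIset S id & \bigcup_(A in S) A = setT].

(* Sigma is a connected component, for the Euclidean topology, of the
   intersection of X with a stratum. *)
Definition piece (S : set (set V)) (X Sigma : set V) : Prop :=
  exists2 A, S A &
    exists2 x, (X `&` A) x & Sigma = connected_component (X `&` A) x.

Definition piecewise_algebraic_bundle_for (S : set (set V)) (n : nat)
    (X : set V) (E : set (V * Fn n)) : Prop :=
  topological_subbundle X E /\
  forall Sigma, piece S X Sigma ->
    algebraic_bundle Sigma (restriction E Sigma).

Definition piecewise_algebraic_morphism_for (S : set (set V)) (n p : nat)
    (X : set V) (E : set (V * Fn n)) (E' : set (V * Fn p))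
    (phi : set_type E -> set_type E') : Prop :=
  @bundle_morphism R F V (subfamily E) (subfamily E') phi /\
  forall Sigma, piece S X Sigma ->
    exists phiS : set_type (restriction E Sigma) ->
                  set_type (restriction E' Sigma),
      algebraic_morphism Sigma phiS /\ agree phiS phi.

Definition piecewise_algebraic_bundle (n : nat) (X : set V)
    (E : set (V * Fn n)) : Prop :=
  exists2 S, stratification S & piecewise_algebraic_bundle_for S X E.

Definition piecewise_algebraic_morphism (n p : nat) (X : set V)
    (E : set (V * Fn n)) (E' : set (V * Fn p))
    (phi : set_type E -> set_type E') : Prop :=
  exists2 S, stratification S &
    [/\ piecewise_algebraic_bundle_for S X E,
        piecewise_algebraic_bundle_for S X E' &
        piecewise_algebraic_morphism_for S X phi].

Definition piecewise_algebraically_isomorphic (n p : nat) (X : set V)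
    (E : set (V * Fn n)) (E' : set (V * Fn p)) : Prop :=
  exists (phi : set_type E -> set_type E') (psi : set_type E' -> set_type E),
    [/\ piecewise_algebraic_morphism X phi, piecewise_algebraic_morphism X psi,
        cancel phi psi & cancel psi phi].

End PiecewiseAlgebraicBundles.

(* Main.v *)
Require Import Defs.
From HB Require Import structures.
From mathcomp Require Import all_boot all_order all_algebra finmap.
From mathcomp Require Import all_classical all_reals all_analysis.
From mathcomp Require Import complex ring lra.
From mathcomp Require Import -(notations) mpoly.

(* Bundles over [X] are encoded by fields of real matrices: a subbundle of
   [X * F^n] is the fixed space of a field of idempotents commuting with the
   scalars, and it is algebraic when the idempotents are rational functions.

   Existence. Embed the bundle in [X * F^n] and let [p] be its field of
   orthogonal projectors. A fine cubical grid in the affine space containing [V]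
   gives bump functions [lam_m], each a product of positive parts of polynomials,
   at most [2 ^ N] of them being nonzero at a point, together with projectors
   [P_m = p a_m] close to [p] on the support of [lam_m]. These are glued by
   recursion on [m]: if [Q] is the idempotent obtained so far, with total weight
   [w], and [t = w / (lam_m + w)], then [P_m] is replaced by [U^-1 P_m U], where
   [U = (1 - t) + t (P_m Q + (1 - P_m) (1 - Q))] is close to [1] and satisfies
   [U^-1 P_m U = Q] at [t = 1]. The formula is rational in [lam_m], [w] and [Q].
   The error is multiplied by a constant at each active step only, so the bound
   [2 ^ N], independent of the mesh, keeps the result close to [p]. On a
   connected component of a stratum of the zero sets of the polynomials involved,
   each [lam_m] is either zero or a polynomial.

   Uniqueness. Let [Phi] be the field of matrices of a topological isomorphism
   [E -> E'], and [p], [p'] the orthogonal projectors onto [E], [E']. If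
   [Psi = \sum_m lam_m Phi(a_m)] then [p Psi p'] is piecewise algebraic and, up to
   the positive factor [\sum_m lam_m], close to [Phi], hence an isomorphism. *)

Set Implicit Arguments.
Unset Strict Implicit.
Unset Printing Implicit Defensive.

Import Order.TTheory GRing.Theory Num.Theory.
Import numFieldNormedType.Exports.
Local Open Scope classical_set_scope.
Local Open Scope ring_scope.

(** * Scalars and real forms *)

(** A convex combination of projectors is not a projector, and its spectral projectors are in
    general not rational in its entries; this is why projectors are glued one at a time. The danger
    is circularity: the admissible error decides the cover, while the number of gluing steps, which
    decides the admissible error, depends on the cover. It is broken by counting only the steps that
    act at a given point. Morphisms form a vector space, so for them plain averaging is allowed, and
    invertibility is an open condition.

    Orthogonal projectors are used because they depend on the fiber alone: every local frame,
    continuous or regular, yields the same matrix. When a formula is extended from a piece to its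
    Zariski closure, identities between rational functions persist by density, while nonvanishing
    conditions cut out the Zariski neighborhood. *)

Section Scalars.
Context {R : realType} {F : scalar_kind}.
Local Notation K := (scalars R F).
Local Notation d := (scalar_dim F).

Definition scalar_of_real (r : R) : K :=
  match F return scalars R F with
  | Reals => r
  | Complexes => r%:C%C
  | Quaternions => Quaternion r 0 0 0
  end.

Definition scalar_of_coords (u : 'rV[R]_d) : K :=
  match F return 'rV[R]_(scalar_dim F) -> scalars R F with
  | Reals => fun u => u 0 0
  | Complexes => fun u => (u 0 0 +i* u 0 1)%C
  | Quaternions => fun u => Quaternion (u 0 0) (u 0 1) (u 0 2) (u 0 3)
  end u.

Definition scalar_conj (x : K) : K :=
  match F return scalars R F -> scalars R F with
  | Reals => id
  | Complexes => fun z : complex R => (complex.Re z -i* complex.Im z)%C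
  | Quaternions => fun q : quaternion R =>
      Quaternion (qre q) (- qim_i q) (- qim_j q) (- qim_k q)
  end x.

Definition scalar_inv (x : K) : K :=
  match F return scalars R F -> scalars R F with
  | Reals => fun x : R => x^-1
  | Complexes => fun z : complex R => z^-1
  | Quaternions => fun q : quaternion R =>
      let s := (qre q ^+ 2 + qim_i q ^+ 2 + qim_j q ^+ 2 + qim_k q ^+ 2)^-1 in
      Quaternion (s * qre q) (- (s * qim_i q)) (- (s * qim_j q))
                 (- (s * qim_k q))
  end x.

End Scalars.

Section ScalarTheory.
Context {R : realType} {F : scalar_kind}.
Local Notation K := (scalars R F).
Local Notation d := (scalar_dim F).

Lemma scalar_coordsK : cancel (@scalar_coords R F) scalar_of_coords.
Proof.
case: F => /= [x|[a b]|[a b c e]] /=; rewrite /scalar_of_coords ?mxE //=.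
Qed.

Lemma scalar_of_coordsK : cancel scalar_of_coords (@scalar_coords R F).
Proof.
case: F => /= u; apply/rowP => i; rewrite /scalar_of_coords !mxE /=.
- by rewrite ord1.
- by case: i => [[|[|[]]]] //= h; congr (u 0 _); apply: val_inj.
- by case: i => [[|[|[|[|[]]]]]] //= h; congr (u 0 _); apply: val_inj.
Qed.

Lemma scalar_coordsD (x y : K) :
  scalar_coords (x + y) = scalar_coords x + scalar_coords y.
Proof.
move: x y; case: F => /= [x y|[a b] [a' b']|x y]; apply/rowP => i;
  rewrite !mxE /=.
- by rewrite ord1.
- by case: i => [[|[|[]]]].
- by case: i => [[|[|[|[|[]]]]]].
Qed.

Lemma scalar_coordsZ (r : R) (x : K) :
  scalar_coords (scalar_of_real r * x) = r *: scalar_coords x.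
Proof.
move: x; case: F => /= [x|[a b]|x]; apply/rowP => i; rewrite !mxE /=.
- by rewrite ord1.
- by case: i => [[|[|[]]]] //= h; rewrite !mul0r ?addr0 ?subr0.
- by case: i => [[|[|[|[|[]]]]]] //= h; rewrite !mul0r ?addr0 ?subr0.
Qed.

Lemma scalar_of_real_comm (r : R) (x : K) :
  scalar_of_real r * x = x * scalar_of_real r.
Proof.
move: x; case: F => /= [x|x|x]; [exact: mulrC|exact: mulrC|].
by congr Quaternion; rewrite /=; ring.
Qed.

(** Conjugation is the real adjoint. This makes the commutant of the scalars stable under
    transposition, hence orthogonal projectors onto [F]-subspaces [F]-linear. *)
Lemma scalar_conj_dot (a x y : K) :
  \sum_k scalar_coords (a * x) 0 k * scalar_coords y 0 k =
  \sum_k scalar_coords x 0 k * scalar_coords (scalar_conj a * y) 0 k.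
Proof.
move: a x y; case: F => /=.
- by move=> a x y; rewrite !big_ord1 !mxE /=; ring.
- case=> a1 a2 [x1 x2] [y1 y2]; rewrite !big_ord_recl !big_ord0 !mxE /=; ring.
- move=> a x y; rewrite !big_ord_recl !big_ord0 !mxE /=; ring.
Qed.

Lemma scalar_mulVr (x : K) : x != 0 -> scalar_inv x * x = 1.
Proof.
move: x; case: F => /= [x|x|x].
- exact: mulVf.
- exact: mulVf.
case: x => a b c e nz.
set s := a ^+ 2 + b ^+ 2 + c ^+ 2 + e ^+ 2.
have s0 : s != 0.
  apply: contra nz; rewrite /s !paddr_eq0 ?addr_ge0 ?sqr_ge0 //.
  by rewrite !sqrf_eq0 => /andP[/andP[/andP[/eqP-> /eqP->] /eqP->] /eqP->].
have := mulVf s0; set si := s^-1 => sis.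
by congr Quaternion; rewrite /= -/s -/si; [rewrite -sis /s|..]; ring.
Qed.

End ScalarTheory.

Section RealForms.
Context {R : realType} {F : scalar_kind}.
Local Notation K := (scalars R F).
Local Notation d := (scalar_dim F).
Local Notation Fn n := 'rV[scalars R F]_n.
Local Notation "n ~d" := (n * d)%N (at level 2, format "n ~d").

Definition unrealify n (u : 'rV[R]_(n ~d)) : Fn n :=
  \row_i scalar_of_coords (row i (vec_mx u)).

Lemma realifyK n : cancel (@realify R F n) (@unrealify n).
Proof.
move=> v; apply/rowP => i; rewrite mxE mxvecK -[RHS]scalar_coordsK.
by congr scalar_of_coords; apply/rowP => k; rewrite !mxE.
Qed.

Lemma unrealifyK n : cancel (@unrealify n) (@realify R F n).
Proof.
move=> u; rewrite /realify -[RHS]vec_mxK; congr mxvec.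
by apply/matrixP => i k; rewrite !mxE scalar_of_coordsK !mxE.
Qed.

Lemma realify_inj n : injective (@realify R F n).
Proof. exact: can_inj (@realifyK n). Qed.

Lemma realifyD n (v w : Fn n) : realify (v + w) = realify v + realify w.
Proof.
rewrite /realify -linearD; congr mxvec.
by apply/matrixP => i k; rewrite !mxE scalar_coordsD mxE.
Qed.

Lemma realify0 n : realify (0 : Fn n) = 0.
Proof. by apply: (addrI (realify (0 : Fn n))); rewrite -realifyD !addr0. Qed.

Lemma realify_sum n I (r : seq I) P (E : I -> Fn n) :
  realify (\sum_(i <- r | P i) E i) = \sum_(i <- r | P i) realify (E i).
Proof. exact: (big_morph _ (@realifyD n) (@realify0 n)). Qed.

Lemma realifyZ n (r : R) (v : Fn n) :
  realify (scalar_of_real r *: v) = r *: realify v.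
Proof.
rewrite /realify -linearZ; congr mxvec.
by apply/matrixP => i k; rewrite !mxE scalar_coordsZ mxE.
Qed.

Lemma realify_eq0 n (v : Fn n) : realify v = 0 -> v = 0.
Proof. by rewrite -[X in _ = X](realify0 n) => /realify_inj. Qed.

Lemma unrealifyD n (u w : 'rV[R]_(n ~d)) :
  unrealify (u + w) = unrealify u + unrealify w.
Proof. by apply: realify_inj; rewrite realifyD !unrealifyK. Qed.

Lemma unrealifyZ n r (u : 'rV[R]_(n ~d)) :
  unrealify (r *: u) = scalar_of_real r *: unrealify u.
Proof. by apply: realify_inj; rewrite realifyZ !unrealifyK. Qed.

Lemma eq_mx_rowmul m n (A B : 'M[R]_(m, n)) :
  (forall u : 'rV_m, u *m A = u *m B) -> A = B.
Proof. by move=> h; apply/row_matrixP => i; rewrite !rowE. Qed.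

(** Rows are acted upon from the right, so composites read from left to right. *)
Definition mx_of n p (g : Fn n -> Fn p) : 'M[R]_(n ~d, p ~d) :=
  \matrix_i realify (g (unrealify (delta_mx 0 i))).

Lemma mx_ofE n p (g : Fn n -> Fn p) (v : Fn n) :
  {morph g : v w / v + w} ->
  (forall r v, g (scalar_of_real r *: v) = scalar_of_real r *: g v) ->
  realify (g v) = realify v *m mx_of g.
Proof.
move=> gD gZ.
have g0 : g 0 = 0 by apply: (addrI (g 0)); rewrite -gD !addr0.
rewrite -{1}[v]realifyK; move: (realify v) => u.
rewrite {1}[u]matrix_sum_delta big_ord1.
rewrite mulmx_sum_row (big_morph _ (@unrealifyD n) (_ : _ = 0)); last first.
  by apply: realify_inj; rewrite unrealifyK realify0.
rewrite (big_morph _ gD g0) realify_sum; apply: eq_bigr => i _.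
by rewrite unrealifyZ gZ realifyZ rowK.
Qed.

Definition smul_mx n (a : K) : 'M[R]_(n ~d) := mx_of (fun v : Fn n => a *: v).

Lemma smul_mxE n (a : K) (v : Fn n) :
  realify (a *: v) = realify v *m smul_mx n a.
Proof.
apply: (@mx_ofE n n ( *:%R a)) => [u w|r u]; first exact: scalerDr.
by rewrite !scalerA scalar_of_real_comm.
Qed.

Lemma realify_dot n (v w : Fn n) :
  (realify v *m (realify w)^T) 0 0 =
  \sum_i \sum_k scalar_coords (v 0 i) 0 k * scalar_coords (w 0 i) 0 k.
Proof.
rewrite mxE (reindex _ (curry_mxvec_bij _ _)) /= pair_bigA /=.
by apply: eq_bigr => -[i k] _; rewrite !mxE !mxvecE !mxE.
Qed.

Lemma tr_smul_mx n (a : K) : (smul_mx n a)^T = smul_mx n (scalar_conj a).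
Proof.
apply: eq_mx_rowmul => w; apply: trmx_inj; rewrite trmx_mul trmxK.
apply: eq_mx_rowmul => u; rewrite -[u]unrealifyK -[w]unrealifyK.
rewrite mulmxA -!smul_mxE; apply/matrixP => i j; rewrite !ord1 !realify_dot.
by apply: eq_bigr => k _; rewrite !mxE scalar_conj_dot.
Qed.

(** The commutant of the scalars. It is stable under sums, products, transposition and inversion,
    hence under every matrix formula used below. *)
Definition scalar_linear n p (A : 'M[R]_(n ~d, p ~d)) :=
  forall a, smul_mx n a *m A = A *m smul_mx p a.

Lemma scalar_linear1 n : scalar_linear (1%:M : 'M[R]_(n ~d)).
Proof. by move=> a; rewrite mulmx1 mul1mx. Qed.

Lemma scalar_linear0 n p : scalar_linear (0 : 'M[R]_(n ~d, p ~d)).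
Proof. by move=> a; rewrite mulmx0 mul0mx. Qed.

Lemma scalar_linearD n p (A B : 'M[R]_(n ~d, p ~d)) :
  scalar_linear A -> scalar_linear B -> scalar_linear (A + B).
Proof. by move=> hA hB a; rewrite mulmxDl mulmxDr hA hB. Qed.

Lemma scalar_linearZ n p r (A : 'M[R]_(n ~d, p ~d)) :
  scalar_linear A -> scalar_linear (r *: A).
Proof. by move=> hA a; rewrite -scalemxAl -scalemxAr hA. Qed.

Lemma scalar_linearN n p (A : 'M[R]_(n ~d, p ~d)) :
  scalar_linear A -> scalar_linear (- A).
Proof. by rewrite -scaleN1r; exact: scalar_linearZ. Qed.

Lemma scalar_linear_sum n p I (r : seq I) (P : pred I)
    (A : I -> 'M[R]_(n ~d, p ~d)) : (forall i, P i -> scalar_linear (A i)) ->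
  scalar_linear (\sum_(i <- r | P i) A i).
Proof.
move=> hA; elim/big_rec: _ => [|i x Pi]; first exact: scalar_linear0.
by apply: scalar_linearD; exact: hA.
Qed.

Lemma scalar_linearM n p q (A : 'M[R]_(n ~d, p ~d)) (B : 'M[R]_(p ~d, q ~d)) :
  scalar_linear A -> scalar_linear B -> scalar_linear (A *m B).
Proof. by move=> hA hB a; rewrite mulmxA hA -!mulmxA hB. Qed.

Lemma scalar_conjK (a : K) : scalar_conj (scalar_conj a) = a.
Proof.
move: a; case: F => //= [[a b]|[a b c e]] /=; first by rewrite opprK.
by rewrite /scalar_conj /= !opprK.
Qed.

Lemma scalar_linear_tr n p (A : 'M[R]_(n ~d, p ~d)) :
  scalar_linear A -> scalar_linear A^T.
Proof.
move=> hA a; rewrite -[a]scalar_conjK; move: (scalar_conj a) => b.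
by rewrite -!tr_smul_mx -!trmx_mul hA.
Qed.

Lemma scalar_linear_inv n (A : 'M[R]_(n ~d)) :
  scalar_linear A -> scalar_linear (invmx A).
Proof.
move=> hA a; case: (boolP (A \in unitmx)) => uA; last first.
  by rewrite /invmx (negPf uA).
by rewrite -[LHS](mulKmx uA) (mulmxA A) -hA mulmxK.
Qed.

Lemma scalar_linear_mx_of n p (g : Fn n -> Fn p) :
  {morph g : v w / v + w} -> (forall a v, g (a *: v) = a *: g v) ->
  scalar_linear (mx_of g).
Proof.
move=> gD gZ a; apply: eq_mx_rowmul => u; rewrite -[u]unrealifyK !mulmxA.
have gE w := mx_ofE w gD (fun r => gZ (scalar_of_real r)).
by rewrite -smul_mxE -!gE -smul_mxE gZ.
Qed.

Definition mx_act n p (A : 'M[R]_(n ~d, p ~d)) (v : Fn n) : Fn p :=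
  unrealify (realify v *m A).

Lemma realify_act n p (A : 'M[R]_(n ~d, p ~d)) v :
  realify (mx_act A v) = realify v *m A.
Proof. exact: unrealifyK. Qed.

Lemma mx_actD n p (A : 'M[R]_(n ~d, p ~d)) v w :
  mx_act A (v + w) = mx_act A v + mx_act A w.
Proof. by rewrite /mx_act realifyD mulmxDl unrealifyD. Qed.

Lemma mx_act0 n p (A : 'M[R]_(n ~d, p ~d)) : mx_act A 0 = 0.
Proof. by apply: realify_inj; rewrite realify_act !realify0 mul0mx. Qed.

Lemma mx_actZ n p (A : 'M[R]_(n ~d, p ~d)) a v :
  scalar_linear A -> mx_act A (a *: v) = a *: mx_act A v.
Proof.
move=> hA; apply: realify_inj.
by rewrite smul_mxE !realify_act smul_mxE -!mulmxA hA.
Qed.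

Definition frame_mx n r (s : 'I_r -> Fn n) : 'M[R]_(r ~d, n ~d) :=
  mx_of (fun w : Fn r => \sum_i w 0 i *: s i).

Lemma frame_mxE n r (s : 'I_r -> Fn n) (w : Fn r) :
  realify (\sum_i w 0 i *: s i) = realify w *m frame_mx s.
Proof.
apply: (@mx_ofE r n (fun w => \sum_i w 0 i *: s i)) => [u v|a v].
  by rewrite -big_split; apply: eq_bigr => i _; rewrite mxE scalerDl.
by rewrite scaler_sumr; apply: eq_bigr => i _; rewrite mxE scalerA.
Qed.

Lemma scalar_linear_frame n r (s : 'I_r -> Fn n) : scalar_linear (frame_mx s).
Proof.
apply: scalar_linear_mx_of => [u v|a v].
  by rewrite -big_split; apply: eq_bigr => i _; rewrite mxE scalerDl.
by rewrite scaler_sumr; apply: eq_bigr => i _; rewrite mxE scalerA.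
Qed.

Lemma row_sum_delta r (w : Fn r) : w = \sum_i w 0 i *: delta_mx 0 i.
Proof. by rewrite {1}[w]matrix_sum_delta big_ord1. Qed.

Lemma mx_act_frame n r (G : 'M[R]_(r ~d, n ~d)) (w : Fn r) : scalar_linear G ->
  mx_act G w = \sum_i w 0 i *: mx_act G (delta_mx 0 i).
Proof.
move=> hG; rewrite {1}[w]row_sum_delta.
rewrite (big_morph _ (@mx_actD _ _ G) (mx_act0 G)).
by apply: eq_bigr => i _; rewrite mx_actZ.
Qed.

Definition free_family n r (s : 'I_r -> Fn n) :=
  forall c : 'I_r -> K, \sum_i c i *: s i = 0 -> forall i, c i = 0.

Lemma row_free_frame n r (s : 'I_r -> Fn n) :
  free_family s -> row_free (frame_mx s).
Proof.
move=> fs; apply: inj_row_free => u; rewrite -[u]unrealifyK -frame_mxE.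
move=> /realify_eq0 /fs h; rewrite [unrealify u](_ : _ = 0) ?realify0 //.
by apply/rowP => i; rewrite h mxE.
Qed.

Lemma scalar_dim_gt0 : (0 < d)%N. Proof. by case: F. Qed.

Lemma free_family_leq n r (s : 'I_r -> Fn n) : free_family s -> (r <= n ~d)%N.
Proof.
move=> /row_free_frame fs; apply: leq_trans (leq_pmulr r scalar_dim_gt0) _.
by move: fs; rewrite /row_free => /eqP <-; exact: rank_leq_col.
Qed.

(** A free family of maximal length spans: in a nontrivial relation with one more vector, the
    coefficient of that vector is nonzero, hence invertible. Lengths are bounded by the real
    dimension. *)
Lemma exists_basis n (W : set (Fn n)) : W 0 ->
  (forall v w, W v -> W w -> W (v + w)) -> (forall a v, W v -> W (a *: v)) ->
  exists r (s : 'I_r -> Fn n), free_family s /\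
    forall v, W v <-> exists c : 'I_r -> K, v = \sum_i c i *: s i.
Proof.
move=> W0 WD WZ.
pose P r := exists2 s : 'I_r -> Fn n, free_family s & forall i, W (s i).
have P0 : exists r, `[< P r >].
  by exists 0%N; apply/asboolP; exists (fun=> 0) => [c _ []|[]].
have Pb r : `[< P r >] -> (r <= n ~d)%N.
  by move=> /asboolP[s /free_family_leq].
case: (ex_maxnP P0 Pb) => r /asboolP[s fs Ws] rmax; exists r, s; split=> // v.
have span c : W (\sum_i c i *: s i) by elim/big_ind: _ => // i _; exact: WZ.
split=> [Wv|[c ->] //]; apply: contrapT => nv.
suff /rmax : `[< P r.+1 >] by rewrite ltnn.
(* The longer family has [v] at index [ord0], followed by [s]. *)
apply/asboolP; exists (fun i => oapp s v (unlift ord0 i)); last first.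
  by move=> i; case: (unlift _ _).
move=> c; rewrite big_ord_recl unlift_none /= => h.
have c0 : c ord0 = 0.
  apply/eqP; apply/negPn/negP => c0; apply: nv.
  exists (fun i => - (scalar_inv (c ord0) * c (lift ord0 i))).
  have := congr1 (fun x => scalar_inv (c ord0) *: x) h.
  rewrite scaler0 scalerDr scalerA scalar_mulVr // scale1r.
  move=> /eqP; rewrite addr_eq0 => /eqP ->; rewrite scaler_sumr -sumrN.
  by apply: eq_bigr => i _; rewrite liftK /= scalerA scaleNr.
move: h; rewrite c0 scale0r add0r => h.
have {}h : \sum_i c (lift ord0 i) *: s i = 0.
  by rewrite -[RHS]h; apply: eq_bigr => i _; rewrite liftK.
by move=> i; case: (unliftP ord0 i) => [j|] ->; [exact: (fs _ h)|].
Qed.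

End RealForms.

(** * Function algebras, rational functions and continuity *)

Section FunctionAlgebras.
Context {R : realType} {T : Type}.

(** Polynomials, functions rational near a given set and functions continuous at a point are all of
    this kind, so one set of closure lemmas for determinants and inverses yields both algebraicity
    and continuity. *)
Definition function_algebra (P : set (T -> R)) :=
  [/\ forall a, P (fun=> a),
      forall f g, P f -> P g -> P (fun x => f x + g x) &
      forall f g, P f -> P g -> P (fun x => f x * g x)].

Definition entries m n (P : set (T -> R)) (A : T -> 'M[R]_(m, n)) :=
  forall i j, P (fun x => A x i j).

Section Closure.
Variables (P : set (T -> R)) (hP : function_algebra P).

Lemma falg_cst a : P (fun=> a). Proof. by case: hP. Qed.

Lemma falgD f g : P f -> P g -> P (fun x => f x + g x).
Proof. by case: hP => _ + _; apply. Qed.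

Lemma falgM f g : P f -> P g -> P (fun x => f x * g x).
Proof. by case: hP => _ _; apply. Qed.

Lemma falgN f : P f -> P (fun x => - f x).
Proof.
move=> Pf; rewrite (_ : (fun _ => _) = fun x => -1 * f x).
  by apply: falgM => //; exact: falg_cst.
by apply/funext => x; rewrite mulN1r.
Qed.

Lemma falgB f g : P f -> P g -> P (fun x => f x - g x).
Proof. by move=> Pf Pg; apply: falgD => //; exact: falgN. Qed.

Lemma falg_sum I (r : seq I) (Q : pred I) (f : I -> T -> R) :
  (forall i, P (f i)) -> P (fun x => \sum_(i <- r | Q i) f i x).
Proof.
move=> Pf; elim: r => [|i r IH].
  rewrite (_ : (fun _ => _) = fun=> 0); first exact: falg_cst.
  by apply/funext => x; rewrite big_nil.
case: (boolP (Q i)) => Qi.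
  rewrite (_ : (fun _ => _) = fun x => f i x + \sum_(i <- r | Q i) f i x).
    exact: falgD.
  by apply/funext => x; rewrite big_cons Qi.
rewrite (_ : (fun _ => _) = fun x => \sum_(i <- r | Q i) f i x) //.
by apply/funext => x; rewrite big_cons (negPf Qi).
Qed.

Lemma falg_prod I (r : seq I) (Q : pred I) (f : I -> T -> R) :
  (forall i, P (f i)) -> P (fun x => \prod_(i <- r | Q i) f i x).
Proof.
move=> Pf; elim: r => [|i r IH].
  rewrite (_ : (fun _ => _) = fun=> 1); first exact: falg_cst.
  by apply/funext => x; rewrite big_nil.
case: (boolP (Q i)) => Qi.
  rewrite (_ : (fun _ => _) = fun x => f i x * \prod_(i <- r | Q i) f i x).
    exact: falgM.
  by apply/funext => x; rewrite big_cons Qi.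
rewrite (_ : (fun _ => _) = fun x => \prod_(i <- r | Q i) f i x) //.
by apply/funext => x; rewrite big_cons (negPf Qi).
Qed.

Lemma entries_cst m n (A : 'M[R]_(m, n)) : entries P (fun=> A).
Proof. by move=> i j; exact: falg_cst. Qed.

Lemma entries_ext m n (A B : T -> 'M[R]_(m, n)) :
  A =1 B -> entries P A -> entries P B.
Proof. by move=> /funext ->. Qed.

Lemma entriesD m n (A B : T -> 'M[R]_(m, n)) :
  entries P A -> entries P B -> entries P (fun x => A x + B x).
Proof.
move=> hA hB i j; rewrite (_ : (fun _ => _) = fun x => A x i j + B x i j).
  exact: falgD.
by apply/funext => x; rewrite mxE.
Qed.

Lemma entriesZ m n f (A : T -> 'M[R]_(m, n)) :
  P f -> entries P A -> entries P (fun x => f x *: A x).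
Proof.
move=> hf hA i j; rewrite (_ : (fun _ => _) = fun x => f x * A x i j).
  exact: falgM.
by apply/funext => x; rewrite mxE.
Qed.

Lemma entriesB m n (A B : T -> 'M[R]_(m, n)) :
  entries P A -> entries P B -> entries P (fun x => A x - B x).
Proof.
move=> hA hB i j; rewrite (_ : (fun _ => _) = fun x => A x i j - B x i j).
  exact: falgB.
by apply/funext => x; rewrite !mxE.
Qed.

Lemma entriesM m n p (A : T -> 'M[R]_(m, n)) (B : T -> 'M[R]_(n, p)) :
  entries P A -> entries P B -> entries P (fun x => A x *m B x).
Proof.
move=> hA hB i j.
rewrite (_ : (fun _ => _) = fun x => \sum_k A x i k * B x k j).
  by apply: falg_sum => k; exact: falgM.
by apply/funext => x; rewrite mxE.
Qed.

Lemma entries_tr m n (A : T -> 'M[R]_(m, n)) :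
  entries P A -> entries P (fun x => (A x)^T).
Proof.
move=> hA i j; rewrite (_ : (fun _ => _) = fun x => A x j i) //.
by apply/funext => x; rewrite mxE.
Qed.

Lemma entries_sum I (r : seq I) (Q : pred I) m n (A : I -> T -> 'M[R]_(m, n)) :
  (forall i, entries P (A i)) ->
  entries P (fun x => \sum_(i <- r | Q i) A i x).
Proof.
move=> hA i j.
rewrite (_ : (fun _ => _) = fun x => \sum_(k <- r | Q k) A k x i j).
  by apply: falg_sum => k; exact: hA.
by apply/funext => x; rewrite summxE.
Qed.

Lemma falg_det n (A : T -> 'M[R]_n) :
  entries P A -> P (fun x => \det (A x)).
Proof.
move=> hA; apply: falg_sum => s; apply: falgM; first exact: falg_cst.
by apply: falg_prod => i.
Qed.

(** Cramer's formula without the case distinction of [invmx]: its entries are polynomials in those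
    of [A] and in the inverse of the determinant. A singular matrix is sent to [0]. *)
Definition mx_inv (n : nat) (A : 'M[R]_n) : 'M[R]_n := (\det A)^-1 *: \adj A.

Lemma mx_inv_unit n (A : 'M[R]_n) : A \in unitmx -> mx_inv A = invmx A.
Proof. by rewrite /invmx => ->. Qed.

Lemma entries_inv n (A : T -> 'M[R]_n) : entries P A ->
  P (fun x => (\det (A x))^-1) -> entries P (fun x => mx_inv (A x)).
Proof.
move=> hA hd; apply: entriesZ => // i j.
rewrite (_ : (fun _ => _) =
    fun x => (-1) ^+ (j + i) * \det (row' j (col' i (A x)))).
  apply: falgM; first exact: falg_cst.
  apply: falg_det => k l.
  rewrite (_ : (fun _ => _) = fun x => A x (lift j k) (lift i l)) //.
  by apply/funext => x; rewrite !mxE.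
by apply/funext => x; rewrite mxE.
Qed.

End Closure.

Section Rational.
Context {I : Type} (c : I -> T -> R).

Inductive polynomial_in : (T -> R) -> Prop :=
| PolyCst a : polynomial_in (fun=> a)
| PolyGen i : polynomial_in (c i)
| PolyAdd f g : polynomial_in f -> polynomial_in g ->
    polynomial_in (fun x => f x + g x)
| PolyMul f g : polynomial_in f -> polynomial_in g ->
    polynomial_in (fun x => f x * g x).

Lemma polynomial_algebra : function_algebra polynomial_in.
Proof.
by split; [exact: PolyCst|exact: PolyAdd|exact: PolyMul].
Qed.

(* On [Z], [f] is a quotient whose denominator has no zero on [Y]; only the
   points of [Z] where the denominator is nonzero are constrained. Hence
   [Y = [set z]] gives rationality of [f] near [z]. *)
Definition rational_on (Y Z : set T) (f : T -> R) :=
  exists u w, [/\ polynomial_in u, polynomial_in w,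
    forall y, Y y -> w y != 0 & forall y, Z y -> w y != 0 -> f y = u y / w y].

Lemma rational_polynomial Y Z f : polynomial_in f -> rational_on Y Z f.
Proof.
move=> hf; exists f, (fun=> 1); split=> // [|y _]; first exact: PolyCst.
by rewrite divr1.
Qed.

Lemma rational_algebra Y Z : function_algebra (rational_on Y Z).
Proof.
split=> [a|f g|f g]; first exact/rational_polynomial/PolyCst.
- move=> [u [w [pu pw w0 fE]]] [u' [w' [pu' pw' w'0 gE]]].
  exists (fun x => u x * w' x + u' x * w x), (fun x => w x * w' x); split.
  + by apply: PolyAdd; apply: PolyMul.
  + exact: PolyMul.
  + by move=> y Yy; rewrite mulf_neq0 ?w0 ?w'0.
  + move=> y Zy; rewrite mulf_eq0 negb_or => /andP[wy w'y].
    by rewrite fE // gE // addf_div.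
- move=> [u [w [pu pw w0 fE]]] [u' [w' [pu' pw' w'0 gE]]].
  exists (fun x => u x * u' x), (fun x => w x * w' x); split.
  + exact: PolyMul.
  + exact: PolyMul.
  + by move=> y Yy; rewrite mulf_neq0 ?w0 ?w'0.
  + move=> y Zy; rewrite mulf_eq0 negb_or => /andP[wy w'y].
    by rewrite fE // gE // mulf_div.
Qed.

(** Multiplying numerator and denominator by those of [k] makes [k] nonzero wherever the new
    denominator is, so a formula valid only where [k] does not vanish is enough. *)
Lemma rational_local (Y Z : set T) k f : Y `<=` Z -> rational_on Y Z k ->
  (forall y, Y y -> k y != 0) -> rational_on Y (Z `&` [set y | k y != 0]) f ->
  rational_on Y Z f.
Proof.
move=> YZ [a [b [pa pb b0 kE]]] k0 [u [w [pu pw w0 fE]]].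
exists (fun x => u x * (a x * b x)), (fun x => w x * (a x * b x)); split.
- by do 2?apply: PolyMul.
- by do 2?apply: PolyMul.
- move=> y Yy; have := k0 y Yy; rewrite kE ?b0 //; last exact: YZ.
  by rewrite !mulf_eq0 !negb_or w0 // b0 // invr_eq0 b0 // !andbT.
- move=> y Zy; rewrite !mulf_eq0 !negb_or => /and3P[wy ay biy].
  have ky : k y != 0 by rewrite kE // mulf_neq0 // invr_eq0.
  by rewrite fE // -mulf_div divff ?mulr1 // mulf_neq0.
Qed.

Lemma rational_inv (Y Z : set T) f : Y `<=` Z -> rational_on Y Z f ->
  (forall y, Y y -> f y != 0) -> rational_on Y Z (fun x => (f x)^-1).
Proof.
move=> YZ rf f0; apply: (rational_local YZ rf f0).
move: rf => [u [w [pu pw w0 fE]]].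
exists (fun x => w x * w x), (fun x => u x * w x); split.
- exact: PolyMul.
- exact: PolyMul.
- move=> y Yy; have := f0 y Yy; rewrite fE ?w0 //; last exact: YZ.
  by rewrite !mulf_eq0 !negb_or invr_eq0.
- move=> y [Zy _]; rewrite mulf_eq0 negb_or => /andP[uy wy].
  by rewrite fE // -mulf_div divff // mulr1 invf_div.
Qed.

Lemma rational_sub (Y Y' Z Z' : set T) f : Y' `<=` Y -> Z' `<=` Z ->
  rational_on Y Z f -> rational_on Y' Z' f.
Proof.
move=> hY hZ [u [w [pu pw w0 fE]]]; exists u, w.
by split=> // y; [move/hY; exact: w0|move/hZ; exact: fE].
Qed.

Lemma rational_ext (Y Z : set T) f g : {in Z, f =1 g} ->
  rational_on Y Z f -> rational_on Y Z g.
Proof.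
move=> fg [u [w [pu pw w0 fE]]]; exists u, w.
by split=> // y Zy wy; rewrite -fg ?inE // fE.
Qed.

End Rational.
End FunctionAlgebras.

(** Continuity within [X] at a single point, so that real functions continuous at [x] form a
    function algebra and local formulas may change from point to point. *)
Definition cont_at (T S : topologicalType) (X : set T) (x : T) (f : T -> S) :=
  f @ within X (nbhs x) --> f x.

Section WithinContinuity.
Context {T : topologicalType}.

Lemma cont_at_within (S : topologicalType) (X : set T) (f : T -> S) :
  {within X, continuous f} <-> forall x, X x -> cont_at X x f.
Proof. exact: subspace_continuousP. Qed.

Lemma cont_at_near (S : topologicalType) (X : set T) x (f g : T -> S) : X x ->
  (\forall y \near within X (nbhs x), f y = g y) ->
  cont_at X x f -> cont_at X x g.
Proof.
move=> Xx fg hf; have E : f x = g x by move: fg => /nbhs_singleton /(_ Xx).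
rewrite /cont_at -E; refine (cvg_trans _ hf); apply: near_eq_cvg.
by apply: filterS fg => y.
Qed.

Lemma cont_at_eq (S : topologicalType) (X : set T) x (f g : T -> S) : X x ->
  (forall y, X y -> f y = g y) -> cont_at X x f -> cont_at X x g.
Proof. by move=> Xx fg; apply: cont_at_near => //; rewrite near_withinE; exact:
  nearW. Qed.

Lemma cont_at_sub (S : topologicalType) (X X' : set T) x (f : T -> S) :
  X' `<=` X -> cont_at X x f -> cont_at X' x f.
Proof.
move=> XX hf A /hf; rewrite /= /nbhs /= /within /=.
by apply: filterS => y h /XX; exact: h.
Qed.

Lemma cont_at_open (S : topologicalType) (X U : set T) x (f : T -> S) :
  open U -> U x -> cont_at (X `&` U) x f -> cont_at X x f.
Proof.
move=> oU Ux hf A /hf; rewrite /= /nbhs /= /within /= => h.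
have Un : nbhs x U by exact: open_nbhs_nbhs.
by apply: filterS2 h Un => y h Uy Xy; exact: h.
Qed.

Lemma cont_at_comp (S W : topologicalType) (D : set T) p (g : T -> S)
    (X : set S) (f : S -> W) : (forall q, D q -> X (g q)) ->
  cont_at D p g -> cont_at X (g p) f -> cont_at D p (f \o g).
Proof.
move=> DX hg hf A /hf /hg; rewrite /= /nbhs /= /within /=.
by apply: filterS => y h Dy; apply: h => //; exact: DX.
Qed.

Lemma cont_at_cst (S : topologicalType) (X : set T) x (a : S) :
  cont_at X x (fun=> a).
Proof. exact: cvg_cst. Qed.

Lemma cont_at_pair (S W : topologicalType) (X : set T) x (f : T -> S)
    (g : T -> W) : cont_at X x f -> cont_at X x g ->
  cont_at X x (fun y => (f y, g y)).
Proof. by move=> hf hg; apply: cvg_pair. Qed.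

Lemma cont_at_id (X : set T) x : cont_at X x id.
Proof. by move=> A h; apply: filterS h => y Ay _. Qed.

Lemma cont_at_continuous (S : topologicalType) (X : set T) x (f : T -> S) :
  {for x, continuous f} -> cont_at X x f.
Proof.
move=> hf A /hf; rewrite /= /nbhs /= /within /=.
by apply: filterS => y h _.
Qed.

Context {R : realType}.

Lemma cont_at_algebra (X : set T) x : @function_algebra R T (cont_at X x).
Proof.
split=> [a|f g hf hg|f g hf hg]; first exact: cvg_cst.
- exact: (cvgD hf hg).
- exact: (cvgM hf hg).
Qed.

Lemma cont_at_inv (X : set T) x (f : T -> R) : f x != 0 -> cont_at X x f ->
  cont_at X x (fun y => (f y)^-1).
Proof. by move=> f0 hf; exact: (cvgV f0 hf). Qed.

Lemma cont_at_neq0 (X : set T) x (f : T -> R) : cont_at X x f -> f x != 0 ->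
  exists2 O : set T, open O /\ O x & forall y, X y -> O y -> f y != 0.
Proof.
move=> hf f0.
have := cvgr_neq0 _ hf f0.
rewrite near_withinE => hn; exists (interior [set y | X y -> f y != 0]).
  by split; [exact: open_interior|exact: hn].
by move=> y Xy /interior_subset; exact.
Qed.

End WithinContinuity.

Lemma cont_at_fst (S T : topologicalType) (X : set (S * T)) p :
  cont_at X p fst.
Proof. by apply: cont_at_continuous; exact: cvg_fst. Qed.

Lemma cont_at_snd (S T : topologicalType) (X : set (S * T)) p :
  cont_at X p snd.
Proof. by apply: cont_at_continuous; exact: cvg_snd. Qed.

(** * The entrywise norm and perturbations of the identity matrix *)

Section EntrywiseNorm.
Context {R : realType}.

(** Submultiplicative for rectangular matrices too. The identity has norm [n], not [1], which is the
    origin of the hypothesis [D%:R <= b] in the gluing. *)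
Definition sumnorm m n (A : 'M[R]_(m, n)) : R := \sum_i \sum_j `|A i j|.

Lemma sumnorm_ge0 m n (A : 'M[R]_(m, n)) : 0 <= sumnorm A.
Proof. by apply: sumr_ge0 => i _; apply: sumr_ge0. Qed.

Lemma ler_sumnormD m n (A B : 'M[R]_(m, n)) :
  sumnorm (A + B) <= sumnorm A + sumnorm B.
Proof.
rewrite -big_split ler_sum // => i _; rewrite -big_split ler_sum // => j _.
by rewrite mxE ler_normD.
Qed.

Lemma sumnormZ m n r (A : 'M[R]_(m, n)) : sumnorm (r *: A) = `|r| * sumnorm A.
Proof.
rewrite mulr_sumr; apply: eq_bigr => i _; rewrite mulr_sumr.
by apply: eq_bigr => j _; rewrite mxE normrM.
Qed.

Lemma sumnormN m n (A : 'M[R]_(m, n)) : sumnorm (- A) = sumnorm A.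
Proof. by rewrite -scaleN1r sumnormZ normrN1 mul1r. Qed.

Lemma sumnormC m n (A B : 'M[R]_(m, n)) : sumnorm (A - B) = sumnorm (B - A).
Proof. by rewrite -sumnormN opprB. Qed.

Lemma sumnorm0 m n : sumnorm (0 : 'M[R]_(m, n)) = 0.
Proof. by rewrite -[X in sumnorm X](scale0r 0) sumnormZ normr0 mul0r. Qed.

Lemma sumnorm_eq0 m n (A : 'M[R]_(m, n)) : sumnorm A = 0 -> A = 0.
Proof.
move/eqP; rewrite psumr_eq0 => [/allP h|i _]; last exact: sumr_ge0.
apply/matrixP => i j; rewrite mxE.
have /(_ (mem_index_enum _)) := h i; rewrite psumr_eq0 // => /allP /(_ j).
by rewrite mem_index_enum normr_eq0 => /(_ isT)/eqP.
Qed.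

Lemma ler_entry_sumnorm m n (A : 'M[R]_(m, n)) i j : `|A i j| <= sumnorm A.
Proof.
rewrite /sumnorm (bigD1 i) //= (bigD1 j) //= -addrA lerDl addr_ge0 //.
  exact: sumr_ge0.
by apply: sumr_ge0 => k _; exact: sumr_ge0.
Qed.

Lemma ler_sumnormM m n p (A : 'M[R]_(m, n)) (B : 'M[R]_(n, p)) :
  sumnorm (A *m B) <= sumnorm A * sumnorm B.
Proof.
rewrite /sumnorm mulr_suml ler_sum // => i _.
apply: (@le_trans _ _ (\sum_j \sum_k `|A i k| * `|B k j|)).
  apply: ler_sum => j _; rewrite mxE; apply: (le_trans (ler_norm_sum _ _ _)).
  by apply: ler_sum => k _; rewrite normrM.
rewrite exchange_big mulr_suml ler_sum // => k _ /=.
rewrite -mulr_sumr ler_wpM2l // (bigD1 k) //= lerDl.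
by apply: sumr_ge0 => l _; exact: sumr_ge0.
Qed.

Lemma sumnorm1 n : sumnorm (1%:M : 'M[R]_n) = n%:R.
Proof.
rewrite /sumnorm (eq_bigr (fun=> 1)) ?sumr_const ?card_ord // => i _.
rewrite (bigD1 i) //= big1 ?addr0 ?mxE ?eqxx ?normr1 // => j /negPf ji.
by rewrite mxE eq_sym ji normr0.
Qed.

(** A row killed by [U] satisfies [v = v *m (1%:M - U)], a strict contraction, hence vanishes. *)
Lemma unitmx_near1 n (U : 'M[R]_n) : sumnorm (U - 1%:M) < 1 -> U \in unitmx.
Proof.
move=> h; rewrite -row_free_unit; apply: inj_row_free => v vU.
apply: sumnorm_eq0; apply/eqP; rewrite eq_le sumnorm_ge0 andbT.
have vE : v = v *m (1%:M - U) by rewrite mulmxBr mulmx1 vU subr0.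
have := ler_sumnormM v (1%:M - U); rewrite -vE sumnormC.
have := sumnorm_ge0 v; nra.
Qed.

(** In [invmx U = 1%:M - (U - 1%:M) *m invmx U] the last term has at most half the norm of the
    inverse and is absorbed by the left-hand side. *)
Lemma sumnorm_inv_near1 n (U : 'M[R]_n) :
  sumnorm (U - 1%:M) <= 2^-1 -> sumnorm (invmx U) <= 2 * n%:R.
Proof.
move=> h; have uU : U \in unitmx by apply: unitmx_near1; lra.
have iE : invmx U = 1%:M - (U - 1%:M) *m invmx U.
  by rewrite mulmxBl mulmxV // mul1mx subKr.
have := ler_sumnormD 1%:M (- ((U - 1%:M) *m invmx U)).
rewrite -iE sumnormN sumnorm1.
have := ler_sumnormM (U - 1%:M) (invmx U); have := sumnorm_ge0 (invmx U); nra.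
Qed.

Lemma cont_at_sumnorm (T : topologicalType) (X : set T) x m n
    (A : T -> 'M[R]_(m, n)) :
  entries (cont_at X x) A -> cont_at X x (fun y => sumnorm (A y)).
Proof.
move=> hA; apply: (falg_sum (cont_at_algebra X x)) => i.
apply: (falg_sum (cont_at_algebra X x)) => j; exact: cvg_norm (hA i j).
Qed.

Lemma cont_at_squeeze (T : topologicalType) (X : set T) x m n
    (A : T -> 'M[R]_(m, n)) (B : 'M[R]_(m, n)) (f : T -> R) :
  A x = B -> f @ within X (nbhs x) --> (0 : R) ->
  (\forall y \near within X (nbhs x), sumnorm (A y - B) <= f y) ->
  entries (cont_at X x) A.
Proof.
move=> AB f0 h i j; rewrite /cont_at AB.
apply/cvgrPdist_lt => e e0; near=> y.
have -> : B i j - A y i j = - ((A y - B) i j) by rewrite !mxE opprB.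
rewrite normrN; apply: (le_lt_trans (ler_entry_sumnorm _ _ _)).
apply: (@le_lt_trans _ _ (f y)); first by near: y.
apply: (le_lt_trans (ler_norm _)).
by near: y; move/cvgr0_norm_lt: f0; apply.
Unshelve. all: by end_near.
Qed.

End EntrywiseNorm.

(** * Zariski structures presented by generators *)

Section Presentations.
Context {R : realType}.

Definition generated_open (T I : Type) (c : I -> T -> R) (O : set T) :=
  forall t, O t -> exists h, [/\ polynomial_in c h, h t != 0 &
    forall s, h s != 0 -> O s].

(** Coordinate functions that determine both the Zariski topology and the sheaf. The notion passes
    to induced structures, isomorphic spaces and products, so varieties, [F^n] and total spaces of
    bundles share one description. *)
Definition presented_by (X : function_space R) (I : Type) (c : I -> X -> R) :=
  (forall O, zariski_open O <-> generated_open c O) /\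
  (forall O f, zariski_open O ->
     (regular_fun O f <-> forall t, O t -> rational_on c [set t] O f)).

Lemma polynomial_comp (T S I : Type) (c : I -> T -> R) (i : S -> T) h :
  polynomial_in (fun k s => c k (i s)) h <->
  exists2 g, polynomial_in c g & h = g \o i.
Proof.
split=> [|[g pg ->]].
  elim=> [a|k|f g _ [f' pf' ->] _ [g' pg' ->]|f g _ [f' pf' ->] _ [g' pg' ->]].
  - by exists (fun=> a) => //; exact: PolyCst.
  - by exists (c k) => //; exact: PolyGen.
  - by exists (fun x => f' x + g' x) => //; exact: PolyAdd.
  - by exists (fun x => f' x * g' x) => //; exact: PolyMul.
elim: pg => [a|k|f {}g _ pf _ pg|f {}g _ pf _ pg].
- exact: PolyCst.
- exact: (PolyGen (fun k s => c k (i s))).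
- exact: PolyAdd pf pg.
- exact: PolyMul pf pg.
Qed.

Lemma generated_open_principal (T I : Type) (c : I -> T -> R) h :
  polynomial_in c h -> generated_open c [set t | h t != 0].
Proof. by move=> ph t ht; exists h. Qed.

Lemma generated_openI (T I : Type) (c : I -> T -> R) (O O' : set T) :
  generated_open c O -> generated_open c O' -> generated_open c (O `&` O').
Proof.
move=> hO hO' t [/hO[h [ph ht hs]] /hO'[h' [ph' ht' hs']]].
exists (fun x => h x * h' x); split; first exact: PolyMul.
  by rewrite mulf_neq0.
by move=> s; rewrite mulf_eq0 negb_or => /andP[/hs ? /hs' ?].
Qed.

Lemma generated_openT (T I : Type) (c : I -> T -> R) : generated_open c setT.
Proof.
by move=> t _; exists (fun=> 1); split=> //; exact: PolyCst.
Qed.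

Lemma poly_eval_polynomial N f :
  polynomial_in (fun (j : 'I_N) (x : 'rV[R]_N) => x 0 j) f <->
  exists P, f = @poly_eval R N P.
Proof.
split.
  elim=> [a|j|{}f g _ [P ->] _ [Q ->]|{}f g _ [P ->] _ [Q ->]].
  - by exists (mpoly.mpolyC N a); apply/funext => x;
    rewrite /poly_eval mpoly.mevalC.
  - by exists (mpoly.mpolyX R (mpoly.mnm1 j)); apply/funext => x;
      rewrite /poly_eval mpoly.mevalXU.
  - by exists (P + Q); apply/funext => x; rewrite /poly_eval mpoly.mevalD.
  - by exists (P * Q); apply/funext => x; rewrite /poly_eval mpoly.mevalM.
move=> [P ->]; set c := fun _ _ => _.
rewrite (_ : poly_eval P = fun x => \sum_(m <- mpoly.msupp P)
    mpoly.mcoeff m P * \prod_i c i x ^+ m i); last first.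
  by apply/funext => x; rewrite /poly_eval mpoly.mevalE.
apply: (falg_sum (polynomial_algebra c)) => m.
apply: (falgM (polynomial_algebra c)); first exact: PolyCst.
apply: (falg_prod (polynomial_algebra c)) => i.
elim: (m i) => [|k IH].
  by rewrite (_ : (fun _ => _) = fun=> 1) //; exact: PolyCst.
rewrite (_ : (fun _ => _) = fun x => c i x * c i x ^+ k).
  exact: (PolyMul (PolyGen c i) IH).
by apply/funext => x; rewrite exprS.
Qed.

Lemma presented_affine N :
  @presented_by (affine_space N) _ (fun (j : 'I_N) (x : 'rV[R]_N) => x 0 j).
Proof.
have openE (O : set 'rV[R]_N) : algebraic_subset (~` O) <->
    generated_open (fun (j : 'I_N) (x : 'rV[R]_N) => x 0 j) O.
  split=> [[S SE] x Ox|hO].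
    have : ~ (~` O) x by [].
    rewrite SE /= => /existsNP[P] /not_implyP[SP] /eqP Px.
    exists (poly_eval P); split=> //; first by apply/poly_eval_polynomial;
      exists P.
    move=> y Py; apply: contrapT => nOy; have : (~` O) y by [].
    by rewrite SE => /(_ _ SP) /eqP; apply/negP.
  (* The complement of [O] is cut out by all polynomials that vanish off [O]. *)
  exists [set P | forall x, poly_eval P x != 0 -> O x].
  apply/seteqP; split=> x /=.
    by move=> nOx P hP; apply/eqP; apply/negPn/negP => /hP.
  move=> h Ox; have [f [/poly_eval_polynomial[P ->] Px hP]] := hO x Ox.
  by move: Px; rewrite h ?eqxx.
split=> [ O|O f oO]; first exact: openE.
split=> [ [_ h] x Ox|h].
  have [P [Q [ O' [/openE oO' O'x fE]]]] := h x Ox.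
  have [k [pk kx kO']] := oO' x O'x.
  (* The factor [k] confines the nonzero set of the denominator to [O'], where the formula for [f]
     holds. *)
  exists (fun x => poly_eval P x * k x), (fun x => poly_eval Q x * k x); split.
  + by apply: PolyMul => //; apply/poly_eval_polynomial; exists P.
  + by apply: PolyMul => //; apply/poly_eval_polynomial; exists Q.
  + by move=> y ->; rewrite mulf_neq0 //; have [] := fE x Ox O'x.
  + move=> y Oy; rewrite mulf_eq0 negb_or => /andP[Qy ky].
    have [_ ->] := fE y Oy (kO' _ ky).
    by rewrite -mulf_div divff // mulr1.
split=> // x Ox; have [u [w [pu pw w0 fE]]] := h x Ox.
have [P uE] := (poly_eval_polynomial u).1 pu.
have [Q wE] := (poly_eval_polynomial w).1 pw.
exists P, Q, [set x | w x != 0]; split.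
- exact/openE/generated_open_principal.
- exact: w0.
- by move=> y Oy wy; rewrite -uE -wE; split=> //; exact: fE.
Qed.

Lemma regular_polynomial (X : function_space R) I (c : I -> X -> R) f :
  presented_by c -> polynomial_in c f -> regular_fun setT f.
Proof.
move=> [oc rc] pf; apply/rc; first exact/oc/generated_openT.
by move=> t _; exact: rational_polynomial.
Qed.

Lemma presented_induced (T : Type) (X : function_space R) (i : T -> X)
    (I : Type) (c : I -> X -> R) : presented_by c ->
  @presented_by (induced_space i) I (fun k t => c k (i t)).
Proof.
move=> [oc rc].
have openE (O : set T) : [set i @^-1` U | U in @zariski_open R X] O <->
    generated_open (fun k t => c k (i t)) O.
  split=> [[U /oc oU <-] t /oU[h [ph ht hU]]|hO].
    exists (h \o i); split=> //; first by apply/polynomial_comp; exists h.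
    by move=> s; exact: hU.
  exists [set x | exists h, [/\ polynomial_in c h, h x != 0 &
     forall s, h (i s) != 0 -> O s]].
    apply/oc => x [h [ph hx hO']]; exists h; split=> // s hs; by exists h.
  apply/seteqP; split=> t /=; first by move=> [h [_ ht]]; apply.
  by move=> /hO[h [/polynomial_comp[g pg ->] gt gO]]; exists g.
split=> [ O|O f oO]; first exact: openE.
split=> [ [_ h] t Ot|h].
  have [U [g [zU Ut /(rc _ _ zU) rg fE]]] := h t Ot.
  have [u [w [pu pw w0 gE]]] := rg _ Ut.
  have [k [pk kt kU]] := (oc _).1 zU _ Ut.
  exists (fun s => u (i s) * k (i s)), (fun s => w (i s) * k (i s)); split.
  + by apply/polynomial_comp; exists (fun x => u x * k x) => //; exact: PolyMul.
  + by apply/polynomial_comp; exists (fun x => w x * k x) => //; exact: PolyMul.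
  + by move=> y ->; rewrite mulf_neq0 // w0.
  + move=> y Oy; rewrite mulf_eq0 negb_or => /andP[wy ky].
    rewrite fE //; last exact: kU.
    by rewrite gE -?mulf_div ?divff ?mulr1 //; exact: kU.
split=> // t Ot; have [u [w [/polynomial_comp[u' pu' ->]
  /polynomial_comp[w' pw' ->] w0 fE]]] := h t Ot.
have oD : zariski_open [set x | w' x != 0] by exact/oc/generated_open_principal.
exists [set x | w' x != 0], (fun x => u' x / w' x); split=> //; first exact: w0.
by apply/rc => // x w'x; exists u', w'; split=> // y ->.
Qed.

Lemma presented_iso (X Y : function_space R) (f : X -> Y) (g : Y -> X)
    (I : Type) (c : I -> Y -> R) :
  regular_map f -> regular_map g -> cancel f g -> cancel g f ->
  presented_by c -> presented_by (fun k x => c k (f x)).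
Proof.
move=> rf rg fK gK [oc rc].
have preK (O : set X) : f @^-1` (g @^-1` O) = O.
  by apply/seteqP; split=> x /=; rewrite fK.
have openE (O : set X) : zariski_open O <->
    generated_open (fun k x => c k (f x)) O.
  split=> [/rg[/oc oO _] t Ot|hO].
    have gft : (g @^-1` O) (f t) by rewrite /= fK.
    have [h [ph ht hO]] := oO _ gft.
    exists (h \o f); split=> //; first by apply/polynomial_comp; exists h.
    by move=> s /hO /=; rewrite fK.
  rewrite -(preK O); apply: (rf _ _).1; apply/oc => y /= /hO.
  move=> [h [/polynomial_comp[k pk ->]]]; rewrite /= gK => ky kO.
  by exists k; split=> // s ks; apply: kO; rewrite /= gK.
split=> [ O|O h oO]; first exact: openE.
have goO := (rg _ oO).1.
split=> [rh t Ot|hh].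
  have /(rc _ _ goO) rhg := (rg _ oO).2 _ rh.
  have gft : (g @^-1` O) (f t) by rewrite /= fK.
  have [u [w [pu pw w0 hE]]] := rhg _ gft.
  exists (u \o f), (w \o f); split.
  - by apply/polynomial_comp; exists u.
  - by apply/polynomial_comp; exists w.
  - by move=> y ->; exact: w0.
  - by move=> y Oy wy; rewrite -hE //= fK.
rewrite -(preK O) (_ : h = (h \o g) \o f); last by apply/funext => x /=;
  rewrite fK.
apply: (rf _ goO).2; apply/rc => // y /= /hh.
move=> [u [w [/polynomial_comp[u' pu' ->] /polynomial_comp[w' pw' ->] w0 hE]]].
exists u', w'; split=> // [z ->|z Oz wz].
  by have := w0 _ erefl; rewrite /= gK.
by rewrite /= hE //= gK.
Qed.

Lemma rational_comp (T S I : Type) (c : I -> T -> R) (i : S -> T)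
    (Y : set S) (Y' : set T) (Z : set T) f :
  i @` Y `<=` Y' -> rational_on c Y' Z f ->
  rational_on (fun k s => c k (i s)) Y (i @^-1` Z) (f \o i).
Proof.
move=> YY' [u [w [pu pw w0 fE]]]; exists (u \o i), (w \o i); split.
- by apply/polynomial_comp; exists u.
- by apply/polynomial_comp; exists w.
- by move=> y Yy; apply: w0; apply: YY'; exists y.
- by move=> y Zy wy; exact: fE.
Qed.

(** Only points of [A] are constrained by [rational_on c _ A], so the same pair of polynomials
    serves on the subspace and on the whole space. *)
Lemma rational_subspace (T I : Type) (c : I -> T -> R) (A : set T)
    (a : set_type A) f :
  rational_on (fun k (s : set_type A) => c k (set_val s)) [set a] setT
    (fun s => f (set_val s)) <-> rational_on c [set set_val a] A f.
Proof.
split=> [[u [w [/polynomial_comp[u' pu' ->] /polynomial_comp[w' pw' ->] w0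
  fE]]]|].
  exists u', w'; split=> // [y ->|y Ay w'y]; first exact: w0.
  by have := fE (SigSub (mem_set Ay)) Logic.I; apply.
move=> hf; have := @rational_comp T (set_type A) I c set_val [set a] _ A f
  (_ : _ `<=` [set set_val a]).
move=> /(_ _ hf) h.
apply: rational_sub (h _) => //; first by move=> s _; exact: set_valP.
by move=> _ [s -> <-].
Qed.

Lemma rational_pullback (T S I J : Type) (c : I -> T -> R) (c' : J -> S -> R)
    (f : T -> S) (t : T) h :
  (forall j, rational_on c [set t] setT (c' j \o f)) -> polynomial_in c' h ->
  rational_on c [set t] setT (h \o f).
Proof.
move=> hf; elim=> [a|j|{}h g _ rh _ rg|{}h g _ rh _ rg]; last 2 first.
- exact: falgD (rational_algebra _ _ _) _ _ rh rg.
- exact: falgM (rational_algebra _ _ _) _ _ rh rg.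
- exact: falg_cst (rational_algebra _ _ _) _.
- exact: hf.
Qed.

(** Regularity may be tested on coordinates, because a polynomial in rational functions is rational
    and its nonvanishing is a Zariski open condition. *)
Lemma regular_mapP (X Y : function_space R) (I J : Type) (c : I -> X -> R)
    (c' : J -> Y -> R) (f : X -> Y) : presented_by c -> presented_by c' ->
  regular_map f <-> forall j t, rational_on c [set t] setT (c' j \o f).
Proof.
move=> [oc rc] [oc' rc']; split=> [rf j t|hf O oO].
  have oT : zariski_open [set: Y] by exact/oc'/generated_openT.
  have oTX : zariski_open [set: X] by exact/oc/generated_openT.
  apply: ((rc _ _ oTX).1 _ t Logic.I); apply: (rf setT oT).2.
  by apply/(rc' _ _ oT) => s _; exact/rational_polynomial/PolyGen.
have goO : generated_open c (f @^-1` O).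
  move=> t /= /((oc' _).1 oO)[h [ph ht hO]].
  have [u [w [pu pw w0 hE]]] := rational_pullback (fun j => hf j t) ph.
  exists (fun x => u x * w x); split; first exact: PolyMul.
    move: (ht); have /= -> := hE t Logic.I (w0 _ erefl).
    by rewrite !mulf_eq0 invr_eq0.
  move=> s; rewrite mulf_eq0 negb_or => /andP[us ws]; apply: hO.
  by have /= -> := hE s Logic.I ws; rewrite mulf_neq0 ?invr_eq0.
split=> [|h /(rc' _ _ oO) rh]; first exact/oc.
apply/rc => [|t Ot]; first exact/oc.
have [u [w [pu pw w0 hE]]] := rh _ Ot.
have st : [set t] `<=` f @^-1` O by move=> _ ->.
have sub k : polynomial_in c' k -> rational_on c [set t] (f @^-1` O) (k \o f).
  by move=> pk; apply: rational_sub (rational_pullback (fun j => hf j t) pk).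
apply: (rational_local st (sub _ pw)) => [y ->|]; first exact: w0.
have wV : rational_on c [set t] (f @^-1` O) (fun x => (w (f x))^-1).
  by apply: rational_inv (sub _ pw) _ => // y ->; exact: w0.
have uwV := falgM (rational_algebra _ _ _) (sub _ pu) wV.
apply: (@rational_ext _ _ _ _ _ _ (fun x => (u \o f) x / w (f x))).
  by move=> y; rewrite inE => -[Oy wy] /=; rewrite hE.
by apply: rational_sub uwV => // y [].
Qed.

End Presentations.

(** * Products: the tensor description of the sheaf agrees with the one by coordinates *)

Section ProductPresentation.
Context {R : realType} (X Y : function_space R) (I J : Type)
  (c : I -> X -> R) (c' : J -> Y -> R).
Hypotheses (hc : presented_by c) (hc' : presented_by c').

Definition product_generators (k : I + J) (p : X * Y) : R :=
  match k with inl i => c i p.1 | inr j => c' j p.2 end.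

Local Notation cp := product_generators.

Lemma product_polynomial1 h : polynomial_in c h -> polynomial_in cp (h \o fst).
Proof.
elim=> [a|i|f g _ pf _ pg|f g _ pf _ pg].
- exact: PolyCst.
- exact: (PolyGen cp (inl i)).
- exact: PolyAdd pf pg.
- exact: PolyMul pf pg.
Qed.

Lemma product_polynomial2 h : polynomial_in c' h -> polynomial_in cp (h \o snd).
Proof.
elim=> [a|i|f g _ pf _ pg|f g _ pf _ pg].
- exact: PolyCst.
- exact: (PolyGen cp (inr i)).
- exact: PolyAdd pf pg.
- exact: PolyMul pf pg.
Qed.

Lemma product_tensor_fintype (U : set X) (W : set Y) (K : finType)
    (a : K -> X -> R) (b : K -> Y -> R) :
  (forall k, regular_fun U (a k)) -> (forall k, regular_fun W (b k)) ->
  product_tensor U W (fun p => \sum_k a k p.1 * b k p.2).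
Proof.
move=> ra rb; exists #|K|, (fun i => a (enum_val i)), (fun i => b (enum_val i)).
split=> // p; rewrite (reindex (@enum_val K K)) //.
by exists (@enum_rank K) => x _; rewrite ?enum_valK ?enum_rankK.
Qed.

(** Expansion of a polynomial in two groups of variables into finitely many products; the index
    types are added for a sum and multiplied for a product. *)
Lemma polynomial_tensor h : polynomial_in cp h -> product_tensor setT setT h.
Proof.
have reg1 f : polynomial_in c f -> regular_fun setT f.
  exact: regular_polynomial hc.
have reg2 f : polynomial_in c' f -> regular_fun setT f.
  exact: regular_polynomial hc'.
pose tensor (p : X * Y -> R) := exists (K : finType) (a : K -> X -> R)
  (b : K -> Y -> R), [/\ forall k, polynomial_in c (a k),
    forall k, polynomial_in c' (b k) & forall q,
      p q = \sum_k a k q.1 * b k q.2].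
move=> ph; suff [K [a [b [pa pb hE]]]] : tensor h.
  rewrite (funext hE : h = _); apply: product_tensor_fintype => k.
    exact: reg1.
  exact: reg2.
elim: ph => [r|[i|j]|f g _ [K [a [b [pa pb fE]]]] _ [L [a' [b' [pa' pb' gE]]]]|
    f g _ [K [a [b [pa pb fE]]]] _ [L [a' [b' [pa' pb' gE]]]]].
- exists unit, (fun _ _ => r), (fun _ _ => 1); split=> [k|k|q].
  + exact: PolyCst.
  + exact: PolyCst.
  + by rewrite big_const card_unit /= addr0 mulr1.
- exists unit, (fun _ => c i), (fun _ _ => 1); split=> [k|k|q].
  + exact: PolyGen.
  + exact: PolyCst.
  + by rewrite big_const card_unit /= addr0 mulr1.
- exists unit, (fun _ _ => 1), (fun _ => c' j); split=> [k|k|q].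
  + exact: PolyCst.
  + exact: PolyGen.
  + by rewrite big_const card_unit /= addr0 mul1r.
- exists (K + L)%type,
    (fun k => match k with inl k => a k | inr l => a' l end),
    (fun k => match k with inl k => b k | inr l => b' l end).
  by split=> [[]|[]|q] //; rewrite fE gE big_sumType.
- exists (K * L)%type, (fun k x => a k.1 x * a' k.2 x),
    (fun k x => b k.1 x * b' k.2 x); split=> [k|k|q].
  + exact: PolyMul.
  + exact: PolyMul.
  + rewrite fE gE big_distrlr /= pair_bigA /=.
    by apply: eq_bigr => k _; rewrite mulrACA.
Qed.

Lemma tensor_rational (U : set X) (W : set Y) h p : zariski_open U ->
  zariski_open W -> product_tensor U W h -> U p.1 -> W p.2 ->
  rational_on cp [set p] (fst @^-1` U `&` snd @^-1` W) h.
Proof.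
move=> oU oW [k [a [b [ra rb /funext ->]]]] Up Wp.
pose rA := rational_algebra cp [set p] (fst @^-1` U `&` snd @^-1` W).
apply: (falg_sum rA) => i; apply: (falgM rA).
  have [u [w [pu pw w0 aE]]] := (hc.2 U (a i) oU).1 (ra i) _ Up.
  exists (u \o fst), (w \o fst); split; [exact: product_polynomial1| |..].
  - exact: product_polynomial1.
  - by move=> y ->; exact: w0.
  - by move=> y [Uy _] wy; exact: aE.
have [u [w [pu pw w0 bE]]] := (hc'.2 W (b i) oW).1 (rb i) _ Wp.
exists (u \o snd), (w \o snd); split; [exact: product_polynomial2| |..].
- exact: product_polynomial2.
- by move=> y ->; exact: w0.
- by move=> y [_ Wy] wy; exact: bE.
Qed.

Lemma product_basic_generated (U : set X) (W : set Y) h : zariski_open U ->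
  zariski_open W -> product_tensor U W h ->
  generated_open cp (product_basic_open U W h).
Proof.
move=> oU oW th p [Up Wp hp].
have [u [w [pu pw w0 hE]]] := tensor_rational oU oW th Up Wp.
have [g [pg gp gU]] := (hc.1 U).1 oU _ Up.
have [g' [pg' gp' gW]] := (hc'.1 W).1 oW _ Wp.
exists (fun q => g q.1 * (g' q.2 * (u q * w q))); split.
- apply: PolyMul; first exact: (product_polynomial1 pg).
  by apply: PolyMul; [exact: (product_polynomial2 pg')|exact: PolyMul].
- move: hp; rewrite hE //; last exact: w0.
  by rewrite !mulf_eq0 !negb_or gp gp' invr_eq0.
- move=> q; rewrite !mulf_eq0 !negb_or => /and4P[/gU Uq /gW Wq uq wq].
  by split=> //; rewrite hE // mulf_neq0 // invr_eq0.
Qed.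

Lemma presented_product : @presented_by _ (product_space X Y) _ cp.
Proof.
have oT1 : zariski_open [set: X] by exact/hc.1/generated_openT.
have oT2 : zariski_open [set: Y] by exact/hc'.1/generated_openT.
have openE (O : set (X * Y)) : (forall p, O p ->
      exists (U : set X) (W : set Y) (h : X * Y -> R),
        [/\ zariski_open U, zariski_open W, product_tensor U W h,
          product_basic_open U W h p & product_basic_open U W h `<=` O]) <->
    generated_open cp O.
  split=> [oO p Op|hO p Op].
    have [U [W [h [oU oW th ph hO]]]] := oO p Op.
    have [k [pk kp kb]] := product_basic_generated oU oW th ph.
    by exists k; split=> // q /kb /hO.
  have [h [ph hp hsub]] := hO p Op.
  exists setT, setT, h; split=> //; first exact: polynomial_tensor.
  by move=> q [_ _ hq]; exact: hsub.
split=> [ O|O f oO]; first exact: openE.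
split=> [[_ hf] p Op|hf].
  have [U [W [g [h [[oU oW] [tg th] hp hO fE]]]]] := hf p Op.
  have [k [pk kp kb]] := product_basic_generated oU oW th hp.
  have pO : [set p] `<=` O by move=> _ ->.
  apply: (rational_local pO (rational_polynomial _ _ pk)) => [y ->//|].
  have [Up Wp hp0] := hp.
  have rg := tensor_rational oU oW tg Up Wp.
  have rh := tensor_rational oU oW th Up Wp.
  have rhV : rational_on cp [set p] (fst @^-1` U `&` snd @^-1` W)
      (fun q => (h q)^-1).
    by apply: rational_inv rh _ => [_ ->|y ->].
  have rgh := falgM (rational_algebra _ _ _) rg rhV.
  apply: (@rational_ext _ _ _ _ _ _ (fun q => g q / h q)).
    by move=> y; rewrite inE => -[Oy ky] /=; rewrite fE //; exact: kb.
  by apply: rational_sub rgh => // y [Oy /kb[]].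
split; [exact: oO|move=> p Op]; have [u [w [pu pw w0 fE]]] := hf p Op.
have [k [pk kp kb]] := (openE O).1 oO p Op.
exists setT, setT, (fun q => u q * k q), (fun q => w q * k q); split=> //.
- by split; apply: polynomial_tensor; exact: PolyMul.
- by split=> //; rewrite mulf_neq0 // w0.
- by move=> q [_ _]; rewrite mulf_eq0 negb_or => /andP[_ /kb].
- move=> q [_ _]; rewrite mulf_eq0 negb_or => /andP[wq kq].
  by rewrite fE // -?mulf_div ?divff ?mulr1 //; exact: kb.
Qed.

End ProductPresentation.

Lemma variety_presented (R : realType) (V : function_space R) :
  real_algebraic_variety V ->
  exists N (c : 'I_N -> V -> R), presented_by c.
Proof.
move=> [N [A [_ [f [g [rf rg fK gK]]]]]].
eexists N, _; exact: (presented_iso rf rg fK gK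
  (presented_induced set_val (@presented_affine R N))).
Qed.

Lemma presented_vector_space (R : realType) (F : scalar_kind) n :
  @presented_by R (vector_space F n) _
    (fun (j : 'I_(n * scalar_dim F)) v => realify v 0 j).
Proof.
exact: (@presented_induced R _ (affine_space _) (@realify R F n) _ _
  (@presented_affine R _)).
Qed.

Lemma presented_total_space (R : realType) (F : scalar_kind)
    (V : function_space R) (I : Type) (c : I -> V -> R) n
    (E : set (V * 'rV[scalars R F]_n)) : presented_by c ->
  @presented_by R (total_space E) _ (fun k e =>
    @product_generators R V (vector_space F n) _ _ c
      (fun (j : 'I_(n * scalar_dim F)) v => realify v 0 j) k (set_val e)).
Proof.
move=> hc; apply: presented_induced.
exact: (presented_product hc (@presented_vector_space R F n)).
Qed.

Lemma regular_onP (R : realType) (F : scalar_kind)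
    (V : function_space R) (I : Type) (c : I -> V -> R) n
    (A : set V) (s : V -> 'rV[scalars R F]_n) : presented_by c ->
  @regular_on R V (vector_space F n) A s <->
  forall x, A x -> entries (rational_on c [set x] A) (fun y => realify (s y)).
Proof.
move=> hc.
apply: (iff_trans (regular_mapP _ (presented_induced set_val hc)
  (@presented_vector_space R F n))).
split=> [h x Ax i j|h j a].
  rewrite ord1.
  exact: ((rational_subspace c (SigSub (mem_set Ax))
    (fun y => realify (s y) 0 j)).1 (h j (SigSub (mem_set Ax)))).
have := h _ (set_valP a) 0 j => h'.
exact: ((rational_subspace c a (fun y => realify (s y) 0 j)).2 h').
Qed.

(** * Euclidean topology *)

Section ConvergenceCriteria.

Lemma cvg_initialP (S : choiceType) (T : topologicalType) (f : S -> T)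
    (U : Type) (G : set_system U) {FG : Filter G} (g : U -> S) (x : S) :
  g @ G --> (x : initial_topology f) <-> (f \o g) @ G --> f x.
Proof.
split=> [h|h].
  by apply: (cvg_comp _ _ h); exact: (@initial_continuous _ _ f x).
move=> A [B [[W oW <-] Wfx BA]]; apply: (filterS (P := (f \o g) @^-1` W)).
  by move=> u Wu; exact: BA.
by apply: h; exact: open_nbhs_nbhs.
Qed.

Lemma cvg_ptws (I U : Type) (T : topologicalType) (G : set_system U)
    {FG : Filter G} (g : U -> I -> T) (x : I -> T) :
  (forall i, (fun u => g u i) @ G --> x i) -> g @ G --> (x : {ptws I -> T}).
Proof.
move=> h; apply/cvg_sup => i; apply/cvg_initialP; exact: h.
Qed.

Lemma cvg_ptws_proj (I U : Type) (T : topologicalType) (G : set_system U)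
    {FG : Filter G} (g : U -> I -> T) (x : I -> T) i :
  g @ G --> (x : {ptws I -> T}) -> (fun u => g u i) @ G --> x i.
Proof. by move=> /cvg_sup /(_ i) /cvg_initialP. Qed.

Lemma cvg_mxP (T : topologicalType) m n U (G : set_system U) {FG : Filter G}
    (g : U -> 'M[T]_(m, n)) (M : 'M[T]_(m, n)) :
  g @ G --> M <-> forall i j, (fun u => g u i j) @ G --> M i j.
Proof.
split=> [h i j A Aij|h A [P hP PA]].
  apply: (h [set N | A (N i j)]).
  exists (fun k l => if (k == i) && (l == j) then A else setT) => [k l|N].
    by case: ifP => [/andP[/eqP -> /eqP ->] //|_]; exact: filterT.
  by move=> /(_ i j); rewrite !eqxx.
have : \forall u \near G, forall i j, P i j (g u i j).
  by apply: filter_forall => i; apply: filter_forall => j; exact: h.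
by apply: filterS => u hu; apply: PA => i j; exact: hu.
Qed.

Lemma cvg_set_valP (T : topologicalType) (A : set T) U (G : set_system U)
    {FG : Filter G} (g : U -> A) (a : A) :
  g @ G --> a <-> (fun u => set_val (g u)) @ G --> set_val a.
Proof. exact: cvg_initialP. Qed.

Lemma set_val_within (T : topologicalType) (A : set T) (a : A) :
  set_val @ nbhs a --> within A (nbhs (set_val a)).
Proof.
move=> B hB; have : nbhs a (set_val @^-1` [set x | A x -> B x]).
  by apply: (@initial_continuous _ _ set_val a); exact: hB.
by apply: filterS => b /=; apply; exact: set_valP.
Qed.

Lemma continuous_set_type (T S : topologicalType) (A : set T) (f : T -> S)
    (g : A -> S) : (forall a, f (set_val a) = g a) ->
  {within A, continuous f} <-> continuous g.
Proof.
move=> fg; split=> [/subspace_continuousP h a|h].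
  rewrite /continuous_at -(fg a).
  rewrite (_ : g = f \o set_val); last by apply/funext => b; rewrite /= fg.
  apply: cvg_comp; first exact: set_val_within.
  by apply: h; exact: set_valP.
apply/subspace_continuousP => x Ax; pose a : A := SigSub (mem_set Ax).
have E : f x = g a by rewrite -fg.
rewrite /from_subspace E => B /(h a) [C [[W oW <-] Wx CB]].
have : nbhs x W by apply: open_nbhs_nbhs; split.
apply: filterS => y Wy Ay; have /= := CB (SigSub (mem_set Ay)) Wy.
by rewrite /preimage /= -fg.
Qed.

Lemma continuous_set_type_map (T S : topologicalType) (A : set T) (B : set S)
    (f : T -> S) (phi : A -> B) :
  (forall a, f (set_val a) = set_val (phi a)) ->
  {within A, continuous f} -> continuous phi.
Proof.
move=> fphi hf a; apply/(@cvg_set_valP _ _ _ (nbhs a) _).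
exact: ((continuous_set_type fphi).1 hf a).
Qed.

End ConvergenceCriteria.

Section EuclideanTopology.
Context {R : realType} {F : scalar_kind}.

Lemma realify_entry n (v : 'rV[scalars R F]_n) k l :
  realify v 0 (mxvec_index k l) = scalar_coords (v 0 k) 0 l.
Proof. by rewrite /realify mxvecE mxE. Qed.

Lemma cvg_realifyP n U (G : set_system U) {FG : Filter G}
    (g : U -> 'rV[scalars R F]_n) v :
  g @ G --> v <-> forall i j, (fun u => realify (g u) i j) @ G -->
    realify v i j.
Proof.
have fE k l : (fun u => realify (g u) 0 (mxvec_index k l)) =
    (fun u => scalar_coords (g u 0 k) 0 l).
  by apply/funext => u; rewrite realify_entry.
split=> [/cvg_mxP h i j|h].
  rewrite ord1; case/mxvec_indexP: j => k l; rewrite realify_entry fE.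
  by have /cvg_initialP/cvg_mxP/(_ 0 l) := h 0 k.
apply/cvg_mxP => i k; rewrite ord1; apply/cvg_initialP/cvg_mxP => j l.
by rewrite ord1 /comp -fE -realify_entry.
Qed.

Context {V : function_space R} {I : Type} (c : I -> V -> R).
Hypothesis hc : presented_by c.

Lemma cvg_regular U (G : set_system U) {FG : Filter G} (g : U -> V) x f :
  g @ G --> x -> regular_fun setT f -> (f \o g) @ G --> f x.
Proof.
move=> /cvg_initialP h rf.
exact: (@cvg_ptws_proj _ _ _ _ _ _ _ (exist _ f rf) h).
Qed.

Lemma continuous_polynomial f : polynomial_in c f -> continuous f.
Proof.
move=> pf x.
exact: (cvg_regular (g := id) (@cvg_id _ (nbhs x)) (regular_polynomial hc pf)).
Qed.

(** The topology is defined by all global regular functions, but each of them is near a given point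
    a quotient of polynomials in the coordinates. *)
Lemma cvg_presentedP U (G : set_system U) {FG : Filter G} (g : U -> V) x :
  g @ G --> x <-> forall i, (c i \o g) @ G --> c i x.
Proof.
split=> [h i|h].
  by apply: (cvg_regular h); apply: (regular_polynomial hc); exact: PolyGen.
apply/cvg_initialP; apply: cvg_ptws => -[f rf] /=.
have pol k : polynomial_in c k -> (k \o g) @ G --> k x.
  elim=> [a|i|{}f' g' _ hf _ hg|{}f' g' _ hf _ hg].
  - exact: cvg_cst.
  - exact: h.
  - exact: cvgD hf hg.
  - exact: cvgM hf hg.
have oT : zariski_open [set: V] by exact/hc.1/generated_openT.
have [u [w [pu pw w0 fE]]] := (hc.2 _ f oT).1 rf x Logic.I.
have wx := w0 _ erefl; rewrite /global_evaluation /= fE //.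
have uw : (fun y => u (g y) / w (g y)) @ G --> u x / w x.
  by apply: cvgM (pol _ pu) _; exact: cvgV wx (pol _ pw).
refine (cvg_trans _ uw); apply: near_eq_cvg.
apply: (filterS _ (cvgr_neq0 _ (pol _ pw) wx)) => y wy.
by rewrite /= [RHS]fE.
Qed.

Lemma nbhs_presented x (A : set V) : nbhs x A ->
  exists2 e, 0 < e & forall y, (forall i, `|c i y - c i x| < e) -> A y.
Proof.
move=> xA; pose B e : set V := [set y | forall i, `|c i y - c i x| < e].
(* The filter of boxes around [x] converges to [x] in each coordinate, hence converges, which means
   that every neighborhood of [x] contains a box. *)
pose G := filter_from [set e : R | 0 < e] B.
have FG : Filter G.
  apply: filter_from_filter; first by exists 1; rewrite /= ltr01.
  move=> e e' e0 e'0; exists (Order.min e e'); first by rewrite /= lt_min e0.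
  by move=> y h; split=> i; have := h i; rewrite lt_min => /andP[].
suff /(_ A xA) : id @ G --> x by [].
apply/cvg_presentedP => i; apply/cvgrPdist_lt => e e0; exists e => // y h /=.
by rewrite distrC; exact: h.
Qed.

End EuclideanTopology.

(** * Frames and projectors *)

Arguments total_set {R F B} xi : rename.
Arguments bundle_proj {R F B} xi _ : rename.

Section RightInverse.
Context {R : realType}.

(** If [u] is killed by the Gram matrix, then the squared norm of [u *m B] is zero. *)
Lemma gram_unit m n (B : 'M[R]_(m, n)) : row_free B -> B *m B^T \in unitmx.
Proof.
move=> fB; rewrite -row_free_unit; apply: inj_row_free => u uB.
suff : u *m B = 0 by move/eqP; rewrite mulmx_free_eq0 // => /eqP.
have : (u *m B *m (u *m B)^T) 0 0 = 0.
  by rewrite trmx_mul !mulmxA -(mulmxA u) uB mul0mx mxE.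
move: (u *m B) => w; rewrite mxE => /eqP.
rewrite psumr_eq0 => [/allP h|i _]; last by rewrite [w^T i 0]mxE -expr2 sqr_ge0.
apply/rowP => i; have := h i (mem_index_enum _).
by rewrite [w^T i 0]mxE -expr2 sqrf_eq0 mxE => /eqP.
Qed.

(** For independent rows this is the Moore-Penrose inverse; it is rational in [B], and
    [right_inv B *m B] is the orthogonal projector onto the row space. *)
Definition right_inv m n (B : 'M[R]_(m, n)) := B^T *m mx_inv (B *m B^T).

Lemma right_invK m n (B : 'M[R]_(m, n)) : row_free B -> B *m right_inv B = 1%:M.
Proof.
by move=> /gram_unit uB; rewrite mulmxA mx_inv_unit // mulmxV.
Qed.

Lemma entries_right_inv T (P : set (T -> R)) m n (B : T -> 'M[R]_(m, n)) :
  function_algebra P -> entries P B ->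
  P (fun x => (\det (B x *m (B x)^T))^-1) ->
  entries P (fun x => right_inv (B x)).
Proof.
move=> hP hB hd; apply: entriesM => //; first exact: entries_tr.
by apply: entries_inv => //; apply: entriesM => //; exact: entries_tr.
Qed.

Lemma entries_det_gram T (P : set (T -> R)) m n (B : T -> 'M[R]_(m, n)) :
  function_algebra P -> entries P B -> P (fun x => \det (B x *m (B x)^T)).
Proof.
by move=> hP hB; apply: falg_det => //; apply: entriesM => //; exact:
  entries_tr.
Qed.

Lemma cont_right_inv (T : topologicalType) X (x : T) m n (B : T -> 'M[R]_(m,
  n)) :
  row_free (B x) -> entries (cont_at X x) B ->
  entries (cont_at X x) (fun x => right_inv (B x)).
Proof.
move=> fB hB; have hP := @cont_at_algebra _ R X x.
apply: entries_right_inv => //; apply: cont_at_inv; last exact: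
  entries_det_gram.
by have := gram_unit fB; rewrite unitmxE unitfE.
Qed.

Lemma rational_right_inv T I (c : I -> T -> R) (Y Z : set T) m n
    (B : T -> 'M[R]_(m, n)) : Y `<=` Z -> (forall y, Y y -> row_free (B y)) ->
  entries (rational_on c Y Z) B ->
  entries (rational_on c Y Z) (fun x => right_inv (B x)).
Proof.
move=> YZ fB hB; have hP := rational_algebra c Y Z.
apply: entries_right_inv => //; apply: rational_inv => //.
  exact: entries_det_gram.
by move=> y /fB /gram_unit; rewrite unitmxE unitfE.
Qed.

Definition orthogonal_projector n (W : set 'rV[R]_n) (p : 'M[R]_n) :=
  [/\ p^T = p, p *m p = p & forall u, W u <-> u *m p = u].

Lemma orthogonal_projector_uniq n (W : set 'rV[R]_n) p q :
  orthogonal_projector W p -> orthogonal_projector W q -> p = q.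
Proof.
move=> [pT pp Wp] [qT qq Wq].
have pq : p *m q = p.
  apply: eq_mx_rowmul => u; rewrite mulmxA; apply/Wq/Wp.
  by rewrite -mulmxA pp.
have qp : q *m p = q.
  apply: eq_mx_rowmul => u; rewrite mulmxA; apply/Wp/Wq.
  by rewrite -mulmxA qq.
by have := congr1 trmx qp; rewrite trmx_mul pT qT pq.
Qed.

(** Chosen from the subspace alone. Uniqueness identifies it with the formula of any local frame, so
    continuity and rationality are checked frame by frame. The default [0] stands for the absence of
    a projector. *)
Definition projector_onto n (W : set 'rV[R]_n) : 'M[R]_n :=
  xget 0 (orthogonal_projector W).

Lemma projector_ontoE n (W : set 'rV[R]_n) p :
  orthogonal_projector W p -> projector_onto W = p.
Proof.
move=> hp; apply: (@orthogonal_projector_uniq _ W) => //.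
exact: (xgetPex 0 (ex_intro _ p hp)).
Qed.

Lemma projector_row_span m n (B : 'M[R]_(m, n)) (W : set 'rV[R]_n) :
  row_free B -> (forall u, W u <-> exists w, u = w *m B) ->
  orthogonal_projector W (right_inv B *m B).
Proof.
move=> fB WE; have BK := right_invK fB; split.
- rewrite /right_inv mx_inv_unit ?gram_unit // !trmx_mul trmxK trmx_inv.
  by rewrite trmx_mul trmxK mulmxA.
- by rewrite mulmxA -(mulmxA (right_inv B)) BK mulmx1.
- move=> u; split=> [/WE[w ->]|<-]; last by apply/WE; rewrite mulmxA; eexists.
  by rewrite -mulmxA (mulmxA B) BK mul1mx.
Qed.

(** Symmetry and idempotence give [p i i = \sum_k p i k ^+ 2], so no entry exceeds [1] in absolute
    value. As the bound does not depend on the subspace, one constant serves all fibers. *)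
Lemma sumnorm_projector n (W : set 'rV[R]_n) p :
  orthogonal_projector W p -> sumnorm p <= (n * n)%:R.
Proof.
move=> [pT pp _]; have entry i j : `|p i j| <= 1.
  have diag : p i i = \sum_k p i k ^+ 2.
    rewrite -{1}pp mxE; apply: eq_bigr => k _.
    by rewrite -[in p k i]pT mxE expr2.
  have sq k : p i k ^+ 2 <= p i i.
    rewrite diag (bigD1 k) //= lerDl; apply: sumr_ge0 => l _; exact: sqr_ge0.
  have pii : p i i <= 1 by have := sq i; nra.
  by rewrite -(@expr_le1 _ 2) // real_normK ?num_real // (le_trans (sq j)).
apply: (@le_trans _ _ (\sum_(i < n) \sum_(j < n) 1)).
  by apply: ler_sum => i _; apply: ler_sum => j _.
by rewrite !sumr_const !card_ord -mulrnA.
Qed.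

End RightInverse.

Section LocalFrames.
Context {R : realType} {F : scalar_kind}.
Local Notation d := (scalar_dim F).
Local Notation Fn n := 'rV[scalars R F]_n.

Lemma scalar_linear_right_inv r n (B : 'M[R]_(r * d, n * d)) : row_free B ->
  @scalar_linear R F r n B -> @scalar_linear R F n r (right_inv B).
Proof.
move=> fB hB; apply: scalar_linearM; first exact: scalar_linear_tr.
rewrite mx_inv_unit ?gram_unit //; apply: scalar_linear_inv.
by apply: scalar_linearM => //; exact: scalar_linear_tr.
Qed.

Lemma cont_at_realify (T : topologicalType) (X : set T) x n (g : T -> Fn n) :
  cont_at X x g <-> entries (cont_at X x) (fun y => realify (g y)).
Proof. exact: cvg_realifyP. Qed.

Lemma cont_at_act (T : topologicalType) (X : set T) x m n
    (B : T -> 'M[R]_(m * d, n * d)) (g : T -> Fn m) :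
  entries (cont_at X x) B -> cont_at X x g ->
  cont_at X x (fun y => mx_act (B y) (g y)).
Proof.
move=> hB /cont_at_realify hg; apply/cont_at_realify.
apply: (@entries_ext _ _ _ _ _ (fun y => realify (g y) *m B y)).
  by move=> y; rewrite realify_act.
exact: (entriesM (cont_at_algebra X x)).
Qed.

(* The matrix of a frame over [O] at the points of [X `&` O]; its row space is
   the real form of the fiber [E y]. *)
Definition frame_on (B : topologicalType) n (X : set B)
    (E : B -> set (Fn n)) (O : set B) r (M : B -> 'M[R]_(r * d, n * d)) :=
  forall y, X y -> O y -> [/\ row_free (M y), @scalar_linear R F r n (M y),
    (forall v, E y v <-> exists w : Fn r, v = mx_act (M y) w) &
    entries (cont_at X y) M].

Lemma fiber_projector (B : topologicalType) n (X : set B)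
    (E : B -> set (Fn n)) O r (M : B -> 'M[R]_(r * d, n * d)) y :
  frame_on X E O M -> X y -> O y ->
  orthogonal_projector [set u | E y (unrealify u)] (right_inv (M y) *m M y).
Proof.
move=> hM Xy Oy; have [fM lM EM cM] := hM y Xy Oy.
apply: projector_row_span => // u; split=> [/EM[w wE]|[w ->]].
  by exists (realify w); rewrite -realify_act -wE unrealifyK.
by apply/EM; exists (unrealify w); rewrite /mx_act unrealifyK.
Qed.

Definition proj_fiber (B : topologicalType) n (E : B -> set (Fn n)) (y : B) :
    'M[R]_(n * d) := projector_onto [set u | E y (unrealify u)].

Lemma proj_fiberE (B : topologicalType) n (X : set B)
    (E : B -> set (Fn n)) O r (M : B -> 'M[R]_(r * d, n * d)) y :
  frame_on X E O M -> X y -> O y -> proj_fiber E y = right_inv (M y) *m M y.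
Proof. by move=> hM Xy Oy; apply: projector_ontoE; apply:
  fiber_projector hM _ _. Qed.

Definition has_frames (B : topologicalType) n (X : set B) (E : B ->
  set (Fn n)) :=
  forall x, X x -> exists O r (M : B -> 'M[R]_(r * d, n * d)),
    [/\ open O, O x & frame_on X E O M].

Lemma proj_fiberP (B : topologicalType) n (X : set B) (E : B -> set (Fn n)) x :
  has_frames X E -> X x ->
  [/\ (proj_fiber E x)^T = proj_fiber E x,
      proj_fiber E x *m proj_fiber E x = proj_fiber E x,
      forall v, E x v <-> realify v *m proj_fiber E x = realify v,
      @scalar_linear R F n n (proj_fiber E x) &
      entries (cont_at X x) (proj_fiber E)].
Proof.
move=> hE Xx; have [ O [r [M [oO Ox hM]]]] := hE x Xx.
have [pT pp Ep] := fiber_projector hM Xx Ox.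
have [fM lM EM cM] := hM x Xx Ox.
rewrite (proj_fiberE hM Xx Ox); split=> //.
- by move=> v; apply: iff_trans (Ep (realify v)); rewrite /= realifyK.
- exact: scalar_linearM (scalar_linear_right_inv fM lM) lM.
- move=> i j; apply: (@cont_at_near _ _ X x
    (fun y => (right_inv (M y) *m M y) i j)) => //.
    have : nbhs x O by exact: open_nbhs_nbhs.
    rewrite near_withinE; apply: filterS => y Oy Xy.
    by rewrite (proj_fiberE hM Xy Oy).
  apply: (entriesM (cont_at_algebra X x)) => //.
  exact: cont_right_inv.
Qed.

Section OverV.
Context {V : function_space R}.

Lemma subbundle_of_frames n (X : set V) (E : set (V * Fn n)) :
  (forall e, E e -> X e.1) -> has_frames X (fun x v => E (x, v)) ->
  topological_subbundle X E.
Proof.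
move=> EX hE; split=> //.
  by apply/cont_at_within => e _; exact: cont_at_fst.
move=> x Xx; have [ O [r [M [oO Ox hM]]]] := hE x Xx.
exists O; split=> //; split=> //; exists r.
exists (fun p => (p.1, mx_act (M p.1) p.2)).
exists (fun e => mx_act (right_inv (M e.1)) e.2); split.
- apply/cont_at_within => -[y w] [[/= Xy Oy] _].
  have [fM lM EM cM] := hM y Xy Oy.
  apply: cont_at_pair; first exact: cont_at_fst.
  apply: cont_at_act; last exact: cont_at_snd.
  move=> i j; apply: (@cont_at_comp _ _ _ _ _ fst X (fun y => M y i j)).
  + by move=> q [[]].
  + exact: cont_at_fst.
  + exact: cM.
- apply/cont_at_within => -[y w] [/= Ey Oy].
  have Xy := EX _ Ey; have [fM lM EM cM] := hM y Xy Oy.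
  apply: cont_at_act; last exact: cont_at_snd.
  move=> i j; apply: (@cont_at_comp _ _ _ _ _ fst X
    (fun y => right_inv (M y) i j)).
  + by move=> q [/EX].
  + exact: cont_at_fst.
  + exact: cont_right_inv.
- move=> y w Xy Oy; have [fM lM EM cM] := hM y Xy Oy; split=> //.
    by apply/EM; exists w.
  apply: realify_inj; rewrite !realify_act -mulmxA right_invK //.
  by rewrite mulmx1.
- move=> [y v] /= Ey Oy; have Xy := EX _ Ey.
  have [fM lM EM cM] := hM y Xy Oy; have [w ->] := (EM v).1 Ey.
  congr (_, _); apply: realify_inj; rewrite !realify_act.
  by rewrite -(mulmxA _ (M y)) right_invK // mulmx1.
- move=> y Xy Oy; have [fM lM EM cM] := hM y Xy Oy.
  by split=> [v w|a v]; rewrite /= ?mx_actD // mx_actZ.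
Qed.

(** The rows of [M y] are the images of the standard real basis under the trivialization followed by
    [iota]. The trivialization is returned as well, because the inverse of the embedding is
    expressed through it. *)
Lemma frames_of_embedding n (X : set V) (xi : vector_family R F V)
    (iota : ambient xi -> Fn n) : vector_bundle X xi ->
  {within total_set xi, continuous iota} ->
  (forall e e', total_set xi e -> total_set xi e' ->
     bundle_proj xi e = bundle_proj xi e' ->
     iota (fadd e e') = iota e + iota e') ->
  (forall a e, total_set xi e -> iota (fscale a e) = a *: iota e) ->
  (forall e e', total_set xi e -> total_set xi e' ->
     bundle_proj xi e = bundle_proj xi e' -> iota e = iota e' -> e = e') ->
  forall x, X x -> exists O r h k (M : V -> 'M[R]_(r * d, n * d)),
    [/\ open O, O x, @trivialization R F V X xi O r h k,
      (forall y w, X y -> O y -> iota (h (y, w)) = mx_act (M y) w) &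
      frame_on X (fun y v => exists e, [/\ total_set xi e,
        bundle_proj xi e = y & iota e = v]) O M].
Proof.
move=> [piX _ loc] ciota iotaD iotaZ iota_inj x Xx.
have [ O [oO [Ox [r [h [k triv]]]]]] := loc x Xx.
have [ch ck hP kK hlin] := triv.
pose M y : 'M[R]_(r * d, n * d) := mx_of (fun w => iota (h (y, w))).
have iD y : X y -> O y -> {morph (fun w => iota (h (y, w))) : v w / v + w}.
  move=> Xy Oy v w; have [-> _] := hlin y Xy Oy.
  have [t1 p1 _] := hP y v Xy Oy; have [t2 p2 _] := hP y w Xy Oy.
  by rewrite iotaD // p1 p2.
have iZ y a v : X y -> O y -> iota (h (y, a *: v)) = a *: iota (h (y, v)).
  move=> Xy Oy; have [_ ->] := hlin y Xy Oy.
  by have [t1 p1 _] := hP y v Xy Oy; rewrite iotaZ.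
have iM y w : X y -> O y -> iota (h (y, w)) = mx_act (M y) w.
  move=> Xy Oy; apply: realify_inj; rewrite realify_act.
  by apply: (mx_ofE w (iD y Xy Oy)) => a v; exact: iZ.
exists O, r, h, k, M; split=> // y Xy Oy; split.
- apply: inj_row_free => u uM.
  have E : h (y, unrealify u) = h (y, 0).
    have [t1 p1 _] := hP y (unrealify u) Xy Oy.
    have [t2 p2 _] := hP y 0 Xy Oy.
    apply: iota_inj => //; rewrite ?p1 ?p2 //.
    by apply: realify_inj; rewrite !iM // !realify_act unrealifyK uM realify0
      mul0mx.
  have [_ _ k1] := hP y (unrealify u) Xy Oy; have [_ _ k2] := hP y 0 Xy Oy.
  by rewrite -[u]unrealifyK -k1 E k2 realify0.
- by apply: scalar_linear_mx_of; [exact: iD|move=> a v; exact: iZ].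
- move=> v; split=> [[e [te pe <-]]|[w ->]].
    have Oe : O (bundle_proj xi e) by rewrite pe.
    exists (k e); rewrite -iM // -pe kK //.
  have [t1 p1 _] := hP y w Xy Oy.
  by exists (h (y, w)); rewrite iM.
- move=> i j; apply: (cont_at_open oO Oy).
  apply: (@cont_at_eq _ _ _ _
    (fun y => realify (iota (h (y, unrealify (delta_mx 0 i)))) 0 j)) => //.
    by move=> z _; rewrite /M mxE.
  have : cont_at (X `&` O) y (iota \o (h \o
      (fun y => (y, unrealify (delta_mx 0 i))))).
    apply: (@cont_at_comp _ _ _ _ _ _ (total_set xi)).
    + by move=> z [Xz Oz] /=; have [] := hP z (unrealify (delta_mx 0 i)) Xz Oz.
    + apply: (@cont_at_comp _ _ _ _ _ _ ((X `&` O) `*` setT)).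
      * by move=> z [Xz Oz].
      * by apply: cont_at_pair; [exact: cont_at_id|exact: cont_at_cst].
      * by apply: (cont_at_within _ _).1 ch _ _; split.
    + apply: (cont_at_within _ _).1 ciota _ _.
      by have [] := hP y (unrealify (delta_mx 0 i)) Xy Oy.
  by move=> /cont_at_realify; apply.
Qed.

Lemma frames_of_subbundle n (X : set V) (E : set (V * Fn n)) :
  topological_subbundle X E -> has_frames X (fun x v => E (x, v)).
Proof.
move=> hE x Xx.
have [|//|//| |O [r [h [k [M [oO Ox _ _ hM]]]]]] :=
    @frames_of_embedding n X (subfamily E) snd hE _ _ _ _ x Xx.
- by apply/cont_at_within => e _; exact: cont_at_snd.
- by move=> [y v] [y' v'] _ _ /= -> ->.
- exists O, r, M; split=> // y Xy Oy.
  have [fM lM EM cM] := hM y Xy Oy; split=> // v; apply: iff_trans (EM v).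
  by split=> [Ey|[[y' v'] [/= + <- <-]]//]; exists (y, v).
Qed.

End OverV.
End LocalFrames.

(** * Bundles and morphisms given by matrices *)

Section ProjectorBundles.
Context {R : realType} {F : scalar_kind}.
Local Notation d := (scalar_dim F).
Local Notation Fn n := 'rV[scalars R F]_n.

Lemma fixed_basis n (Q : 'M[R]_(n * d)) : Q *m Q = Q ->
  @scalar_linear R F n n Q ->
  exists r (G : 'M[R]_(r * d, n * d)), [/\ row_free G,
    @scalar_linear R F r n G &
    forall v : Fn n, realify v *m Q = realify v <-> exists w, v = mx_act G w].
Proof.
move=> QQ lQ.
have [|v w hv hw|a v hv|r [s [fs sE]]] :=
    @exists_basis R F n [set v | realify v *m Q = realify v].
- by rewrite /= realify0 mul0mx.
- by rewrite /= realifyD mulmxDl hv hw.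
- by rewrite /= smul_mxE -mulmxA lQ mulmxA hv.
exists r, (frame_mx s); split; [exact: row_free_frame|exact:
  scalar_linear_frame|].
move=> v; apply: iff_trans (sE v) _; split=> [[c ->]|[w ->]].
  exists (\row_i c i); apply: realify_inj; rewrite realify_act -frame_mxE.
  by congr realify; apply: eq_bigr => i _; rewrite mxE.
by exists (fun i => w 0 i); apply: realify_inj; rewrite realify_act -frame_mxE.
Qed.

(* Intertwines two projectors: [P *m U = U *m Q] for [U = transition P Q]. *)
Definition transition n (P Q : 'M[R]_n) : 'M[R]_n :=
  P *m Q + (1%:M - P) *m (1%:M - Q).

Lemma transitionl n (P Q : 'M[R]_n) : P *m P = P ->
  P *m transition P Q = P *m Q.
Proof.
move=> PP; rewrite /transition [LHS]mulmxDr !mulmxA PP (mulmxBr P 1%:M P).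
by rewrite mulmx1 PP subrr mul0mx addr0.
Qed.

Lemma transitionr n (P Q : 'M[R]_n) : Q *m Q = Q ->
  transition P Q *m Q = P *m Q.
Proof.
move=> QQ; rewrite /transition [LHS]mulmxDl -!mulmxA QQ (mulmxBl 1%:M Q Q).
by rewrite mul1mx QQ subrr mulmx0 addr0.
Qed.

Lemma transition_refl n (P : 'M[R]_n) : P *m P = P -> transition P P = 1%:M.
Proof.
move=> PP; rewrite /transition PP mulmxBl mul1mx (mulmxBr P) mulmx1 PP subrr
  subr0.
by rewrite addrC subrK.
Qed.

(** The source of the estimates: each term carries the difference of the projectors, so the
    transition between nearby projectors is nearly the identity. *)
Lemma transition_subr1 n (P Q : 'M[R]_n) : P *m P = P -> Q *m Q = Q ->
  transition P Q - 1%:M = P *m (Q - P) + (P - Q) *m Q.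
Proof.
move=> PP QQ; rewrite /transition mulmxBl mul1mx !mulmxBr !mulmxBl mulmx1 PP QQ.
move: (P *m Q) (1%:M : 'M[R]_n) => A J.
by apply/matrixP => i j; rewrite !mxE; lra.
Qed.

Lemma transition_inv n (P Q : 'M[R]_n) : P *m P = P -> Q *m Q = Q ->
  transition P Q \in unitmx ->
  invmx (transition P Q) *m P = Q *m invmx (transition P Q).
Proof.
move=> PP QQ uU; apply: (can_inj (mulKmx uU)).
by rewrite mulKVmx // mulmxA transitionr // -(transitionl Q PP) mulmxK.
Qed.

Lemma scalar_linear_transition n (P Q : 'M[R]_(n * d)) :
  @scalar_linear R F n n P -> @scalar_linear R F n n Q ->
  @scalar_linear R F n n (transition P Q).
Proof.
move=> lP lQ; have l1 := @scalar_linear1 R F n.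
apply: scalar_linearD; first exact: scalar_linearM.
by apply: scalar_linearM; apply: scalar_linearD => //; exact: scalar_linearN.
Qed.

Lemma entries_transition T (A : set (T -> R)) n (P : 'M[R]_n) Q :
  function_algebra A -> entries A Q -> entries A (fun x => transition P (Q x)).
Proof.
move=> hA hQ; have hC M := entries_cst hA (M : 'M[R]_n).
apply: (entriesD hA); first exact: (entriesM hA).
by apply: (entriesM hA) => //; exact: (entriesB hA).
Qed.

(** By [P *m U = U *m Q], right multiplication by an invertible transition carries the fixed rows of
    [P] onto those of [Q]. A basis of one fiber thus spreads to nearby fibers by a formula
    polynomial in [Q]. *)
Lemma transition_frame n r (G : 'M[R]_(r * d, n * d)) (P Q : 'M[R]_(n * d)) :
  P *m P = P -> Q *m Q = Q -> transition P Q \in unitmx -> row_free G ->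
  (forall v : Fn n, realify v *m P = realify v <-> exists w, v = mx_act G w) ->
  row_free (G *m transition P Q) /\ forall v : Fn n,
  realify v *m Q = realify v <-> exists w, v = mx_act (G *m transition P Q) w.
Proof.
move=> PP QQ uU fG GE; set U := transition P Q in uU *; split.
  by rewrite /row_free mxrankMfree // row_free_unit.
have GP w : realify (w : Fn r) *m G *m P = realify w *m G.
  have /GE : exists w', mx_act G w = mx_act G w' by exists w.
  by rewrite realify_act.
move=> v; split=> [vQ|[w ->]].
  have [|w wE] := (GE (unrealify (realify v *m invmx U))).1.
  - rewrite unrealifyK -mulmxA transition_inv // mulmxA vQ //.
  - exists w; apply: realify_inj; rewrite realify_act mulmxA -realify_act -wE.
    by rewrite unrealifyK mulmxKV.
rewrite realify_act mulmxA -[LHS]mulmxA transitionr // -(transitionl Q PP).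
by rewrite mulmxA GP.
Qed.

Section OverV.
Context {V : function_space R} {I : Type} (c : I -> V -> R).
Hypothesis hc : presented_by c.

Definition fixed_bundle n (X : set V) (Q : V -> 'M[R]_(n * d)) :
  set (V * Fn n) :=
  [set e | X e.1 /\ realify e.2 *m Q e.1 = realify e.2].

Definition linear_projector n (X : set V) (Q : V -> 'M[R]_(n * d)) :=
  forall x, X x -> Q x *m Q x = Q x /\ @scalar_linear R F n n (Q x).

(** At [y = x] the transition from [Q x] to [Q y] is the identity, so its determinant stays nonzero
    near [x] and a basis of the fiber at [x] moves to a local frame. *)
Lemma fixed_bundle_topological n X (Q : V -> 'M[R]_(n * d)) :
  linear_projector X Q -> (forall x, X x -> entries (cont_at X x) Q) ->
  topological_subbundle X (@fixed_bundle n X Q).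
Proof.
move=> hQ cQ; apply: subbundle_of_frames => [e []//|x Xx].
have [QQ lQ] := hQ x Xx; have [r [G [fG lG GE]]] := fixed_basis QQ lQ.
have hd : cont_at X x (fun y => \det (transition (Q x) (Q y))).
  by apply: (falg_det (cont_at_algebra X x)); apply:
    entries_transition (cQ x Xx);
    exact: cont_at_algebra.
have [|O [oO Ox] Od] := cont_at_neq0 hd.
  by rewrite transition_refl // det1 oner_neq0.
exists O, r, (fun y => G *m transition (Q x) (Q y)); split=> // y Xy Oy.
have [QQy lQy] := hQ y Xy.
have uU : transition (Q x) (Q y) \in unitmx by rewrite unitmxE unitfE Od.
have [fM ME] := transition_frame QQ QQy uU fG GE; split=> //.
- by apply: scalar_linearM lG _; exact: scalar_linear_transition.
- move=> v; apply: iff_trans (ME v); split=> [[]//|vQ]; by split.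
- have hA := @cont_at_algebra _ R X y.
  apply: (entriesM hA); first exact: entries_cst.
  by apply: entries_transition => //; exact: cQ.
Qed.

Lemma rational_cont_at (Z : set V) x f : Z x -> rational_on c [set x] Z f ->
  cont_at Z x f.
Proof.
move=> Zx [u [w [pu pw w0 fE]]].
have wx := w0 _ erefl.
have cp k : polynomial_in c k -> cont_at Z x k.
  by move=> pk; apply: cont_at_continuous; apply: (continuous_polynomial hc pk).
have hA := @cont_at_algebra _ R Z x.
apply: (@cont_at_near _ _ Z x (fun y => u y * (w y)^-1)) => //.
  have : nbhs x [set y | w y != 0].
    exact: cvgr_neq0 _ (continuous_polynomial hc pw (x := x)) wx.
  by rewrite near_withinE; apply: filterS => y wy Zy; rewrite fE.
by apply: (falgM hA); [exact: cp|apply: cont_at_inv => //; exact: cp].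
Qed.

Lemma fixed_bundle_algebraic n Z (Q : V -> 'M[R]_(n * d)) :
  linear_projector Z Q ->
  (forall z, Z z -> entries (rational_on c [set z] Z) Q) ->
  algebraic_subbundle Z (@fixed_bundle n Z Q).
Proof.
move=> hQ rQ; split.
  apply: fixed_bundle_topological => // x Zx i j.
  by apply: rational_cont_at => //; exact: rQ.
move=> z Zz.
have [QQ lQ] := hQ z Zz; have [r [G [fG lG GE]]] := fixed_basis QQ lQ.
have [u [w [pu pw w0 dE]]] :
    rational_on c [set z] Z (fun y => \det (transition (Q z) (Q y))).
  have hA := rational_algebra c [set z] Z.
  by apply: (falg_det hA); apply: entries_transition (rQ z Zz).
(* A Zariski open condition on all of [V], which on [Z] makes the transition invertible. *)
exists [set y | u y * w y != 0]; split.
- by apply/hc.1/generated_open_principal; exact: PolyMul.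
- have := dE z Zz (w0 _ erefl); rewrite transition_refl // det1 /= mulf_eq0.
  rewrite negb_or w0 // andbT => h; apply/eqP => uz.
  by move: h; rewrite uz mul0r => /eqP; rewrite oner_eq0.
exists r, (fun i y => mx_act (G *m transition (Q z) (Q y)) (delta_mx 0 i)).
have Zu y : Z y -> u y * w y != 0 -> transition (Q z) (Q y) \in unitmx.
  move=> Zy; rewrite mulf_eq0 negb_or unitmxE unitfE => /andP[uy wy].
  by rewrite dE // mulf_neq0 // invr_eq0.
split=> [i|y [Zy uwy]].
  apply/(regular_onP _ _ hc) => x [Zx uwx].
  have hA := rational_algebra c [set x] (Z `&` [set y | u y * w y != 0]).
  apply: (@entries_ext _ _ _ _ _ (fun y => realify (delta_mx 0 i) *m
    (G *m transition (Q z) (Q y)))); first by move=> y; rewrite realify_act.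
  apply: (entriesM hA); first exact: entries_cst.
  apply: (entriesM hA); first exact: entries_cst.
  apply: entries_transition => // k l.
  by apply: rational_sub (rQ x Zx k l) => // y [].
have [QQy lQy] := hQ y Zy; have uU := Zu y Zy uwy.
have lU : @scalar_linear R F r n (G *m transition (Q z) (Q y)).
  by apply: scalar_linearM lG _; exact: scalar_linear_transition.
have [fM ME] := transition_frame QQ QQy uU fG GE; split.
  move=> v; split=> [[_ /= vQ]|[k ->]].
    by have [k ->] := (ME v).1 vQ; exists (fun i => k 0 i);
      rewrite -mx_act_frame.
  split=> //=; apply/ME; exists (\row_i k i); rewrite mx_act_frame //.
  by apply: eq_bigr => i _; rewrite mxE.
move=> k kE i.
have : mx_act (G *m transition (Q z) (Q y)) (\row_i k i) = 0.
  by rewrite mx_act_frame // -[RHS]kE; apply: eq_bigr => j _; rewrite mxE.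
move=> /(congr1 (@realify R F n)); rewrite realify_act realify0 => /eqP.
rewrite mulmx_free_eq0 // => /eqP/realify_eq0/rowP/(_ i).
by rewrite !mxE.
Qed.

(** Converse to [fixed_bundle_algebraic]: near [z] the projector is [right_inv (M y) *m M y], with
    [M] the matrix of a regular frame. *)
Lemma algebraic_proj_fiber n Z (E : set (V * Fn n)) z :
  algebraic_subbundle Z E -> Z z ->
  entries (rational_on c [set z] Z) (proj_fiber (fun x v => E (x, v))).
Proof.
move=> [_ hE] Zz; have [ O [zO Oz [r [s [rs sE]]]]] := hE z Zz.
pose M y : 'M[R]_(r * d, n * d) := frame_mx (fun i => s i y).
have hA := rational_algebra c [set z] (Z `&` O).
have rM : entries (rational_on c [set z] (Z `&` O)) M.
  move=> i j; rewrite (_ : (fun _ => _) = fun y => (\sum_k realify (s k y) *m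
      smul_mx n ((unrealify (delta_mx 0 i) : Fn r) 0 k)) 0 j); last first.
    apply/funext => y; rewrite /M mxE realify_sum; congr (_ 0 j).
    by under eq_bigr do rewrite smul_mxE.
  apply: (entries_sum hA) => k; apply: (entriesM hA); last exact: entries_cst.
  by apply: ((regular_onP _ _ hc).1 (rs k)).
have fM y : (Z `&` O) y -> row_free (M y).
  by move=> /sE[_ h]; apply: row_free_frame.
have pE y : (Z `&` O) y ->
    right_inv (M y) *m M y = proj_fiber (fun x v => E (x, v)) y.
  move=> ZOy; apply/esym/projector_ontoE/projector_row_span; first exact: fM.
  move=> u; apply: iff_trans ((sE y ZOy).1 (unrealify u)) _.
  split=> [[k kE]|[w ->]].
    exists (realify (\row_i k i)); rewrite -frame_mxE -[LHS]unrealifyK kE.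
    by congr realify; apply: eq_bigr => i _; rewrite mxE.
  exists (fun i => unrealify w 0 i); apply: realify_inj.
  by rewrite unrealifyK frame_mxE unrealifyK.
have [h [ph hz hO]] := (hc.1 O).1 zO z Oz.
have zZ : [set z] `<=` Z by move=> _ ->.
move=> i j; apply: (rational_local zZ (rational_polynomial _ _ ph)) =>
  [_ ->//|].
apply: (@rational_sub _ _ _ _ [set z] _ (Z `&` O)) => //.
  by move=> y [Zy /hO].
apply: (@rational_ext _ _ _ _ _ _ (fun y => (right_inv (M y) *m M y) i j)).
  by move=> y; rewrite inE => /pE ->.
apply: (entriesM hA) => //; apply: rational_right_inv => //.
  by move=> _ ->.
by move=> _ ->; exact: fM.
Qed.

Definition mx_map n p (E : set (V * Fn n)) (E' : set (V * Fn p))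
    (M : V -> 'M[R]_(n * d, p * d)) (phi : set_type E -> set_type E') :=
  forall e, set_val (phi e) =
    ((set_val e).1, mx_act (M (set_val e).1) (set_val e).2).

Lemma mx_map_exists n p (E : set (V * Fn n)) (E' : set (V * Fn p))
    (M : V -> 'M[R]_(n * d, p * d)) :
  (forall e, E e -> E' (e.1, mx_act (M e.1) e.2)) ->
  exists phi : set_type E -> set_type E', mx_map M phi.
Proof.
by move=> h; exists (fun e => SigSub (mem_set (h _ (set_valP e)))).
Qed.

Lemma mx_map_morphism n p X (E : set (V * Fn n)) (E' : set (V * Fn p)) M
    (phi : set_type E -> set_type E') :
  (forall e, E e -> X e.1) -> mx_map M phi ->
  (forall x, X x -> @scalar_linear R F n p (M x)) ->
  (forall x, X x -> entries (cont_at X x) M) ->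
  @bundle_morphism R F V (subfamily E) (subfamily E') phi.
Proof.
move=> EX hphi lM cM; split.
- pose f (e : V * Fn n) : V * Fn p := (e.1, mx_act (M e.1) e.2).
  have fg a : f (set_val a) = set_val (phi a) by rewrite hphi.
  suff hf : {within E, continuous f} by exact: (continuous_set_type_map fg hf).
  apply/cont_at_within => a Ea; apply: cont_at_pair; first exact: cont_at_fst.
  apply: cont_at_act; last exact: cont_at_snd.
  move=> i j; apply: (@cont_at_comp _ _ _ _ _ fst X (fun y => M y i j)).
  + exact: EX.
  + exact: cont_at_fst.
  + by apply: cM; exact: EX.
- by move=> e; rewrite hphi.
- by move=> e1 e2 e3 /= e12 e3E; rewrite !hphi e3E /= e12 mx_actD.
- move=> a e1 e2 /= e12; rewrite !hphi e12 /= mx_actZ //.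
  by apply: lM; apply: EX; exact: set_valP.
Qed.

Lemma mx_map_regular n p Z (E : set (V * Fn n)) (E' : set (V * Fn p)) M
    (phi : set_type E -> set_type E') :
  (forall e, E e -> Z e.1) -> mx_map M phi ->
  (forall z, Z z -> entries (rational_on c [set z] Z) M) ->
  @regular_map R (total_space E) (total_space E') phi.
Proof.
move=> EZ hphi rM.
pose gens := fun (k : I + 'I_(n * d)) (e : set_type E) =>
  @product_generators R V (vector_space F n) _ _ c
    (fun (j : 'I_(n * d)) v => realify v 0 j) k (set_val e).
apply/(regular_mapP _ (presented_total_space E hc) (presented_total_space E'
  hc)).
have hA (e : set_type E) := rational_algebra gens [set e] setT.
have pi1 u : polynomial_in c u ->
    polynomial_in gens (fun e => u (set_val e).1).
  move=> pu; pose gen' := @product_generators R V (vector_space F n) _ _ c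
    (fun (j : 'I_(n * d)) v => realify v 0 j).
  apply: (polynomial_comp gen' set_val _).2; exists (u \o fst) => //.
  exact: (@product_polynomial1 R V (vector_space F n)).
move=> [i|j] e.
  rewrite (_ : _ \o phi = fun e : set_type E => c i (set_val e).1); last first.
    by apply/funext => e'; rewrite /= hphi.
  by apply: rational_polynomial; apply: pi1; exact: PolyGen.
rewrite (_ : _ \o phi = fun e : set_type E =>
    \sum_k realify (set_val e).2 0 k * M (set_val e).1 k j); last first.
  by apply/funext => e'; rewrite /= hphi realify_act mxE.
apply: (falg_sum (hA e)) => k; apply: (falgM (hA e)).
  by apply: rational_polynomial; exact: (PolyGen gens (inr k)).
have [u [w [pu pw w0 fE]]] := rM _ (EZ _ (set_valP e)) k j.
exists (fun e => u (set_val e).1), (fun e => w (set_val e).1); split.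
- exact: pi1.
- exact: pi1.
- by move=> y ->; exact: w0.
- by move=> y _ wy; apply: fE => //; apply: EZ; exact: set_valP.
Qed.


(** A [vector_family] carries operations on its whole ambient space; stability of the fibers under
    them is read off the trivializations. *)
Lemma bundle_operations X (xi : vector_family R F V) : vector_bundle X xi ->
  (forall e e', total_set xi e -> total_set xi e' ->
     bundle_proj xi e = bundle_proj xi e' -> total_set xi (fadd e e') /\
     bundle_proj xi (fadd e e') = bundle_proj xi e) /\
  (forall a e, total_set xi e -> total_set xi (fscale a e) /\
     bundle_proj xi (fscale a e) = bundle_proj xi e).
Proof.
move=> [piX _ loc].
have loc' e : total_set xi e -> exists (r : nat) (h : V * Fn r -> ambient xi),
    [/\ forall v, total_set xi (h (bundle_proj xi e, v)) /\
        bundle_proj xi (h (bundle_proj xi e, v)) = bundle_proj xi e,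
      forall e', total_set xi e' -> bundle_proj xi e' = bundle_proj xi e ->
        exists v, e' = h (bundle_proj xi e, v),
      forall v w, h (bundle_proj xi e, v + w) =
        fadd (h (bundle_proj xi e, v)) (h (bundle_proj xi e, w)) &
      forall a v, h (bundle_proj xi e, a *: v) =
        fscale a (h (bundle_proj xi e, v))].
  move=> te; have Xe := piX e te; have [ O [oO [Oe [r [h [k triv]]]]]] :=
    loc _ Xe.
  have [_ _ hP kK hlin] := triv; have [hD hZ] := hlin _ Xe Oe.
  exists r, h; split=> // [v|e' te' ee'].
    by have [] := hP _ v Xe Oe.
  by exists (k e'); rewrite -ee' kK // ee'.
split=> [e e' te te' ee'|a e te].
  have [r [h [hP hS hD _]]] := loc' e te.
  have [v vE] := hS e te erefl; have [w wE] := hS e' te' (esym ee').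
  have -> : fadd e e' = h (bundle_proj xi e, v + w) by rewrite hD -vE -wE.
  by have [] := hP (v + w).
have [r [h [hP hS _ hZ]]] := loc' e te; have [v vE] := hS e te erefl.
have -> : fscale a e = h (bundle_proj xi e, a *: v) by rewrite hZ -vE.
by have [] := hP (a *: v).
Qed.

Lemma embedding_isomorphic n (X : set V) (xi : vector_family R F V)
    (iota : ambient xi -> Fn n) (E : set (V * Fn n)) : vector_bundle X xi ->
  {within total_set xi, continuous iota} ->
  (forall e e', total_set xi e -> total_set xi e' ->
     bundle_proj xi e = bundle_proj xi e' ->
     iota (fadd e e') = iota e + iota e') ->
  (forall a e, total_set xi e -> iota (fscale a e) = a *: iota e) ->
  (forall e e', total_set xi e -> total_set xi e' ->
     bundle_proj xi e = bundle_proj xi e' -> iota e = iota e' -> e = e') ->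
  (forall p, E p <-> exists e,
     [/\ total_set xi e, bundle_proj xi e = p.1 & iota e = p.2]) ->
  topologically_isomorphic xi (subfamily E).
Proof.
move=> hxi ciota iotaD iotaZ iota_inj EE.
have [piX cpi _] := hxi.
have phiE (e : set_type (total_set xi)) :
    E (bundle_proj xi (set_val e), iota (set_val e)).
  by apply/EE; exists (set_val e); split=> //; exact: set_valP.
pose phi e : set_type E := SigSub (mem_set (phiE e)).
have /choice[g gP] (p : set_type E) : exists e, [/\ total_set xi e,
    bundle_proj xi e = (set_val p).1 & iota e = (set_val p).2].
  by apply/EE; exact: set_valP.
have gT p : total_set xi (g p) by have [] := gP p.
pose psi p : set_type (total_set xi) := SigSub (mem_set (gT p)).
have psiP p : bundle_proj xi (set_val (psi p)) = (set_val p).1 /\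
    iota (set_val (psi p)) = (set_val p).2 by have [] := gP p.
have phiK : cancel phi psi.
  move=> e; apply: val_inj; have [h1 h2] := psiP (phi e).
  by apply: iota_inj => //; exact: set_valP.
have psiK : cancel psi phi.
  move=> p; apply: val_inj; have [h1 h2] := psiP p.
  by rewrite [RHS]surjective_pairing -[X in _ = (X, _)]h1 -[X in _ = (_, X)]h2.
have phi_cont : continuous phi.
  pose f e := (bundle_proj xi e, iota e).
  have fg a : f (set_val a) = set_val (phi a) by [].
  suff hf : {within total_set xi, continuous f}.
    exact: (continuous_set_type_map fg hf).
  apply/cont_at_within => a ta; apply: cont_at_pair.
    exact: (cont_at_within _ _).1 cpi a ta.
  exact: (cont_at_within _ _).1 ciota a ta.
have [addT scaleT] := bundle_operations hxi.
have psi_cont : continuous psi.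
  move=> p; apply/(@cvg_set_valP _ _ _ (nbhs p) _).
  have Xp : X (set_val p).1.
    by have [<- _] := psiP p; apply: piX; exact: set_valP.
  have [ O [r [h [k [M [oO Op triv iM hM]]]]]] :=
    frames_of_embedding hxi ciota iotaD iotaZ iota_inj Xp.
  have [ch ck hP kK hlin] := triv.
  (* Local formula for [psi], which gives its continuity: [right_inv] recovers the coordinates of a
     vector in the frame, and the trivialization turns them into a point of [xi]. *)
  pose g' (q : V * Fn n) := h (q.1, mx_act (right_inv (M q.1)) q.2).
  have gE (q : set_type E) : O (set_val q).1 ->
    set_val (psi q) = g' (set_val q).
    move=> Oq; have [h1 h2] := psiP q.
    have Xq : X (set_val q).1 by rewrite -h1; apply: piX; exact: set_valP.
    have [fM _ _ _] := hM _ Xq Oq.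
    have tq := set_valP (psi q).
    rewrite /g' -h1 -[LHS]kK // ?h1 //; congr (h (_, _)).
    apply: realify_inj; rewrite realify_act -h2.
    rewrite -[set_val (psi q)]kK // ?h1 // iM // realify_act -mulmxA right_invK
      //.
    rewrite mulmx1; congr realify.
    by have [_ _ ->] := hP _ (k (set_val (psi q))) Xq Oq.
  rewrite (gE p Op).
  have EX q : E q -> X q.1 by move=> /EE[e [te <- _]]; exact: piX.
  have near_O : nbhs p (set_val @^-1` [set q : V * Fn n | O q.1]).
    have hO : nbhs (set_val p) [set q : V * Fn n | O q.1].
      by apply: (@cvg_fst _ _ (nbhs (set_val p).1)); exact: open_nbhs_nbhs.
    by apply: (@initial_continuous _ _ set_val p); exact: hO.
  have gc : cont_at (E `&` [set q | O q.1]) (set_val p) g'.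
    have Ep := set_valP p; have [fM _ _ cM] := hM _ Xp Op.
    apply: (@cont_at_comp _ _ _ _ _
      (fun q => (q.1, mx_act (right_inv (M q.1)) q.2)) ((X `&` O) `*` setT) h).
    - by move=> q [/EX Xq Oq].
    - apply: cont_at_pair; first exact: cont_at_fst.
      apply: cont_at_act; last exact: cont_at_snd.
      move=> i j; apply: (@cont_at_comp _ _ _ _ _ fst X
        (fun y => right_inv (M y) i j)).
      + by move=> q [/EX].
      + exact: cont_at_fst.
      + exact: cont_right_inv.
    - by apply: (cont_at_within _ _).1 ch _ _; split.
  have gc' : (fun q : set_type E => g' (set_val q)) @ nbhs p --> g' (set_val p).
    suff sv : set_val @ nbhs p -->
      within (E `&` [set q | O q.1]) (nbhs (set_val p)).
      exact: (cvg_comp _ _ sv gc).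
    move=> A hA.
    have n1 : nbhs p (set_val @^-1`
        [set q : V * Fn n | (E `&` [set q | O q.1]) q -> A q]).
      by apply: (@initial_continuous _ _ set_val p); exact: hA.
    apply: (filterS _ (filterI n1 near_O)) => q [hq Oq].
    by apply: hq; split=> //; exact: set_valP.
  refine (cvg_trans _ gc'); apply: near_eq_cvg.
  by apply: (filterS _ near_O) => q Oq; rewrite gE.
exists phi, psi; split=> //.
- split=> //.
  + move=> e1 e2 e3 e12 e3E.
    have [t1 t2] := (set_valP e1, set_valP e2).
    have [_ b3] := addT _ _ t1 t2 e12.
    change ((bundle_proj xi (set_val e3), iota (set_val e3)) =
      (bundle_proj xi (set_val e1), iota (set_val e1) + iota (set_val e2))).
    by rewrite e3E b3 iotaD.
  + move=> a e1 e2 e12; have t1 := set_valP e1; have [_ b2] := scaleT a _ t1.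
    change ((bundle_proj xi (set_val e2), iota (set_val e2)) =
      (bundle_proj xi (set_val e1), a *: iota (set_val e1))).
    by rewrite e12 b2 iotaZ.
- split=> //.
  + by move=> p; have [] := psiP p.
  + move=> p1 p2 p3 /= p12 p3E.
    have [h1 i1] := psiP p1; have [h2 i2] := psiP p2; have [h3 i3] := psiP p3.
    have t1 := set_valP (psi p1); have t2 := set_valP (psi p2).
    have h12 : bundle_proj xi (set_val (psi p1)) = bundle_proj xi (set_val (psi
      p2)).
      by rewrite h1 h2.
    have [t12 b12] := addT _ _ t1 t2 h12.
    apply: iota_inj => //; first exact: set_valP.
      by rewrite h3 b12 h1 p3E.
    by rewrite iotaD // i1 i2 i3 p3E.
  + move=> a p1 p2 p12.
    have [h1 i1] := psiP p1; have [h2 i2] := psiP p2.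
    have t1 := set_valP (psi p1); have [ta ba] := scaleT a _ t1.
    apply: iota_inj => //; first exact: set_valP.
      by rewrite h2 ba h1 p12.
    by rewrite iotaZ // i1 i2 p12.
Qed.

End OverV.
End ProjectorBundles.

(** * Stratifications and bump functions *)

Section Stratifications.
Context {R : realType} {V : function_space R}.

Definition common_refinement (S S' : set (set V)) : set (set V) :=
  [set A `&` B | A in S & B in S'].

Lemma zariski_locally_closedI (I : Type) (c : I -> V -> R) (A B : set V) :
  presented_by c -> zariski_locally_closed A -> zariski_locally_closed B ->
  zariski_locally_closed (A `&` B).
Proof.
move=> [oc _] [ O [C [oO cC ->]]] [ O' [C' [oO' cC' ->]]].
exists (O `&` O'), (C `&` C'); split; last by rewrite setIACA.
  by apply/oc/generated_openI; exact/oc.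
apply/oc => x; rewrite setCI =>
  -[/((oc _).1 cC)|/((oc _).1 cC')] [h [ph hx hC]].
  by exists h; split=> // y /hC ?; left.
by exists h; split=> // y /hC ?; right.
Qed.

Lemma stratification_refinement (I : Type) (c : I -> V -> R) S S' :
  presented_by c -> stratification S -> stratification S' ->
  stratification (common_refinement S S').
Proof.
move=> hc [fS lS tS cS] [fS' lS' tS' cS']; split.
- exact: finite_image2.
- move=> _ [A SA [B SB <-]].
  exact: (zariski_locally_closedI hc (lS _ SA) (lS' _ SB)).
- move=> _ _ [A SA [B SB <-]] [A' SA' [B' SB' <-]] /= [x [[Ax Bx] [A'x B'x]]].
  have -> : A = A' by apply: tS => //; exists x.
  by have -> : B = B' by apply: tS' => //; exists x.
- apply/seteqP; split=> // x _.
  have [A SA Ax] : (\bigcup_(A in S) A) x by rewrite cS.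
  have [B SB Bx] : (\bigcup_(A in S') A) x by rewrite cS'.
  by exists (A `&` B) => //; exists A => //; exists B.
Qed.

Lemma piece_subset (X : set V) (A B : set V) x : (X `&` (A `&` B)) x ->
  connected_component (X `&` (A `&` B)) x `<=` connected_component (X `&` A) x.
Proof.
move=> h; apply: connected_component_max.
- exact: connected_component_refl.
- by move=> y /connected_component_sub [Xy [Ay _]].
- exact: component_connected.
Qed.

(** This lets a common refinement inherit algebraicity over the pieces of either stratification. *)
Lemma piece_refinement S S' (X Sigma : set V) :
  piece (common_refinement S S') X Sigma ->
  (exists2 Sigma1, piece S X Sigma1 & Sigma `<=` Sigma1) /\
  (exists2 Sigma2, piece S' X Sigma2 & Sigma `<=` Sigma2).
Proof.
move=> [_ [A SA [B SB <-]] [x [Xx [Ax Bx]] ->]]; split.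
  exists (connected_component (X `&` A) x); first by exists A => //; exists x.
  exact: piece_subset.
exists (connected_component (X `&` B) x); first by exists B => //; exists x.
by rewrite (setIC A); exact: piece_subset.
Qed.

Lemma piece_connected S (X Sigma : set V) : piece S X Sigma -> connected Sigma.
Proof. by move=> [A SA [x _ ->]]; exact: component_connected. Qed.

Lemma piece_sub S (X Sigma : set V) : piece S X Sigma -> Sigma `<=` X.
Proof. by move=> [A SA [x _ ->]] y /connected_component_sub []. Qed.

(** Only vanishing is recorded, since sign conditions do not in general define Zariski locally
    closed sets; connectedness of the pieces supplies the signs. *)
Definition zero_stratum (T : finType) (f : T -> V -> R) (b : {ffun T -> bool}) :
  set V := [set x | forall t, (f t x == 0) = b t].

Definition zero_strata (T : finType) (f : T -> V -> R) : set (set V) :=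
  [set zero_stratum f b | b in setT].

Lemma stratification_zero (I : Type) (c : I -> V -> R) (T : finType)
    (f : T -> V -> R) : presented_by c ->
  (forall t, polynomial_in c (f t)) -> stratification (zero_strata f).
Proof.
move=> hc pf; have hA := polynomial_algebra c; split.
- by apply: finite_image; exact: finite_finset.
- move=> _ [b _ <-].
  exists [set x | \prod_(t | ~~ b t) f t x != 0].
  exists [set x | forall t, b t -> f t x = 0]; split.
  + by apply/hc.1/generated_open_principal; exact: (falg_prod hA).
  + apply/hc.1 => x /existsNP[t] /not_implyP[bt] /eqP ft.
    by exists (f t); split=> // y /eqP fy h; apply: fy; exact: h.
  + apply/seteqP; split=> x /= h.
      split=> [|t bt]; last by apply/eqP; rewrite h.
      by apply/prodf_neq0 => t nb; rewrite h.
    move=> t; case: h => h1 h2; case: (boolP (b t)) => bt.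
      by rewrite h2 ?eqxx.
    by apply/negbTE; move/prodf_neq0: h1; apply.
- move=> _ _ [b _ <-] [b' _ <-] [x [hb hb']]; congr zero_stratum.
  by apply/ffunP => t; rewrite -hb -hb'.
- apply/seteqP; split=> // x _.
  exists (zero_stratum f [ffun t => f t x == 0]) => [|t]; last by rewrite ffunE.
  by exists [ffun t => f t x == 0].
Qed.

(** Either the stratum imposes [f t = 0], or the image of the connected piece is an interval that
    avoids [0]. *)
Lemma piece_sign (I : Type) (c : I -> V -> R) (T : finType)
    (f : T -> V -> R) (X Sigma : set V) t : presented_by c ->
  (forall t, polynomial_in c (f t)) -> piece (zero_strata f) X Sigma ->
  [\/ forall x, Sigma x -> f t x = 0, forall x, Sigma x -> 0 < f t x |
      forall x, Sigma x -> f t x < 0].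
Proof.
move=> hc pf pS; have cS := piece_connected pS.
case: pS => _ [b _ <-] [x0 hx0 SE].
have zE x : Sigma x -> (f t x == 0) = b t.
  by rewrite SE => /connected_component_sub [_ ].
case: (boolP (b t)) => bt.
  by constructor 1 => x /zE; rewrite bt => /eqP.
have nz x : Sigma x -> f t x != 0 by move=> /zE ->.
have /connected_intervalP itv : connected (f t @` Sigma).
  apply: connected_continuous_connected => //.
  by apply: continuous_subspaceT => x; exact:
    (continuous_polynomial hc (pf t) (x := x)).
have Sx0 : Sigma x0 by rewrite SE; exact: connected_component_refl.
case: (ltrgt0P (f t x0)) => [p|n|z]; last by have := nz _ Sx0; rewrite z eqxx.
  constructor 2 => x Sx; rewrite lt_def nz //= leNgt; apply/negP => fx.
  have fI y : Sigma y -> (f t @` Sigma) (f t y) by exists y.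
  have [|y Sy] := itv _ _ (fI x Sx) (fI x0 Sx0) 0;
    first by rewrite (ltW fx) (ltW p).
  by move/eqP; rewrite (negPf (nz y Sy)).
constructor 3 => x Sx; rewrite lt_neqAle nz //= leNgt; apply/negP => fx.
have fI y : Sigma y -> (f t @` Sigma) (f t y) by exists y.
have [|y Sy] := itv _ _ (fI x0 Sx0) (fI x Sx) 0;
  first by rewrite (ltW fx) (ltW n).
by move/eqP; rewrite (negPf (nz y Sy)).
Qed.

End Stratifications.

(* The library has this for pointed spaces only. *)
Lemma compact_cover_compact (T : topologicalType) (x : T) (X : set T) :
  compact X -> cover_compact X.
Proof.
move=> cX; pose P : ptopologicalType :=
  HB.pack (Topological.sort T) (isPointed.Build T x).
suff : @cover_compact P X by exact.
by rewrite -compact_cover.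
Qed.

(** * Bump functions on a cubical grid *)

Section BumpFunctions.
Context {R : realType} {V : function_space R} {N : nat} (c : 'I_N -> V -> R).
Hypothesis hc : presented_by c.

Definition pos_part (t : R) := (t + `|t|) / 2.

Lemma pos_part_ge0 t : 0 <= pos_part t.
Proof. by rewrite divr_ge0 // -lerBlDl sub0r -normrN ler_norm. Qed.

Lemma pos_part_gt0 t : (0 < pos_part t) = (0 < t).
Proof.
rewrite /pos_part; case: (ltrP 0 t) => h.
  by rewrite gtr0_norm // divr_gt0 // addr_gt0.
by rewrite ler0_norm // subrr mul0r ltxx.
Qed.

Lemma pos_part_id t : 0 <= t -> pos_part t = t.
Proof. by move=> h; rewrite /pos_part ger0_norm //; lra. Qed.

Lemma pos_part_eq0 t : t <= 0 -> pos_part t = 0.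
Proof. by move=> h; rewrite /pos_part ler0_norm // subrr mul0r. Qed.

(** A Lebesgue number for the sup distance of the coordinates: finitely many boxes of half the
    admissible radius cover [X], and [r] is at most each of these half radii. *)
Lemma compact_lebesgue (X : set V) (U : V -> set V) : compact X ->
  (forall a, X a -> nbhs a (U a)) ->
  exists r B : R, [/\ 0 < r, forall x i, X x -> `|c i x| <= B &
    forall x, X x -> exists2 a, X a &
      forall y, (forall i, `|c i y - c i x| < r) -> U a y].
Proof.
move=> cX0 hU; have [[p _]|nX] := pselect (exists p, X p); last first.
  exists 1, 0; split=> [//|x i Xx|x Xx]; by case: nX; exists x.
have cX := compact_cover_compact p cX0.
have /choice[e eP] a : exists e : R, X a -> 0 < e /\
    forall y, (forall i, `|c i y - c i a| < e) -> U a y.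
  have [Xa|nXa] := pselect (X a); last by exists 0.
  by have [e e0 h] := nbhs_presented hc (hU a Xa); exists e.
pose W a : set V := [set y | forall i, `|c i y - c i a| < e a / 2].
have oW a : X a -> nbhs a (W a).
  move=> Xa; have [e0 _] := eP a Xa.
  suff : \forall y \near a, forall i, `|c i y - c i a| < e a / 2 by [].
  apply: (@filter_forall V _ _ (nbhs a)) => i.
  have /cvgrPdist_lt h := continuous_polynomial hc (PolyGen c i) (x := a).
  have := h (e a / 2) (divr_gt0 e0 (ltr0Sn _ _)).
  by apply: filterS => y; rewrite distrC.
have [D DX XD] : finite_subset_cover X (fun a => (W a)°) X.
  apply: cX => [a _|x Xx]; first exact: open_interior.
  by exists x => //; exact: oW.
have XD' x : X x -> exists2 a, a \in D /\ X a & W a x.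
  move=> /XD[a /= aD /interior_subset Wa]; exists a => //.
  by split=> //; exact: set_mem (DX a aD).
have minr (q : seq V) : (forall a, a \in q -> 0 < e a / 2) ->
    exists2 r : R, 0 < r & forall a, a \in q -> r <= e a / 2.
  elim: q => [_|a q IH h]; first by exists 1.
  have [|r r0 hr] := IH _; first by move=> b bs; apply: h; rewrite inE bs orbT.
  exists (Order.min r (e a / 2)) => [|b].
    by rewrite lt_min r0 h // inE eqxx.
  rewrite inE => /orP[/eqP ->|/hr br]; first by rewrite ge_min lexx orbT.
  by rewrite ge_min br.
have [|r r0 rD] := minr (enum_fset D).
  move=> a aD; have Xa := set_mem (DX a aD).
  by have [e0 _] := eP a Xa; rewrite divr_gt0.
exists r, (\sum_(a <- enum_fset D) \sum_i (`|c i a| + `|e a / 2|)); split=> //.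
- move=> x i /XD'[a [aD Xa] Wa].
  rewrite (big_rem a) //= (bigD1 i) //= -addrA -addrA.
  have h1 : `|c i x| <= `|c i a| + `|e a / 2|.
    have := ler_normD (c i x - c i a) (c i a); rewrite subrK => h.
    apply: (le_trans h); rewrite addrC lerD2l.
    by apply: (le_trans (ltW (Wa i))); exact: ler_norm.
  apply: (le_trans h1); rewrite addrA lerDl addr_ge0 //.
    by apply: sumr_ge0 => j _; rewrite addr_ge0.
  by apply: sumr_ge0 => b _; apply: sumr_ge0 => j _; rewrite addr_ge0.
- move=> x Xx; have [a [aD Xa] Wa] := XD' x Xx; exists a => // y hy.
  have [e0 eU] := eP a Xa; apply: eU => i.
  have -> : c i y - c i a = (c i y - c i x) + (c i x - c i a) by rewrite addrA
    subrK.
  apply: (le_lt_trans (ler_normD _ _)); have := Wa i; have := hy i.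
  have := rD a aD; rewrite /=; lra.
Qed.

Lemma bump_functions (X : set V) (U : V -> set V) : compact X ->
  (forall a, X a -> nbhs a (U a)) ->
  exists (M T : finType) (lam : M -> V -> R) (f : T -> V -> R) (a : M -> V),
    [/\ forall t, polynomial_in c (f t),
      forall m, (forall x, 0 <= lam m x) /\ continuous (lam m),
      forall x, X x -> exists m, 0 < lam m x,
      forall m, X (a m) /\ forall x, U (a m) x \/ \forall y \near x,
        lam m y = 0 &
      (forall x, (#|[pred m | (0 < lam m x)%R]| <= 2 ^ N)%N) /\
      forall Sigma, (exists x, Sigma x) ->
        (forall t, [\/ forall x, Sigma x -> f t x = 0,
          forall x, Sigma x -> 0 < f t x | forall x, Sigma x -> f t x < 0]) ->
        forall m, (forall x, Sigma x -> lam m x = 0) \/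
          exists2 g, polynomial_in c g &
            forall x, Sigma x -> 0 < lam m x /\ lam m x = g x].
Proof.
move=> cX hU; have [r [B [r0 BX rX]]] := compact_lebesgue cX hU.
(* A bump has width [2] after scaling by [s], hence width [r] in each coordinate. The shift [o]
   makes the grid indices that matter on [X] natural numbers below [L]. *)
pose s : R := 2 / r; have s0 : 0 < s by rewrite divr_gt0.
pose o := (Num.truncn (s * `|B|)).+1.
have oP x i : X x -> `|s * c i x| < o%:R.
  move=> Xx; rewrite normrM gtr0_norm //.
  have /andP[_] := truncn_itv (mulr_ge0 (ltW s0) (normr_ge0 B)).
  apply: le_lt_trans; rewrite ler_wpM2l ?(ltW s0) //.
  by apply: (le_trans (BX x i Xx)); exact: ler_norm.
pose L := (o + o).+1.
pose g (i : 'I_N) (k : 'I_L) (x : V) : R := 1 - (s * c i x + o%:R - k%:R) ^+ 2.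
have hA := polynomial_algebra c.
have pg i k : polynomial_in c (g i k).
  apply: (falgB hA); first exact: falg_cst.
  rewrite (_ : (fun _ => _) = fun x => (s * c i x + o%:R - k%:R) *
    (s * c i x + o%:R - k%:R)); last by apply/funext => x; rewrite expr2.
  have pl : polynomial_in c (fun x => s * c i x + o%:R - k%:R).
    apply: (falgB hA); last exact: falg_cst.
    apply: (falgD hA); last exact: falg_cst.
    by apply: (falgM hA); [exact: falg_cst|exact: PolyGen].
  exact: (falgM hA).
have g_gt0 i k x : (0 < g i k x) = (`|s * c i x + o%:R - k%:R| < 1).
  by rewrite subr_gt0 -[in LHS]real_normK ?num_real // expr_lt1.
pose l (m : {ffun 'I_N -> 'I_L}) x := \prod_i pos_part (g i (m i) x).
have l_gt0 m x : (0 < l m x) = [forall i, 0 < g i (m i) x].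
  apply/idP/forallP => [h i|h]; last by apply: prodr_gt0 => i _;
    rewrite pos_part_gt0.
  rewrite -pos_part_gt0 lt_def pos_part_ge0 andbT; apply/negP => /eqP h0.
  by move: h; rewrite /l (bigD1 i) //= h0 mul0r ltxx.
have l_ge0 m x : 0 <= l m x by apply: prodr_ge0 => i _; exact: pos_part_ge0.
have l_cont m : continuous (l m).
  move=> x; have hC := @cont_at_algebra V R setT x.
  have : cont_at setT x (l m).
    apply: (falg_prod hC) => i; apply: (falgM hC); last exact: falg_cst.
    have cg : cont_at setT x (g i (m i)).
      by apply: cont_at_continuous; exact:
        (continuous_polynomial hc (pg _ _) (x := x)).
    by apply: (falgD hC) => //; exact: cvg_norm cg.
  by move=> h A /h; rewrite /= /nbhs /= /within /=; apply: filterS => y; apply.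
(* Only bumps that are positive somewhere on [X] are kept: a point [w m] of [X] is needed to select
   the center [a m]. *)
pose M := {m : {ffun 'I_N -> 'I_L} | `[< exists2 x, X x & 0 < l m x >]}.
have /choice[w wP] (m : M) : exists w, X w /\ 0 < l (val m) w.
  by have /asboolP[w ? ?] := valP m; exists w.
have /choice[a aP] (m : M) : exists a, X a /\
    forall y, (forall i, `|c i y - c i (w m)| < r) -> U a y.
  by have [Xw _] := wP m; have [a Xa ha] := rX _ Xw; exists a.
exists M, ('I_N * 'I_L)%type, (fun m => l (val m)), (fun t => g t.1 t.2), a;
  split.
- by move=> t; exact: pg.
- by move=> m; split.
- move=> x Xx; pose z i := s * c i x + o%:R.
  have z0 i : 0 <= z i.
    by have := oP x i Xx; rewrite /z ltr_norml => /andP[? _]; lra.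
  have zL i : (Num.truncn (z i) < L)%N.
    rewrite -(ltr_nat R); have /andP[h _] := truncn_itv (z0 i).
    apply: (le_lt_trans h); have := oP x i Xx; rewrite ltr_norml => /andP[_ h'].
    by rewrite /L -natr1 natrD /z; lra.
  pose m0 : {ffun 'I_N -> 'I_L} := [ffun i => Ordinal (zL i)].
  have m0x : 0 < l m0 x.
    rewrite l_gt0; apply/forallP => i; rewrite g_gt0 ffunE /=.
    have /andP[h1] := truncn_itv (z0 i); rewrite -natr1 => h2.
    by rewrite -/(z i) ger0_norm; lra.
  have hm0 : `[< exists2 x, X x & 0 < l m0 x >] by apply/asboolP; exists x.
  by exists (Sub m0 hm0 : M).
- move=> m; have [Xa aU] := aP m; split=> // x.
  have [Xw lw] := wP m.
  (* In scaled coordinates [w m] is at distance less than [1] from the index. If [x] is at distance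
     at most [1], the two points differ by less than [r]; if [x] is farther in some coordinate, the
     bump vanishes near [x]. *)
  case: (pselect (forall i, `|s * c i x + o%:R - (val m i)%:R| <= 1)) => h.
    left; apply: aU => i; move: lw; rewrite l_gt0 => /forallP/(_ i).
    rewrite g_gt0 => h2; have h1 := h i.
    have sr : s * r = 2 by rewrite /s divfK // gt_eqF.
    rewrite -(ltr_pM2l s0) sr -[s in s * `|_|]gtr0_norm // -normrM.
    have -> : s * (c i x - c i (w m)) = (s * c i x + o%:R - (val m i)%:R) -
      (s * c i (w m) + o%:R - (val m i)%:R) by ring.
    by apply: (le_lt_trans (ler_normB _ _)); lra.
  right; move/existsNP: h => [i /negP]; rewrite -ltNge => h.
  have gx : g i (val m i) x < 0.
    by rewrite subr_lt0 -real_normK ?num_real // exprn_egt1.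
  have hn : \forall y \near x, g i (val m i) y < 0.
    have := continuous_polynomial hc (pg i (val m i)) (x := x).
    by move=> /cvgr_lt /(_ 0 gx).
  apply: (filterS _ hn) => y gy.
  by rewrite /l (bigD1 i) //= pos_part_eq0 ?mul0r // ltW.
- split=> [x|Sigma [x0 Sx0] hS m].
    (* An active index differs from the scaled coordinate by less than [1], so it is determined by
       the side on which it lies: two choices per coordinate. *)
    pose b (m : M) : {ffun 'I_N -> bool} :=
      [ffun i => s * c i x + o%:R < (val m i)%:R].
    have : (#|[pred m : M | (0 < l (val m) x)%R]| <= #|{ffun 'I_N -> bool}|)%N.
      apply: (@leq_card_in _ _ b) => m m'; rewrite !inE !l_gt0.
      move=> /forallP h /forallP h' bb; apply: val_inj; apply/ffunP => i.
      apply: val_inj; have := h i; have := h' i; rewrite !g_gt0 !ltr_norml.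
      move/ffunP/(_ i): bb; rewrite !ffunE => bb.
      move=> /andP[a1 a2] /andP[b1 b2]; apply/eqP; rewrite eqn_leq.
      rewrite -[X in X && _]ltnS -[X in _ && X]ltnS -!(ltr_nat R) -!natr1.
      by move: bb; case: ltP => u1; case: ltP => u2 // _; apply/andP; split;
        lra.
    by rewrite card_ffun card_bool card_ord.
  (* With constant signs, either every factor equals its positive part and the bump is a polynomial,
     or some factor is nowhere positive on [Sigma] and the bump vanishes there. *)
  case: (pselect (forall i, forall x, Sigma x -> 0 < g i (val m i) x)) => h.
    right; exists (fun x => \prod_i g i (val m i) x).
      by apply: (falg_prod hA) => i; exact: pg.
    move=> x Sx; split; first by rewrite l_gt0; apply/forallP => i; exact: h.
    by apply: eq_bigr => i _; rewrite pos_part_id // ltW // h.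
  left; move/existsNP: h => [i hi] x Sx; rewrite /l (bigD1 i) //=.
  have [h|h|h] := hS (i, val m i) => //.
    by rewrite h // pos_part_eq0 // mul0r.
  by rewrite pos_part_eq0 ?mul0r // ltW // h.
Qed.

End BumpFunctions.

(** * Gluing of idempotents *)

Section Gluing.
Context {R : realType} {D : nat}.
Implicit Types P Q : 'M[R]_D.

(** A segment from the identity to the transition. Conjugation by its invertible points preserves
    idempotents, which averaging [P] and [Q] would not. *)
Definition interpolant P Q (t : R) : 'M[R]_D :=
  1%:M + t *: (transition P Q - 1%:M).

(* A path of idempotents from [P] (at [t = 0]) to [Q] (at [t = 1]). *)
Definition glue_step P Q (t : R) : 'M[R]_D :=
  mx_inv (interpolant P Q t) *m P *m interpolant P Q t.

Lemma glue_step0 P Q : glue_step P Q 0 = P.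
Proof.
rewrite /glue_step /interpolant scale0r addr0 mx_inv_unit ?unitmx1 //.
by rewrite invmx1 mul1mx mulmx1.
Qed.

Lemma glue_step_idem P Q t : P *m P = P -> interpolant P Q t \in unitmx ->
  glue_step P Q t *m glue_step P Q t = glue_step P Q t.
Proof.
move=> PP uU; rewrite /glue_step mx_inv_unit // -!mulmxA (mulmxA (interpolant _
  _ _)).
by rewrite mulmxV // mul1mx (mulmxA P P) PP.
Qed.

Lemma sumnorm_transition P Q b e : P *m P = P -> Q *m Q = Q ->
  sumnorm P <= b -> sumnorm Q <= b -> sumnorm (Q - P) <= e ->
  sumnorm (transition P Q - 1%:M) <= 2 * b * e.
Proof.
move=> PP QQ Pb Qb h; rewrite transition_subr1 //.
apply: (le_trans (ler_sumnormD _ _)).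
have h1 := ler_sumnormM P (Q - P); have h2 := ler_sumnormM (P - Q) Q.
have h' : sumnorm (P - Q) <= e by rewrite sumnormC.
have := sumnorm_ge0 P; have := sumnorm_ge0 Q; have := sumnorm_ge0 (Q - P).
have := sumnorm_ge0 (P - Q); nra.
Qed.

(** With [U] the interpolant and [G] the result, [G - P = U^-1 (P U - U P)] and
    [G - Q = U^-1 (P U - U Q)]. The first bracket is a multiple of [t], the second equals
    [(1 - t) (P - Q)]; continuity of the gluing where a weight vanishes rests on these two
    factors. *)
Lemma glue_step_bounds P Q t b e : P *m P = P -> Q *m Q = Q ->
  D%:R <= b -> sumnorm P <= b -> sumnorm Q <= b ->
  sumnorm (Q - P) <= e -> 2 * b * e <= 2^-1 -> 0 <= t <= 1 ->
  [/\ interpolant P Q t \in unitmx,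
      sumnorm (glue_step P Q t - P) <= 8 * b ^+ 3 * e * t &
      sumnorm (glue_step P Q t - Q) <= (1 - t) * (2 * b * e)].
Proof.
move=> PP QQ Db Pb Qb h small /andP[t0 t1].
have hW := sumnorm_transition PP QQ Pb Qb h.
set W := transition P Q - 1%:M in hW.
have b0 : 0 <= b by exact: le_trans (sumnorm_ge0 P) Pb.
have e0 : 0 <= e by exact: le_trans (sumnorm_ge0 _) h.
have U1 : interpolant P Q t - 1%:M = t *: W by rewrite /interpolant addrC addKr.
have W0 := sumnorm_ge0 W.
have hU : sumnorm (interpolant P Q t - 1%:M) <= 2^-1.
  by rewrite U1 sumnormZ ger0_norm //; nra.
have uU : interpolant P Q t \in unitmx by apply: unitmx_near1; lra.
have hV : sumnorm (invmx (interpolant P Q t)) <= 2 * b.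
  by apply: (le_trans (sumnorm_inv_near1 hU)); lra.
have V0 := sumnorm_ge0 (invmx (interpolant P Q t)).
split=> //.
- have -> : glue_step P Q t - P =
      invmx (interpolant P Q t) *m (t *: (P *m W - W *m P)).
    have -> : t *: (P *m W - W *m P) =
        P *m interpolant P Q t - interpolant P Q t *m P.
      rewrite scalerBr scalemxAr scalemxAl -U1 mulmxBr mulmxBl mulmx1 mul1mx.
      by rewrite opprB addrA subrK.
    by rewrite /glue_step mx_inv_unit // mulmxBr mulmxA mulKmx.
  apply: (le_trans (ler_sumnormM _ _)); rewrite sumnormZ ger0_norm //.
  have h1 : sumnorm (P *m W - W *m P) <= 2 * b * (2 * b * e).
    apply: (le_trans (ler_sumnormD _ _)); rewrite sumnormN.
    have := ler_sumnormM P W; have := ler_sumnormM W P.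
    have := sumnorm_ge0 P; nra.
  have h0 := sumnorm_ge0 (P *m W - W *m P).
  have h2 : t * sumnorm (P *m W - W *m P) <= t * (2 * b * (2 * b * e)).
    exact: ler_wpM2l.
  apply: (@le_trans _ _ (2 * b * (t * (2 * b * (2 * b * e))))).
    by apply: ler_pM => //; exact: mulr_ge0.
  by rewrite le_eqVlt; apply/orP; left; apply/eqP; ring.
- have -> : glue_step P Q t - Q =
      invmx (interpolant P Q t) *m ((1 - t) *: (P - Q)).
    have -> : (1 - t) *: (P - Q) =
        P *m interpolant P Q t - interpolant P Q t *m Q.
      have tw : P *m W = W *m Q + (Q - P).
        rewrite /W mulmxBr mulmxBl transitionl // transitionr // mulmx1 mul1mx.
        by rewrite addrA subrK.
      rewrite /interpolant mulmxDl mulmxDr mulmx1 mul1mx -scalemxAr -scalemxAl.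
      rewrite -/W tw; move: (W *m Q) => A.
      by apply/matrixP => i j; rewrite !mxE; ring.
    by rewrite /glue_step mx_inv_unit // mulmxBr mulmxA mulKmx.
  apply: (le_trans (ler_sumnormM _ _)); rewrite sumnormZ ger0_norm ?subr_ge0 //.
  have h' : sumnorm (P - Q) <= e by rewrite sumnormC.
  have P0 := sumnorm_ge0 (P - Q).
  rewrite mulrCA; apply: ler_wpM2l; first by rewrite subr_ge0.
  exact: ler_pM.
Qed.

Lemma entries_interpolant T (A : set (T -> R)) P (Q : T -> 'M[R]_D) t :
  function_algebra A -> entries A Q -> A t ->
  entries A (fun x => interpolant P (Q x) (t x)).
Proof.
move=> hA hQ ht; have hC M := entries_cst hA (M : 'M[R]_D).
apply: (entriesD hA) => //; apply: (entriesZ hA) => //.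
by apply: (entriesB hA) => //; exact: entries_transition.
Qed.

Lemma entries_glue_step T (A : set (T -> R)) P (Q : T -> 'M[R]_D) t :
  function_algebra A -> entries A Q -> A t ->
  A (fun x => (\det (interpolant P (Q x) (t x)))^-1) ->
  entries A (fun x => glue_step P (Q x) (t x)).
Proof.
move=> hA hQ ht hd; have hI := entries_interpolant P hA hQ ht.
apply: (entriesM hA) => //; apply: (entriesM hA); last exact: entries_cst.
exact: entries_inv.
Qed.

Context {V : topologicalType} {M : Type} (lam : M -> V -> R) (P : M -> 'M[R]_D).

Definition weight (q : seq M) x : R := \sum_(m <- q) lam m x.

Definition blend m (q : seq M) x : R := weight q x / (lam m x + weight q x).

(** The value [0] for the empty list is a placeholder: where [weight q' x] vanishes, [blend] is [0]
    and the step returns [P m] whatever the previous matrix is. *)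
Fixpoint glued (q : seq M) (x : V) : 'M[R]_D :=
  if q isn't m :: q' then 0 else
  if lam m x == 0 then glued q' x else glue_step (P m) (glued q' x) (blend m q'
    x).

Variables (X : set V) (p : V -> 'M[R]_D) (b e : R) (k : nat).
Hypotheses (lam_ge0 : forall m x, 0 <= lam m x)
  (lam_cont : forall m, continuous (lam m))
  (P_idem : forall m, P m *m P m = P m)
  (p_b : forall x, X x -> sumnorm (p x) <= b - 1) (Db : D%:R <= b) (b1 : 1 <= b)
  (P_near : forall m x, X x -> 0 < lam m x -> sumnorm (P m - p x) <= e).
(** Growth of the error [E] in one step: [glue_step_bounds] at distance [2 * E] gives
    [16 * b ^+ 3 * E], to which the distance [e <= E] from [P m] to [p] is added. The bound [b - 1]
    for [p] leaves room for an error of at most [1], so that [b] bounds the glued matrices. *)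
Local Notation C := (16 * b ^+ 3 + 1).
Hypotheses (e_ge0 : 0 <= e) (e_small : 4 * b * (C ^+ k * e) <= 2^-1).

Definition active (q : seq M) x := count (fun m => 0 < lam m x) q.

Lemma weight_ge0 q x : 0 <= weight q x.
Proof. exact: sumr_ge0. Qed.

Lemma C_ge1 : 1 <= C.
Proof. by rewrite lerDr mulr_ge0 // exprn_ge0 // (le_trans ler01 b1). Qed.

Lemma error_mono i : (i <= k)%N -> C ^+ i * e <= C ^+ k * e.
Proof. by move=> ik; rewrite ler_wpM2r // ler_weXn2l // C_ge1. Qed.

Lemma error_le1 : C ^+ k * e <= 1.
Proof.
have h : 0 <= C ^+ k * e.
  by rewrite mulr_ge0 // exprn_ge0 // (le_trans ler01 C_ge1).
apply: (@le_trans _ _ (4 * b * (C ^+ k * e))); last by move: e_small; lra.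
by rewrite ler_peMl //; move: b1; lra.
Qed.

Lemma blend_itv m q x : 0 < lam m x -> 0 <= blend m q x <= 1.
Proof.
move=> l0; have w0 := weight_ge0 q x.
have d0 : 0 < lam m x + weight q x by rewrite ltr_wpDr.
by rewrite divr_ge0 ?(ltW d0) //= ler_pdivrMr // mul1r lerDr ltW.
Qed.

Lemma blend_compl m q x : 0 < lam m x + weight q x ->
  1 - blend m q x = lam m x / (lam m x + weight q x).
Proof.
by move=> h; rewrite -[1](divff (lt0r_neq0 h)) -mulrBl addrK.
Qed.

Definition near_projector q x :=
  glued q x *m glued q x = glued q x /\ sumnorm (glued q x - p x) <= C ^+
    active q x * e.

(** If [weight q x = 0], then [t = 0] and the step is trivial, so nothing has to be known about
    [glued q x]; hence the conditional last hypothesis. *)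
Lemma step_estimates m q x : X x -> 0 < lam m x -> (active (m :: q) x <= k)%N ->
  (0 < weight q x -> near_projector q x) ->
  [/\ interpolant (P m) (glued q x) (blend m q x) \in unitmx,
      sumnorm (glue_step (P m) (glued q x) (blend m q x) - P m) <=
        16 * b ^+ 3 * (C ^+ active q x * e) * blend m q x &
      0 < weight q x ->
      sumnorm (glue_step (P m) (glued q x) (blend m q x) - glued q x) <=
        (1 - blend m q x) * (2 * b)].
Proof.
move=> Xx l0; rewrite /= l0 add1n => actk near_q.
have [w0|w0] := ltrP 0 (weight q x); last first.
  have wE : weight q x = 0 by apply/eqP; rewrite eq_le w0 weight_ge0.
  have tE : blend m q x = 0 by rewrite /blend wE mul0r.
  rewrite tE glue_step0 /interpolant scale0r addr0 unitmx1 subrr sumnorm0 mulr0.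
  by split=> //; rewrite ltxx.
have [QQ Qp] := near_q w0; set E := C ^+ active q x * e in Qp *.
have EK : E <= C ^+ k * e by apply: error_mono; exact: ltnW.
have E0 : 0 <= E by rewrite mulr_ge0 // exprn_ge0 // (le_trans ler01) // C_ge1.
have Ee : e <= E.
  by rewrite -[leLHS]mul1r ler_wpM2r // -[leLHS](expr1n _ (active q x)) lerXn2r
    ?nnegrE // ?(le_trans ler01) // C_ge1.
have b0 : 0 <= b by move: b1; lra.
have E1 : E <= 1 by apply: (le_trans EK); exact: error_le1.
have Pp := P_near Xx l0; have pb := p_b Xx.
have Pb : sumnorm (P m) <= b.
  by have := ler_sumnormD (P m - p x) (p x); rewrite subrK; lra.
have Qb : sumnorm (glued q x) <= b.
  by have := ler_sumnormD (glued q x - p x) (p x); rewrite subrK; lra.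
have QP : sumnorm (glued q x - P m) <= 2 * E.
  have := ler_sumnormD (glued q x - p x) (p x - P m).
  by rewrite addrA subrK (sumnormC (p x)); lra.
have small : 2 * b * (2 * E) <= 2^-1.
  apply: le_trans e_small; have -> : 2 * b * (2 * E) = 4 * b * E by ring.
  by rewrite ler_wpM2l // mulr_ge0.
have [uU h1 h2] := glue_step_bounds (P_idem m) QQ Db Pb Qb QP small (blend_itv
  q l0).
split=> // [|_].
  by apply: (le_trans h1); rewrite le_eqVlt; apply/orP; left; apply/eqP; ring.
apply: (le_trans h2); apply: ler_wpM2l.
  by have /andP[_] := blend_itv q l0; rewrite subr_ge0.
by move: small b1; lra.
Qed.

Lemma glue_near q : (forall x, X x -> (active q x <= k)%N) ->
  forall x, X x -> 0 < weight q x -> near_projector q x.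
Proof.
elim: q => [_ x _|m q IH actk x Xx]; first by rewrite /weight big_nil ltxx.
have act_q y : X y -> (active q y <= k)%N.
  by move=> Xy; apply: leq_trans (actk y Xy); rewrite /= leq_addl.
rewrite /weight big_cons -/(weight q x) /near_projector /= => w0.
case: eqP => [l0|/eqP l0].
  by rewrite l0 ltxx add0n; apply: IH => //; move: w0; rewrite l0 add0r.
have {}l0 : 0 < lam m x by rewrite lt_def l0 lam_ge0.
have [uU h1 _] := step_estimates Xx l0 (actk x Xx) (IH act_q x Xx).
split; first exact: glue_step_idem.
rewrite l0 add1n exprS.
set E := C ^+ active q x * e in h1 *.
have E0 : 0 <= E by rewrite mulr_ge0 // exprn_ge0 // (le_trans ler01) // C_ge1.
have Ee : e <= E.
  by rewrite -[leLHS]mul1r ler_wpM2r // -[leLHS](expr1n _ (active q x)) lerXn2r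
    ?nnegrE // ?(le_trans ler01) // C_ge1.
set G := glue_step _ _ _ in h1 *.
have := ler_sumnormD (G - P m) (P m - p x); rewrite addrA subrK => h.
apply: (le_trans h); rewrite -mulrA -/E mulrDl mul1r.
apply: lerD; last exact: le_trans (P_near Xx l0) Ee.
apply: (le_trans h1); rewrite ler_piMr //; last first.
  by have /andP[] := blend_itv q l0.
by rewrite mulr_ge0 // mulr_ge0 // exprn_ge0 //; move: b1; lra.
Qed.

Lemma weight_cont q x : cont_at X x (weight q).
Proof.
apply: (falg_sum (cont_at_algebra X x)) => m.
by apply: cont_at_continuous; exact: lam_cont.
Qed.

Lemma blend_cont m q x : 0 < lam m x + weight q x -> cont_at X x (blend m q).
Proof.
move=> h; have hA := @cont_at_algebra V R X x.
have lc : cont_at X x (lam m) by apply: cont_at_continuous; exact: lam_cont.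
apply: (falgM hA); first exact: weight_cont.
apply: cont_at_inv; first exact: lt0r_neq0.
by apply: (falgD hA) => //; exact: weight_cont.
Qed.

Lemma lam_pos_near m x : 0 < lam m x -> \forall y \near within X (nbhs x),
  0 < lam m y.
Proof.
move=> l0; have := lam_cont (m := m) (x := x) => /cvgr_gt /(_ 0 l0).
by move=> h; rewrite near_withinE; apply: filterS h => y.
Qed.

(** The recursion changes formula where [lam m] vanishes, and [glued q] is uncontrolled where
    [weight q] vanishes. Near a point of the first kind the result differs from [glued q] by a
    multiple of [1 - t], near one of the second kind from [P m] by a multiple of [t], and these
    factors tend to [0]. *)
Lemma glue_cont q : (forall x, X x -> (active q x <= k)%N) ->
  forall x, X x -> 0 < weight q x -> entries (cont_at X x) (glued q).
Proof.
elim: q => [_ x _|m q IH actk x Xx]; first by rewrite /weight big_nil ltxx.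
have act_q y : X y -> (active q y <= k)%N.
  by move=> Xy; apply: leq_trans (actk y Xy); rewrite /= leq_addl.
rewrite /weight big_cons -/(weight q x) => w0.
have hA := @cont_at_algebra V R X x.
have est y : X y -> 0 < lam m y -> _ :=
  fun Xy ly => step_estimates Xy ly (actk y Xy) (glue_near act_q Xy).
have blend_c := blend_cont w0.
have EK y : X y -> C ^+ active q y * e <= 1.
  by move=> Xy; apply: le_trans (error_mono (act_q y Xy)) error_le1.
have [l0|l0] := ltrP 0 (lam m x); last first.
  have lE : lam m x = 0 by apply/eqP; rewrite eq_le l0 lam_ge0.
  have wq : 0 < weight q x by move: w0; rewrite lE add0r.
  have wn : \forall y \near within X (nbhs x), 0 < weight q y.
    by have /cvgr_gt /(_ 0 wq) := @weight_cont q x.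
  have df : entries (cont_at X x) (fun y => glued (m :: q) y - glued q y).
    apply: (@cont_at_squeeze _ _ X x _ _ _ 0
      (fun y => (1 - blend m q y) * (2 * b))).
    - by rewrite /= lE eqxx subrr.
    - have -> : 0 = (1 - blend m q x) * (2 * b).
        by rewrite blend_compl // lE mul0r mul0r.
      apply: (falgM hA); last exact: falg_cst.
      by apply: (falgB hA) => //; exact: falg_cst.
    - have Xn : \forall y \near within X (nbhs x), X y by exact: withinT.
      apply: filterS2 Xn wn => y Xy wy; rewrite subr0 /=.
      case: eqP => [ly|/eqP ly].
        by rewrite subrr sumnorm0 blend_compl ly ?add0r // mul0r mul0r.
      have {}ly : 0 < lam m y by rewrite lt_def ly lam_ge0.
      by have [_ _] := est y Xy ly; apply.
  apply: (@entries_ext _ _ _ _ _ (fun y => (glued (m ::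
    q) y - glued q y) + glued q y)).
    by move=> y; rewrite subrK.
  by apply: (entriesD hA) => //; exact: IH.
have ln := lam_pos_near l0.
have [wq|wq] := ltrP 0 (weight q x).
  have [uU _ _] := est x Xx l0.
  have cs : entries (cont_at X x)
      (fun y => glue_step (P m) (glued q y) (blend m q y)).
    apply: entries_glue_step => //; first exact: IH.
    apply: cont_at_inv; first by move: uU; rewrite unitmxE unitfE.
    by apply: (falg_det hA); apply: entries_interpolant => //; exact: IH.
  move=> i j; apply: (cont_at_near Xx _ (cs i j)).
  by apply: filterS ln => y ly /=; rewrite gt_eqF.
have wE : weight q x = 0 by apply/eqP; rewrite eq_le wq weight_ge0.
apply: (@cont_at_squeeze _ _ X x _ _ _ (P m) (fun y =>
  16 * b ^+ 3 * blend m q y)).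
- by rewrite /= gt_eqF // /blend wE mul0r glue_step0.
- have -> : 0 = 16 * b ^+ 3 * blend m q x by rewrite /blend wE mul0r mulr0.
  by apply: (falgM hA) => //; exact: falg_cst.
- have Xn : \forall y \near within X (nbhs x), X y by exact: withinT.
  apply: filterS2 Xn ln => y Xy ly; rewrite /= gt_eqF //.
  have [_ h _] := est y Xy ly; apply: (le_trans h).
  have /andP[t0 _] := blend_itv q ly; apply: ler_wpM2r => //.
  rewrite -[leRHS]mulr1; apply: ler_wpM2l; last exact: EK.
  by rewrite mulr_ge0 // exprn_ge0 //; move: b1; lra.
Qed.

End Gluing.

(** * Existence *)

Section AlgebraicExtension.
Context {R : realType} {F : scalar_kind} {V : function_space R} {I : Type}
  (c : I -> V -> R).
Hypothesis hc : presented_by c.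
Local Notation d := (scalar_dim F).
Local Notation Fn n := 'rV[scalars R F]_n.

Lemma subset_zariski_closure (A : set V) : A `<=` zariski_closure A.
Proof. by move=> x Ax C _; exact. Qed.

Lemma zariski_closure_mono (A B : set V) : A `<=` B ->
  zariski_closure A `<=` zariski_closure B.
Proof. by move=> AB x Ax C cC BC; apply: Ax cC _ => y /AB /BC. Qed.

(** Density in the Zariski closure. The closed set used is [u * w = 0] rather than [u = 0], because
    nothing is known about [u] at points of [Sigma] where [w] vanishes. *)
Lemma zero_extension (Sigma Z : set V) f : Sigma `<=` Z ->
  Z `<=` zariski_closure Sigma ->
  (forall z, Z z -> rational_on c [set z] Z f) ->
  (forall x, Sigma x -> f x = 0) -> forall z, Z z -> f z = 0.
Proof.
move=> SZ Zcl rf f0 z Zz; have [u [w [pu pw w0 fE]]] := rf z Zz.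
have uw : u z * w z = 0.
  apply: (Zcl z Zz [set y | u y * w y = 0]) => [|x Sx /=].
    apply/hc.1 => y /eqP uwy; exists (fun y => u y * w y); split=> //.
      exact: PolyMul.
    by move=> t /eqP.
  have [->|wx] := eqVneq (w x) 0; first by rewrite mulr0.
  have := fE x (SZ x Sx) wx; rewrite f0 // => /esym/eqP.
  by rewrite mulf_eq0 invr_eq0 (negPf wx) orbF => /eqP ->; rewrite mul0r.
move/eqP: uw; rewrite mulf_eq0 (negPf (w0 z erefl)) orbF => /eqP uz.
by rewrite fE ?w0 // uz mul0r.
Qed.

Lemma restriction_fixed_bundle n (Z Sigma : set V) (Q Q' : V -> 'M[R]_(n * d)) :
  Sigma `<=` Z -> (forall x, Sigma x -> Q x = Q' x) ->
  restriction (@fixed_bundle R F V n Z Q) Sigma = @fixed_bundle R F V n Sigma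
    Q'.
Proof.
move=> SZ QQ'; apply/seteqP; split=> -[x v] /=.
  by move=> [[/= Zx vQ] [/= Sx _]]; split=> //=; rewrite -QQ'.
by move=> [/= Sx vQ]; split; split=> //=; [exact: SZ|rewrite QQ'].
Qed.

(** The quotients define [Q'] wherever no denominator vanishes. Idempotence and [F]-linearity are
    identities between rational functions, so there they pass from [Sigma] to its Zariski
    closure. *)
Lemma rational_bundle_algebraic n (Sigma : set V) (Q : V -> 'M[R]_(n * d)) :
  @linear_projector R F V n Sigma Q ->
  entries (rational_on c Sigma Sigma) Q ->
  algebraic_bundle Sigma (@fixed_bundle R F V n Sigma Q).
Proof.
move=> hQ rQ.
have /choice[u /choice[w uwP]] (t : 'I_(n * d) * 'I_(n * d)) : exists u,
  exists w,
    [/\ polynomial_in c u, polynomial_in c w,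
    forall y, Sigma y -> w y != 0 &
    forall y, Sigma y -> w y != 0 -> Q y t.1 t.2 = u y / w y] := rQ t.1 t.2.
pose W x := \prod_t w t x.
have pW : polynomial_in c W.
  by apply: (falg_prod (polynomial_algebra c)) => t; have [] := uwP t.
pose Z := zariski_closure Sigma `&` [set x | W x != 0].
pose Q' x : 'M[R]_(n * d) := \matrix_(i, j) (u (i, j) x / w (i, j) x).
have wW x t : W x != 0 -> w t x != 0 by move/prodf_neq0; apply.
have SZ : Sigma `<=` Z.
  move=> x Sx; split; first exact: subset_zariski_closure.
  by apply/prodf_neq0 => t _; have [_ _ + _] := uwP t; apply.
have Zcl : Z `<=` zariski_closure Sigma by move=> x [].
have QQ' x : Sigma x -> Q' x = Q x.
  move=> Sx; apply/matrixP => i j; rewrite mxE.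
  have [_ _ w0 ->] := uwP (i, j) => //; exact: w0.
have rQ' z : Z z -> entries (rational_on c [set z] Z) Q'.
  move=> [_ Wz] i j; have [pu pw w0 _] := uwP (i, j).
  exists (u (i, j)), (w (i, j)); split=> // [_ ->|y _ _]; first exact: wW.
  by rewrite mxE.
have ext (A : V -> 'M[R]_(n * d)) :
    (forall z, Z z -> entries (rational_on c [set z] Z) A) ->
    (forall x, Sigma x -> A x = 0) -> forall z, Z z -> A z = 0.
  move=> rA A0 z Zz; apply/matrixP => i j; rewrite [RHS]mxE.
  apply: (zero_extension SZ Zcl (f := fun x => A x i j)) => // [y Zy|x Sx].
    exact: rA.
  by rewrite A0 // mxE.
have hQ' : @linear_projector R F V n Z Q'.
  move=> z Zz; split=> [|a]; apply/eqP; rewrite -subr_eq0; apply/eqP.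
    apply: (ext (fun x => Q' x *m Q' x - Q' x)) => // [y Zy|x Sx].
      have hA := rational_algebra c [set y] Z.
      by apply: (entriesB hA); [apply: (entriesM hA)|]; exact: rQ'.
    by have [QQ _] := hQ x Sx; rewrite QQ' // QQ subrr.
  apply: (ext (fun x => smul_mx n a *m Q' x - Q' x *m smul_mx n a)) =>
    // [y Zy|x Sx].
    have hA := rational_algebra c [set y] Z.
    have hC B := entries_cst hA (B : 'M[R]_(n * d)).
    by apply: (entriesB hA); apply: (entriesM hA) => //; exact: rQ'.
  by have [_ lQ] := hQ x Sx; rewrite QQ' // lQ subrr.
split.
  apply: fixed_bundle_topological => // x Sx i j.
  apply: (rational_cont_at hc) => //; apply: rational_sub (rQ i j) => // _ ->
    //.
exists Z, (@fixed_bundle R F V n Z Q'); split.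
- split=> //; exists [set x | W x != 0]; split=> //.
  exact/hc.1/generated_open_principal.
- exact: (fixed_bundle_algebraic hc).
- exact: restriction_fixed_bundle.
Qed.

End AlgebraicExtension.

Section GluedBundle.
Context {R : realType} {F : scalar_kind} {V : function_space R} {I : Type}
  (c : I -> V -> R).
Hypothesis hc : presented_by c.
Local Notation d := (scalar_dim F).
Local Notation Fn n := 'rV[scalars R F]_n.

Lemma scalar_linear_mx_inv n (A : 'M[R]_(n * d)) :
  @scalar_linear R F n n A -> @scalar_linear R F n n (mx_inv A).
Proof.
move=> lA; have [uA|nA] := boolP (A \in unitmx).
  by rewrite mx_inv_unit //; exact: scalar_linear_inv.
move: nA; rewrite unitmxE unitfE negbK /mx_inv => /eqP ->.
by rewrite invr0 scale0r; exact: scalar_linear0.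
Qed.

Lemma scalar_linear_glue n M (lam : M -> V -> R) (P : M -> 'M[R]_(n * d)) q x :
  (forall m, @scalar_linear R F n n (P m)) ->
  @scalar_linear R F n n (glued lam P q x).
Proof.
move=> lP; elim: q => [|m q IH] /=; first exact: scalar_linear0.
case: ifP => // _; set t := blend _ _ _ _.
have lU : @scalar_linear R F n n (interpolant (P m) (glued lam P q x) t).
  have l1 := @scalar_linear1 R F n.
  apply: scalar_linearD => //; apply: scalar_linearZ.
  apply: scalar_linearD; last exact: scalar_linearN.
  exact: scalar_linear_transition.
apply: scalar_linearM => //; apply: scalar_linearM => //.
exact: scalar_linear_mx_inv.
Qed.

(** On [Sigma] each step is either always skipped or always performed, so the case distinction in
    [glued] disappears. Invertibility is assumed for all tails of [q], because each stage divides by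
    its own determinant. *)
Lemma rational_glue D M (lam : M -> V -> R) (P : M -> 'M[R]_D) (Sigma :
  set V) q :
  (forall m, (forall x, Sigma x -> lam m x = 0) \/
     exists2 g, polynomial_in c g &
       forall x, Sigma x -> 0 < lam m x /\ lam m x = g x) ->
  (forall m x, 0 <= lam m x) ->
  (forall m q' x, (exists q0, q = q0 ++ m :: q') -> Sigma x -> 0 < lam m x ->
     interpolant (P m) (glued lam P q' x) (blend lam m q' x) \in unitmx) ->
  entries (rational_on c Sigma Sigma) (glued lam P q).
Proof.
move=> lamP lam0; have hA := rational_algebra c Sigma Sigma.
have rlam m : rational_on c Sigma Sigma (lam m).
  have [l0|[g pg lg]] := lamP m.
    apply: (@rational_ext _ _ _ _ _ _ (fun=> 0)); last exact: falg_cst.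
    by move=> x /set_mem Sx; rewrite l0.
  apply: (@rational_ext _ _ _ _ _ _ g); last exact: rational_polynomial.
  by move=> x /set_mem Sx; have [_ ->] := lg x Sx.
have rw s : rational_on c Sigma Sigma (weight lam s) by exact: (falg_sum hA).
elim: q => [_|m q IH uU]; first exact: entries_cst.
have {}IH : entries (rational_on c Sigma Sigma) (glued lam P q).
  apply: IH => m' q' x [q0 qE] Sx lx.
  by apply: uU => //; exists (m :: q0); rewrite qE.
have [l0|[g pg lg]] := lamP m.
  move=> i j; apply: (@rational_ext _ _ _ _ _ _ (fun x =>
    glued lam P q x i j)) => //.
  by move=> x /set_mem Sx /=; rewrite l0 // eqxx.
have lpos x : Sigma x -> 0 < lam m x by move=> /lg[].
have rb : rational_on c Sigma Sigma (blend lam m q).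
  apply: (falgM hA) => //; apply: rational_inv => //; first exact: (falgD hA).
  move=> x Sx; apply: lt0r_neq0; rewrite ltr_pwDl ?lpos //.
  exact: weight_ge0.
have rs : entries (rational_on c Sigma Sigma)
    (fun x => glue_step (P m) (glued lam P q x) (blend lam m q x)).
  apply: entries_glue_step => //; apply: rational_inv => //.
    by apply: (falg_det hA); exact: entries_interpolant.
  move=> x Sx; rewrite -unitfE -unitmxE; apply: uU => //; last exact: lpos.
  by exists [::].
move=> i j; apply: rational_ext (rs i j) => x /set_mem Sx /=.
by rewrite gt_eqF // lpos.
Qed.

End GluedBundle.

Section Embedding.
Context {R : realType} {F : scalar_kind} {V : function_space R} {N : nat}
  (c : 'I_N -> V -> R).
Hypothesis hc : presented_by c.
Local Notation d := (scalar_dim F).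
Local Notation Fn n := 'rV[scalars R F]_n.

(** The local coordinates [k m], multiplied by [lam m] and thus extended by zero, are collected in
    one vector; a single positive weight at a point gives injectivity on the fiber. *)
Lemma bundle_embedding (X : set V) (xi : vector_family R F V) : compact X ->
  vector_bundle X xi -> exists n (iota : ambient xi -> Fn n),
  [/\ {within total_set xi, continuous iota},
      forall e e', total_set xi e -> total_set xi e' ->
        bundle_proj xi e = bundle_proj xi e' ->
        iota (fadd e e') = iota e + iota e',
      forall a e, total_set xi e -> iota (fscale a e) = a *: iota e &
      forall e e', total_set xi e -> total_set xi e' ->
        bundle_proj xi e = bundle_proj xi e' -> iota e = iota e' -> e = e'].
Proof.
move=> cX hxi; have [piX cpi loc] := hxi; have [opD opZ] :=
  bundle_operations hxi.
have /choice[U UP] (a : V) : exists U : set V, X a -> [/\ open U, U a &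
    exists (r : nat) h k, @trivialization R F V X xi U r h k].
  have [Xa|nXa] := pselect (X a); last by exists setT.
  by have [U [oU [Ua t]]] := loc a Xa; exists U.
have nU a : X a -> nbhs a (U a).
  by move=> /UP[oU Ua _]; exact: open_nbhs_nbhs.
have [M [T [lam [f [a [_ lamP lam_cov aP _]]]]]] := bump_functions hc cX nU.
have tr m : exists (r : nat) h k, @trivialization R F V X xi (U (a m)) r h k.
  by have [/UP[]] := aP m.
have /choice[r rP] : forall m, exists r, exists h k,
  @trivialization R F V X xi (U (a m)) r h k := tr.
pose h m := sval (cid (rP m)).
have /(fun h => fun m => cid (h m)) kP m := svalP (cid (rP m)).
pose k m := sval (kP m).
have triv m : trivialization X (U (a m)) (h m) (k m) := svalP (kP m).
pose S : finType := {m : M & 'I_(r m)}.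
pose coef (s : S) (e : ambient xi) : scalars R F :=
  scalar_of_real (lam (tag s) (bundle_proj xi e)) * k (tag s) e 0 (tagged s).
pose iota e : Fn #|S| := \row_t coef (enum_val t) e.
have lam_pos m x : 0 < lam m x -> U (a m) x.
  move=> lx; have [_ /(_ x) [//|/nbhs_singleton lx0]] := aP m.
  by move: lx; rewrite lx0 ltxx.
have kD m e e' : total_set xi e -> total_set xi e' ->
    bundle_proj xi e = bundle_proj xi e' -> U (a m) (bundle_proj xi e) ->
    k m (fadd e e') = k m e + k m e'.
  move=> te te' ee' Ue; have [_ _ hP kK hlin] := triv m; have Xe := piX e te.
  have [hD _] := hlin _ Xe Ue.
  rewrite -{1}[e](kK e te Ue) -{1}[e'](kK e' te' _) -?ee' // -hD.
  by have [_ _ ->] := hP _ (k m e + k m e') Xe Ue.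
have kZ m b e : total_set xi e -> U (a m) (bundle_proj xi e) ->
    k m (fscale b e) = b *: k m e.
  move=> te Ue; have [_ _ hP kK hlin] := triv m; have Xe := piX e te.
  have [_ hZ] := hlin _ Xe Ue.
  rewrite -{1}[e](kK e te Ue) -hZ.
  by have [_ _ ->] := hP _ (b *: k m e) Xe Ue.
have lam0 m x : ~ U (a m) x -> lam m x = 0.
  move=> nU'; apply/eqP; apply: contraPT isT => lx _; apply: nU'; apply:
    lam_pos.
  by rewrite lt_def lx; have [-> _] := lamP m.
have sr0 : scalar_of_real 0 = 0 :> scalars R F.
  have := @scalar_coordsZ R F 0 1; rewrite mulr1 scale0r => sr.
  rewrite -[LHS]scalar_coordsK sr -[RHS]scalar_coordsK; congr scalar_of_coords.
  by apply: (addrI (scalar_coords 0)); rewrite -scalar_coordsD !addr0.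
exists #|S|, iota; split.
- apply/cont_at_within => e te; apply/cont_at_realify => i j.
  rewrite ord1; case/mxvec_indexP: j => t l; set s := enum_val t.
  have E y : realify (iota y) 0 (mxvec_index t l) =
      lam (tag s) (bundle_proj xi y) * scalar_coords (k (tag s) y 0 (tagged s))
        0 l.
    by rewrite realify_entry mxE /coef scalar_coordsZ mxE.
  rewrite (_ : (fun y => _) = fun y => lam (tag s) (bundle_proj xi y) *
      scalar_coords (k (tag s) y 0 (tagged s)) 0 l); last exact/funext.
  have hA := @cont_at_algebra _ R (total_set xi) e.
  have cpe := (cont_at_within _ _).1 cpi e te.
  (* Off [U (a m)] the map [k m] is uncontrolled, but [lam m] vanishes in a whole neighborhood of
     the point, not only at it. *)
  have [Us|nUs] := pselect (U (a (tag s)) (bundle_proj xi e)); last first.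
    have [_ /(_ (bundle_proj xi e)) [//|hn]] := aP (tag s).
    apply: (@cont_at_near _ _ (total_set xi) e (fun=> 0)) => //.
      have hn' : \forall y \near within (total_set xi) (nbhs e),
        lam (tag s) (bundle_proj xi y) = 0 by exact: (cpe _ hn).
      by apply: filterS hn' => y ly; rewrite ly mul0r.
    exact: cont_at_cst.
  apply: (falgM hA).
    apply: (@cont_at_comp _ _ _ _ _ (bundle_proj xi) X (lam (tag s))) => //.
    by apply: cont_at_continuous; have [_ cl] := lamP (tag s); exact: cl.
  have [_ ck _ _ _] := triv (tag s).
  have [oU _ _] := UP _ (aP (tag s)).1.
  have kc : cont_at (total_set xi `&` bundle_proj xi @^-1` U (a (tag s))) e
      (k (tag s)) by exact: ((cont_at_within _ _).1 ck e (conj te Us)).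
  have kc' : cont_at (total_set xi) e (k (tag s)).
    move=> A /kc; rewrite /= /nbhs /= /within /= => hA'.
    have := cpe _ (open_nbhs_nbhs (conj oU Us));
      rewrite /= /nbhs /= /within /= => hU.
    by apply: filterS2 hA' hU => y h1 h2 ty; apply: h1; split=> //; exact: h2.
  have /cont_at_realify /(_ 0 (mxvec_index (tagged s) l)) := kc'.
  rewrite (_ : (fun y => realify _ _ _) =
    fun y => scalar_coords (k (tag s) y 0 (tagged s)) 0 l) //.
  by apply/funext => y; rewrite realify_entry.
- move=> e e' te te' ee'; have [tee bee] := opD e e' te te' ee'.
  apply/rowP => t; rewrite !mxE /coef bee -ee'.
  have [Us|nUs] := pselect (U (a (tag (enum_val t))) (bundle_proj xi e)).
    by rewrite kD // mxE mulrDr.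
  by rewrite lam0 // sr0 !mul0r addr0.
- move=> b e te; have [tbe bbe] := opZ b e te.
  apply/rowP => t; rewrite !mxE /coef bbe.
  have [Us|nUs] := pselect (U (a (tag (enum_val t))) (bundle_proj xi e)).
    by rewrite kZ // mxE !mulrA scalar_of_real_comm.
  by rewrite lam0 // sr0 !mul0r mulr0.
- move=> e e' te te' ee' ie.
  have [m lm] := lam_cov _ (piX e te); have Ue := lam_pos m _ lm.
  have [_ _ _ kK _] := triv m.
  suff kk : k m e = k m e'.
    by rewrite -(kK e te Ue) -(kK e' te' _) -?ee' // kk.
  apply/rowP => i; have := congr1 (fun v : Fn #|S| =>
    v 0 (enum_rank (Tagged (fun m => 'I_(r m)) i : S))) ie.
  rewrite !mxE /coef enum_rankK /= -ee' => /(congr1 (fun x =>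
    scalar_of_real (lam m (bundle_proj xi e))^-1 * x)).
  move=> /(congr1 (@scalar_coords R F)); rewrite !scalar_coordsZ !scalerA.
  rewrite mulVf ?gt_eqF // !scale1r => /(congr1 scalar_of_coords).
  by rewrite !scalar_coordsK.
Qed.

Lemma piecewise_algebraization (X : set V) (xi : vector_family R F V) :
  compact X ->
  vector_bundle X xi -> exists n (E : set (V * Fn n)),
    piecewise_algebraic_bundle X E /\ topologically_isomorphic xi (subfamily E).
Proof.
move=> cX hxi.
have [n [iota [ciota iotaD iotaZ iota_inj]]] := bundle_embedding cX hxi.
have [piX _ _] := hxi.
pose img x : set (Fn n) :=
  [set v | exists e, [/\ total_set xi e, bundle_proj xi e = x & iota e = v]].
have frames : has_frames X img.
  move=> x Xx.
  have [ O [r [h [k [M [oO Ox _ _ hM]]]]]] :=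
    frames_of_embedding hxi ciota iotaD iotaZ iota_inj Xx.
  by exists O, r, M.
pose p := proj_fiber img.
have pP x : X x -> _ := proj_fiberP frames.
(* [D * D] bounds the norm of every orthogonal projector and is at most [b - 1]; the summand [D]
   ensures [D%:R <= b]. *)
pose D := (n * d)%N; pose b : R := (D * D + D + 1)%:R.
pose C : R := 16 * b ^+ 3 + 1; pose k := (2 ^ N)%N.
have b1 : 1 <= b by rewrite ler1n addn1.
have C0 : 0 < C by rewrite ltr_wpDl // mulr_ge0 // exprn_ge0 // (le_trans
  ler01).
(* Makes [4 * b * (C ^+ k * e)] equal to [1 / 2]. It has to be fixed before the bumps, which are
   built for the sets [U] defined by [e]. *)
pose e : R := (8 * b * C ^+ k)^-1.
have b0 : 0 < b by exact: lt_le_trans ltr01 b1.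
have e0 : 0 < e by rewrite invr_gt0 !mulr_gt0 // exprn_gt0.
have e_small : 4 * b * (C ^+ k * e) <= 2^-1.
  have Ck : C ^+ k != 0 by rewrite expf_neq0 // gt_eqF.
  have bn : b != 0 by rewrite gt_eqF.
  rewrite /e le_eqVlt; apply/orP; left; apply/eqP.
  have gen (B Z : R) : B != 0 -> Z != 0 -> 4 * B * (Z * (8 * B * Z)^-1) = 2^-1.
    by move=> B0 Z0; field; rewrite B0 Z0.
  exact: gen.
pose U a : set V := [set x | X x -> sumnorm (p a - p x) < e].
have nU a : X a -> nbhs a (U a).
  move=> Xa; have [_ _ _ _ cp] := pP a Xa.
  have hA := @cont_at_algebra V R X a.
  have : cont_at X a (fun x => sumnorm (p a - p x)).
    apply: cont_at_sumnorm; apply: (entriesB hA) => //; exact: entries_cst.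
  move=> /cvgr_lt /(_ e); rewrite subrr sumnorm0 => /(_ e0).
  by rewrite near_withinE.
have [M [T [lam [f [a [pf lamP lam_cov aP [lam_act lam_piece]]]]]]] :=
  bump_functions hc cX nU.
have lam_ge0 m x : 0 <= lam m x by have [] := lamP m.
have lam_cont m : continuous (lam m) by have [] := lamP m.
pose P m := p (a m).
have P_idem m : P m *m P m = P m by have [_ ? _ _ _] := pP _ (aP m).1.
have P_near m x : X x -> 0 < lam m x -> sumnorm (P m - p x) <= e.
  move=> Xx lx; have [_ /(_ x) [h|/nbhs_singleton h]] := aP m.
    exact: ltW (h Xx).
  by move: lx; rewrite h ltxx.
have p_b x : X x -> sumnorm (p x) <= b - 1.
  move=> Xx; have [pT pp _ _ _] := pP x Xx.
  have /sumnorm_projector h : orthogonal_projector [set u | u *m p x = u] (p x).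
    by [].
  by apply: (le_trans h); rewrite /b natrD addrK ler_nat leq_addr.
have Db : D%:R <= b by rewrite ler_nat -addnA addnC -addnA leq_addr.
pose q := enum M.
have actk x : X x -> (active lam q x <= k)%N.
  move=> _; apply: leq_trans (lam_act x); rewrite cardE /active -size_filter.
  by rewrite /enum_mem -enumT.
pose Q := glued lam P q.
have wpos x : X x -> 0 < weight lam q x.
  move=> Xx; have [m lm] := lam_cov x Xx.
  rewrite /weight (big_rem m) ?mem_enum //=.
  by rewrite ltr_pwDl //; exact: sumr_ge0.
have lP m : @scalar_linear R F n n (P m) by have [_ _ _ ? _] := pP _ (aP m).1.
have Qnear x Xx := glue_near lam_ge0 P_idem p_b Db b1 P_near (ltW e0) e_small
  actk Xx (wpos x Xx).
have Qcont x Xx := glue_cont lam_ge0 lam_cont P_idem p_b Db b1 P_near (ltW e0)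
  e_small actk Xx (wpos x Xx).
have Qproj : @linear_projector R F V n X Q.
  by move=> x Xx; have [QQ _] := Qnear x Xx; split=> //; exact:
    scalar_linear_glue.
exists n, (@fixed_bundle R F V n X Q); split.
  exists (zero_strata f); first exact: (stratification_zero hc).
  split; first exact: fixed_bundle_topological.
  move=> Sigma pS; have SX := piece_sub pS.
  rewrite (restriction_fixed_bundle (Q' := Q)) //.
  apply: (rational_bundle_algebraic hc); first by move=> x /SX; exact: Qproj.
  apply: rational_glue => // [m|m q' x [q0 qE] Sx lx].
    apply: lam_piece; last by move=> t; exact: (piece_sign t hc pf pS).
    case: pS => A SA [x Ax ->]; exists x; exact: connected_component_refl.
  have actk' y : X y -> (active lam (m :: q') y <= k)%N.
    move=> Xy; apply: leq_trans (actk y Xy).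
    by rewrite qE /active count_cat leq_addl.
  have actq' y : X y -> (active lam q' y <= k)%N.
    by move=> Xy; apply: leq_trans (actk' y Xy); rewrite /= leq_addl.
  have Xx := SX x Sx.
  have [] := step_estimates lam_ge0 P_idem p_b Db b1 P_near (ltW e0) e_small
    Xx lx (actk' x Xx) _ => //.
  exact: (glue_near lam_ge0 P_idem p_b Db b1 P_near (ltW e0) e_small actq' Xx).
have near x : X x -> [/\ p x *m p x = p x, Q x *m Q x = Q x,
    sumnorm (Q x - p x) < 1 & transition (p x) (Q x) \in unitmx].
  move=> Xx; have [pT pp _ _ _] := pP x Xx; have [QQ Qp] := Qnear x Xx.
  have Ce : C ^+ active lam q x * e <= C ^+ k * e.
    exact: (error_mono b1 (ltW e0) (actk x Xx)).
  have d1 : sumnorm (Q x - p x) <= C ^+ k * e by exact: le_trans Qp Ce.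
  have Ce0 : 0 <= C ^+ k * e by rewrite mulr_ge0 ?exprn_ge0 // ltW.
  have bCe : C ^+ k * e <= b * (C ^+ k * e) by rewrite ler_peMl.
  have pb := p_b x Xx.
  have Qb : sumnorm (Q x) <= b.
    have := ler_sumnormD (Q x - p x) (p x); rewrite subrK; lra.
  have pb' : sumnorm (p x) <= b by lra.
  have hW := sumnorm_transition pp QQ pb' Qb d1.
  split=> //; first by lra.
  apply: unitmx_near1; lra.
(* The isomorphism applies [Q x] to the embedded fiber. It is injective because a row [u] of the
   fiber with [u *m Q x = 0] satisfies [u = u *m (p x - Q x)], a contraction; a preimage of [v] is
   [v *m invmx U']. *)
pose phi e := mx_act (Q (bundle_proj xi e)) (iota e).
have lQ x : @scalar_linear R F n n (Q x) by exact: scalar_linear_glue.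
have [opD opZ] := bundle_operations hxi.
have iotaP e' : total_set xi e' ->
    realify (iota e') *m p (bundle_proj xi e') = realify (iota e').
  move=> te; have [_ _ pE _ _] := pP _ (piX e' te).
  by apply/pE; exists e'.
apply: (@embedding_isomorphic _ _ _ n X xi phi).
- exact: hxi.
- apply/cont_at_within => e' te; apply: cont_at_act.
    move=> i j; apply: (@cont_at_comp _ _ _ _ _ (bundle_proj xi) X
      (fun x => Q x i j)) => //.
      by have [_ cpi _] := hxi; exact: (cont_at_within _ _).1 cpi e' te.
    by apply: Qcont; exact: piX.
  exact: (cont_at_within _ _).1 ciota e' te.
- move=> e1 e2 t1 t2 e12; have [_ b12] := opD e1 e2 t1 t2 e12.
  by rewrite /phi b12 iotaD // mx_actD e12.
- move=> s e' te; have [_ bs] := opZ s e' te.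
  by rewrite /phi bs iotaZ // mx_actZ.
- move=> e1 e2 t1 t2 e12 /(congr1 (@realify R F n)); rewrite !realify_act -e12.
  set x := bundle_proj xi e1 => /eqP; rewrite -subr_eq0 -mulmxBl => /eqP uQ.
  apply: iota_inj => //; apply: realify_inj; apply/eqP; rewrite -subr_eq0;
    apply/eqP.
  set u := realify (iota e1) - realify (iota e2) in uQ *.
  have up : u *m p x = u.
    by rewrite mulmxBl iotaP // /x e12 iotaP.
  have [_ _ Qp1 _] := near x (piX _ t1).
  have uE : u = u *m (p x - Q x) by rewrite mulmxBr uQ subr0 up.
  apply: sumnorm_eq0; apply/eqP; rewrite eq_le sumnorm_ge0 andbT.
  have := ler_sumnormM u (p x - Q x); rewrite -uE sumnormC.
  have := sumnorm_ge0 u; nra.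
- move=> [x v]; split=> [[/= Xx vQ]|[e' [te /= <- <-]]]; last first.
    split=> /=; first exact: piX.
    have [QQ _] := Qproj _ (piX _ te).
    by rewrite realify_act -mulmxA QQ.
  have [pp QQ _ uU] := near x Xx; have [_ _ pE _ _] := pP x Xx.
  set U' := transition (p x) (Q x) in uU.
  have wp : realify v *m invmx U' *m p x = realify v *m invmx U'.
    by rewrite -mulmxA transition_inv // mulmxA vQ.
  have /pE [e' [te pe ie]] : realify (unrealify (realify v *m invmx U') :
    Fn n) *m p x
      = realify (unrealify (realify v *m invmx U') :
        Fn n) by rewrite unrealifyK.
  exists e'; split=> //=; apply: realify_inj.
  rewrite realify_act pe ie unrealifyK -wp -mulmxA -(transitionl (Q x) pp).
  by rewrite mulmxA wp mulmxKV.
Qed.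

End Embedding.

(** * Uniqueness *)

Section LinearAlgebra.
Context {R : realType}.

(** Rows fixed by [p] and [p'] stand for two fibers, between which [Phi] and [Phi'] are inverse to
    each other. The error is measured after composition with [Phi'], so composing [p *m Psi *m p']
    with [Phi'] on either side gives a perturbation of [L] times the identity of a fiber. *)
Lemma near_iso_bijective n m (p : 'M[R]_n) (p' : 'M[R]_m) (Phi Psi : 'M[R]_(n,
  m))
    (Phi' : 'M[R]_(m, n)) (L : R) :
  p *m p = p -> p' *m p' = p' -> p *m Phi = Phi ->
  p' *m Phi' = Phi' -> Phi' *m p = Phi' -> Phi *m Phi' = p ->
    Phi' *m Phi = p' ->
  sumnorm (Phi' *m (Psi - L *: Phi) *m p') < L ->
  sumnorm (p *m (Psi - L *: Phi) *m Phi') < L ->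
  (forall u : 'rV_n, u *m p = u -> u *m (p *m Psi *m p') = 0 -> u = 0) /\
  (forall v : 'rV_m, v *m p' = v ->
     exists2 u, u *m p = u & u *m (p *m Psi *m p') = v).
Proof.
move=> pp pp' pPhi p'Phi' Phi'p PhiPhi' Phi'Phi h1 h2.
have L0 : 0 < L by exact: le_lt_trans (sumnorm_ge0 _) h1.
split=> [u up uM|v vp'].
  have uE : L *: u = - (u *m (p *m (Psi - L *: Phi) *m Phi')).
    have -> : p *m (Psi - L *: Phi) *m Phi' = p *m Psi *m p' *m Phi' - L *: p.
      rewrite mulmxBr -scalemxAr pPhi mulmxBl -scalemxAl PhiPhi'.
      by rewrite -(mulmxA _ p' Phi') p'Phi'.
    by rewrite mulmxBr mulmxA uM mul0mx sub0r opprK -scalemxAr up.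
  apply: sumnorm_eq0; apply/eqP; rewrite eq_le sumnorm_ge0 andbT.
  have := congr1 (@sumnorm R 1 n) uE; rewrite sumnormZ gtr0_norm // sumnormN =>
    uN.
  have := ler_sumnormM u (p *m (Psi - L *: Phi) *m Phi'); rewrite -uN.
  have := sumnorm_ge0 u; nra.
set T := Phi' *m (p *m Psi *m p').
have TE : T = Phi' *m (Psi - L *: Phi) *m p' + L *: p'.
  rewrite mulmxBr -scalemxAr Phi'Phi mulmxBl -scalemxAl pp' subrK.
  by rewrite /T !mulmxA Phi'p.
have Tp' : T *m p' = T by rewrite /T -!mulmxA pp'.
(* Adding the identity rather than [p'] gives an invertible matrix on the whole space, with
   [T = L *: (A *m p')]. *)
pose A := 1%:M + L^-1 *: (Phi' *m (Psi - L *: Phi) *m p').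
have uA : A \in unitmx.
  apply: unitmx_near1; rewrite /A addrC addKr sumnormZ gtr0_norm ?invr_gt0 //.
  by rewrite mulrC ltr_pdivrMr // mul1r.
have AT : L *: (A *m p') = T.
  rewrite TE /A mulmxDl mul1mx scalerDr -scalemxAl scalerA divff ?gt_eqF //
    scale1r.
  by rewrite -(mulmxA _ p' p') pp' addrC.
exists (L^-1 *: (v *m invmx A *m Phi')).
  by rewrite -scalemxAl -mulmxA Phi'p.
rewrite -scalemxAl -[in X in _ *:
  X]mulmxA -/T -AT -scalemxAr scalerA mulVf ?gt_eqF //.
by rewrite scale1r mulmxA mulmxKV.
Qed.

(* The inverse of [M : im p -> im q], provided that [M] is injective on [im p]. *)
Definition image_inverse n m (p : 'M[R]_n) (M : 'M[R]_(n, m)) : 'M[R]_(m, n) :=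
  M^T *m mx_inv (M *m M^T + (1%:M - p)).

(** The quadratic form of this matrix at [w] is the sum of the squared norms of [w *m M] and
    [w *m (1%:M - p)], which vanish together only at [w = 0]. *)
Lemma gram_projector_unit n m (p : 'M[R]_n) (M : 'M[R]_(n, m)) :
  p^T = p -> p *m p = p ->
  (forall u : 'rV_n, u *m p = u -> u *m M = 0 -> u = 0) ->
  M *m M^T + (1%:M - p) \in unitmx.
Proof.
move=> pT pp inj; rewrite -row_free_unit; apply: inj_row_free => w wN.
have sq0 k (z : 'rV[R]_k) : (z *m z^T) 0 0 = \sum_i z 0 i ^+ 2.
  by rewrite mxE; apply: eq_bigr => i _; rewrite [z^T i 0]mxE expr2.
have qT : (1%:M - p) *m (1%:M - p)^T = 1%:M - p.
  by rewrite linearB /= trmx1 pT mulmxBl mul1mx mulmxBr mulmx1 pp subrr subr0.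
have key : w *m M *m (w *m M)^T + w *m (1%:M - p) *m (w *m (1%:M - p))^T = 0.
  rewrite !trmx_mul !mulmxA -(mulmxA w M) -(mulmxA w (1%:M - p)) qT.
  by rewrite -mulmxDl -mulmxDr wN mul0mx.
have : (w *m M *m (w *m M)^T) 0 0 +
    (w *m (1%:M - p) *m (w *m (1%:M - p))^T) 0 0 = 0.
  by have := congr1 (fun z : 'M[R]_1 => z 0 0) key; rewrite [LHS]mxE [RHS]mxE.
rewrite !sq0 => /eqP; rewrite paddr_eq0; last 2 first.
- by apply: sumr_ge0 => i _; exact: sqr_ge0.
- by apply: sumr_ge0 => i _; exact: sqr_ge0.
have zero k (z : 'rV[R]_k) : \sum_i z 0 i ^+ 2 == 0 -> z = 0.
  rewrite psumr_eq0 => [/allP h|i _]; last exact: sqr_ge0.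
  apply/rowP => i; have := h i (mem_index_enum _).
  by rewrite sqrf_eq0 mxE => /eqP.
move=> /andP[/zero wM /zero /eqP]; rewrite mulmxBr mulmx1 subr_eq0 eq_sym =>
  /eqP wp.
exact: inj.
Qed.

(** On rows fixed by [p] the summand [1%:M - p] vanishes, so [N] acts there as [M *m M^T]; moreover
    [N] commutes with [p]. *)
Lemma image_inverseK n m (p : 'M[R]_n) (M : 'M[R]_(n, m)) :
  p^T = p -> p *m p = p -> p *m M = M ->
  M *m M^T + (1%:M - p) \in unitmx ->
  image_inverse p M *m p = image_inverse p M /\
  (forall u : 'rV_n, u *m p = u -> u *m M *m image_inverse p M = u).
Proof.
move=> pT pp pM; set N := M *m M^T + (1%:M - p) => uN.
have MTp : M^T *m p = M^T by rewrite -{1}pT -trmx_mul pM.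
have pN : p *m N = N *m p.
  rewrite mulmxDr mulmxDl !mulmxA pM -mulmxA MTp.
  by rewrite mulmxBr mulmxBl mulmx1 mul1mx.
have pNV : p *m invmx N = invmx N *m p.
  apply: (can_inj (mulKmx uN)).
  by rewrite mulKVmx // mulmxA -pN mulmxK.
rewrite /image_inverse -/N mx_inv_unit //; split=> [|u up].
  by rewrite -mulmxA -pNV mulmxA MTp.
have uE : u *m N = u *m M *m M^T.
  by rewrite mulmxDr mulmxBr mulmx1 up subrr addr0 mulmxA.
by rewrite mulmxA -uE mulmxK.
Qed.

Lemma entries_image_inverse T (A : set (T -> R)) n m (p : T -> 'M[R]_n)
    (M : T -> 'M[R]_(n, m)) :
  function_algebra A -> entries A p -> entries A M ->
  A (fun x => (\det (M x *m (M x)^T + (1%:M - p x)))^-1) ->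
  entries A (fun x => image_inverse (p x) (M x)).
Proof.
move=> hA hp hM hd; apply: (entriesM hA); first exact: entries_tr.
apply: entries_inv => //; apply: (entriesD hA).
  by apply: (entriesM hA) => //; exact: entries_tr.
by apply: (entriesB hA) => //; exact: entries_cst.
Qed.

Lemma falg_gram_det T (A : set (T -> R)) n m (p : T -> 'M[R]_n)
    (M : T -> 'M[R]_(n, m)) :
  function_algebra A -> entries A p -> entries A M ->
  A (fun x => \det (M x *m (M x)^T + (1%:M - p x))).
Proof.
move=> hA hp hM; apply: (falg_det hA); apply: (entriesD hA).
  by apply: (entriesM hA) => //; exact: entries_tr.
by apply: (entriesB hA) => //; exact: entries_cst.
Qed.

End LinearAlgebra.

(** * Restriction of algebraic bundles to smaller sets *)

Section Restriction.
Context {R : realType} {F : scalar_kind} {V : function_space R} {I : Type}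
  (c : I -> V -> R).
Hypothesis hc : presented_by c.
Local Notation d := (scalar_dim F).
Local Notation Fn n := 'rV[scalars R F]_n.

Lemma restriction_topological n (Z Z' : set V) (E : set (V * Fn n)) :
  Z' `<=` Z -> topological_subbundle Z E ->
  topological_subbundle Z' (restriction E Z').
Proof.
move=> ZZ hE; apply: subbundle_of_frames => [e [_ []]//|x Z'x].
have [ O [r [M [oO Ox hM]]]] := frames_of_subbundle hE (ZZ x Z'x).
exists O, r, M; split=> // y Z'y Oy.
have [fM lM EM cM] := hM y (ZZ y Z'y) Oy; split=> // [v|i j].
  apply: iff_trans (EM v); split=> [[]//|Ey]; by split.
exact: cont_at_sub (cM i j).
Qed.

Lemma restriction_algebraic n (Z Z' : set V) (E : set (V * Fn n)) :
  Z' `<=` Z -> algebraic_subbundle Z E ->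
  algebraic_subbundle Z' (restriction E Z').
Proof.
move=> ZZ [tE aE]; split; first exact: restriction_topological tE.
move=> z Z'z; have [ O [zO Oz [r [s [rs sE]]]]] := aE z (ZZ z Z'z).
exists O; split=> //; exists r, s; split=> [i|x [Z'x Ox]].
  apply/(regular_onP _ _ hc) => x [Z'x Ox] k j.
  have := (regular_onP _ _ hc).1 (rs i) x (conj (ZZ x Z'x) Ox) k j.
  by apply: rational_sub => // y [/ZZ Zy Oy].
have [h1 h2] := sE x (conj (ZZ x Z'x) Ox); split=> // v.
apply: iff_trans (h1 v); split=> [[]//|Ex]; by split.
Qed.

Lemma restriction_restriction n (A B : set V) (E : set (V * Fn n)) :
  A `<=` B -> restriction (restriction E B) A = restriction E A.
Proof.
move=> AB; apply/seteqP; split=> -[x v] /=; first by move=> [[]].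
by move=> [Ex [/= Ax _]]; split=> //; split=> //; split=> //=; exact: AB.
Qed.

Lemma extension_restriction n (Sigma Sigma1 Z Z1 : set V) (E Et :
  set (V * Fn n)) :
  algebraic_extension Sigma1 (restriction E Sigma1) Z1 Et ->
  Sigma `<=` Sigma1 -> Z `<=` Z1 -> zariski_neighborhood_in_closure Sigma Z ->
  algebraic_extension Sigma (restriction E Sigma) Z (restriction Et Z).
Proof.
move=> [_ aE rE] SS ZZ nZ; split=> //; first exact: restriction_algebraic aE.
rewrite restriction_restriction; last by case: nZ.
by rewrite -(restriction_restriction E SS) -rE restriction_restriction.
Qed.

(** The Zariski closure shrinks with the set; the open set of the given extension still serves
    inside the smaller closure. *)
Lemma algebraic_bundle_restriction n (Sigma Sigma1 : set V) (E :
  set (V * Fn n)) :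
  Sigma `<=` Sigma1 -> algebraic_bundle Sigma1 (restriction E Sigma1) ->
  algebraic_bundle Sigma (restriction E Sigma).
Proof.
move=> SS [tE [Z1 [Et ext]]]; split.
  rewrite -(restriction_restriction E SS).
  exact: restriction_topological tE.
have [[S1Z [ O [zO ZE]]] aE rE] := ext.
exists (zariski_closure Sigma `&` O),
  (restriction Et (zariski_closure Sigma `&` O)).
apply: (extension_restriction ext) => //.
  by rewrite ZE; apply: setSI; exact: zariski_closure_mono.
split; last by exists O.
move=> x Sx; split; first exact: subset_zariski_closure.
by have := S1Z x (SS x Sx); rewrite ZE => -[].
Qed.

Lemma piecewise_refinement_sub n (S S' : set (set V)) (X : set V)
    (E : set (V * Fn n)) :
  (forall Sigma, piece S' X Sigma -> exists2 Sigma1, piece S X Sigma1 &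
     Sigma `<=` Sigma1) ->
  piecewise_algebraic_bundle_for S X E -> piecewise_algebraic_bundle_for S' X E.
Proof.
move=> ref [tE aE]; split=> // Sigma /ref[Sigma1 pS1 SS].
by apply: algebraic_bundle_restriction SS _; exact: aE.
Qed.

End Restriction.

Section Morphisms.
Context {R : realType} {F : scalar_kind} {V : function_space R} {I : Type}
  (c : I -> V -> R).
Hypothesis hc : presented_by c.
Local Notation d := (scalar_dim F).
Local Notation Fn n := 'rV[scalars R F]_n.

Lemma bundle_morphism_comp (B : topologicalType) (xi eta zeta :
  vector_family R F B)
    (phi : total_set xi -> total_set eta) (psi : total_set eta ->
      total_set zeta) :
  bundle_morphism phi -> bundle_morphism psi -> bundle_morphism (psi \o phi).
Proof.
move=> [c1 p1 a1 s1] [c2 p2 a2 s2]; split.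
- by move=> e; apply: continuous_comp; [exact: c1|exact: c2].
- by move=> e; rewrite /= p2 p1.
- by move=> e1 e2 e3 e12 e3E; apply: a2; [rewrite !p1|exact: a1].
- by move=> a e1 e2 e12; apply: s2; exact: s1.
Qed.

Definition fiber_proj n (E : set (V * Fn n)) : V -> 'M[R]_(n * d) :=
  proj_fiber (fun x v => E (x, v)).

Lemma fiber_projP n (X : set V) (E : set (V * Fn n)) x :
  topological_subbundle X E -> X x ->
  [/\ (fiber_proj E x)^T = fiber_proj E x,
      fiber_proj E x *m fiber_proj E x = fiber_proj E x,
      forall v, E (x, v) <-> realify v *m fiber_proj E x = realify v,
      @scalar_linear R F n n (fiber_proj E x) &
      entries (cont_at X x) (fiber_proj E)].
Proof. by move=> hE Xx; exact: (proj_fiberP (frames_of_subbundle hE)). Qed.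

Lemma fiber_proj_eq n (E E' : set (V * Fn n)) x :
  (forall v, E (x, v) <-> E' (x, v)) -> fiber_proj E x = fiber_proj E' x.
Proof.
move=> EE; congr projector_onto; apply/seteqP; split=> u /=; exact:
  (EE _).1 || exact: (EE _).2.
Qed.

(** Precomposition with the projector extends the map of fibers to all of [F^n], by zero on the
    orthogonal complement, so that a matrix is determined by [phi]. *)
Lemma morphism_matrix n m (X : set V) (E : set (V * Fn n)) (E' : set (V * Fn m))
    (phi : set_type E -> set_type E') :
  topological_subbundle X E -> topological_subbundle X E' ->
  @bundle_morphism R F V (subfamily E) (subfamily E') phi ->
  exists Phi : V -> 'M[R]_(n * d, m * d), forall x, X x ->
  [/\ @scalar_linear R F n m (Phi x), fiber_proj E x *m Phi x = Phi x,
      Phi x *m fiber_proj E' x = Phi x,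
      entries (cont_at X x) Phi &
      forall e : set_type E, (set_val e).1 = x ->
        realify (set_val (phi e)).2 = realify (set_val e).2 *m Phi x].
Proof.
move=> hE hE' [cphi pphi aphi sphi]; pose p := fiber_proj E.
have pP x : X x -> _ := fiber_projP hE.
have pP' x : X x -> _ := fiber_projP hE'.
have inE x v : X x -> E (x, mx_act (p x) v).
  move=> /pP[_ pp pE _ _]; apply/pE.
  by rewrite realify_act -mulmxA pp.
(* The default [0] is never reached over [X], where [inE] provides membership. *)
pose g x (v : Fn n) : Fn m := if pselect (E (x, mx_act (p x) v)) is left h
  then (set_val (phi (SigSub (mem_set h)))).2 else 0.
have gE x v (e : set_type E) : set_val e = (x, mx_act (p x) v) ->
    g x v = (set_val (phi e)).2.
  move=> eE; rewrite /g; case: pselect => [h|nh].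
    by congr (set_val (phi _)).2; apply: val_inj.
  by case: nh; rewrite -eE; exact: set_valP.
have sub x v : X x -> exists e : set_type E, set_val e = (x, mx_act (p x) v).
  by move=> Xx; exists (SigSub (mem_set (inE x v Xx))).
have gD x : X x -> {morph g x : v w / v + w}.
  move=> Xx v w; have [e1 E1] := sub x v Xx; have [e2 E2] := sub x w Xx.
  have [e3 E3] := sub x (v + w) Xx.
  rewrite (gE _ _ _ E1) (gE _ _ _ E2) (gE _ _ _ E3).
  rewrite (aphi e1 e2 e3) //=; first by rewrite E1 E2.
  by rewrite E1 E2 E3 mx_actD.
have gZ x a v : X x -> g x (a *: v) = a *: g x v.
  move=> Xx; have [e1 E1] := sub x v Xx; have [e2 E2] := sub x (a *: v) Xx.
  rewrite (gE _ _ _ E1) (gE _ _ _ E2) (sphi a e1 e2) //= E1 E2 mx_actZ //.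
  by have [] := pP x Xx.
pose Phi x := mx_of (g x).
have gM x v : X x -> realify (g x v) = realify v *m Phi x.
  by move=> Xx; apply: mx_ofE => [|r w]; [exact: gD|exact: gZ].
have pK x v : X x -> E (x, v) -> mx_act (p x) v = v.
  by move=> /pP[_ _ pE _ _] /pE vE; apply: realify_inj; rewrite realify_act.
exists Phi => x Xx; have [pT pp pE lp cp] := pP x Xx; split.
- by apply: scalar_linear_mx_of => [|a v]; [exact: gD|exact: gZ].
- apply: eq_mx_rowmul => u; rewrite -[u]unrealifyK mulmxA -realify_act -!gM //.
  have [e eE] := sub x (unrealify u) Xx; rewrite (gE _ _ _ eE); congr realify.
  by apply: gE; rewrite eE (pK x (mx_act (p x) (unrealify u))) //; exact: inE.
- apply: eq_mx_rowmul => u; rewrite -[u]unrealifyK mulmxA -!gM //.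
  have [_ _ pE' _ _] := pP' x Xx; apply/pE'.
  have [e eE] := sub x (unrealify u) Xx; rewrite (gE _ _ _ eE).
  have <- : (set_val (phi e)).1 = x by have := pphi e; rewrite /= eE.
  by rewrite -surjective_pairing; exact: set_valP.
- move=> i j; pose v0 : Fn n := unrealify (delta_mx 0 i).
  apply: (@cont_at_eq _ _ _ _ (fun y => realify (g y v0) 0 j)) => //.
    by move=> y _; rewrite /Phi mxE.
  (* A continuous section of [E], the projection of a fixed basis vector; its image under [phi] is a
     row of [Phi]. *)
  pose s (a : set_type X) : set_type E :=
    SigSub (mem_set (inE (set_val a) v0 (set_valP a))).
  have cs : continuous s.
    apply: (continuous_set_type_map (f := fun y => (y, mx_act (p y) v0))) => //.
    apply/cont_at_within => y Xy; apply: cont_at_pair; first exact: cont_at_id.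
    apply: cont_at_act; last exact: cont_at_cst.
    by have [] := pP y Xy.
  have c2 : continuous (fun e' : set_type E' => realify (set_val e').2 0 j).
    apply: (continuous_set_type (f := fun q : V * Fn m =>
      realify q.2 0 j) _).1 => //.
    apply/cont_at_within => q _.
    by have /cont_at_realify := @cont_at_snd _ _ E' q; apply.
  suff : {within X, continuous (fun y => realify (g y v0) 0 j)}.
    by move/cont_at_within; apply.
  apply/(continuous_set_type (g := fun a =>
    realify (set_val (phi (s a))).2 0 j)).
    by move=> a; congr (realify _ 0 j); exact: gE.
  have c3 : continuous (phi \o s).
    by move=> a; apply: continuous_comp; [exact: cs|exact: cphi].
  have c4 : continuous ((fun e' : set_type E' => realify (set_val e').2 0 j)
      \o (phi \o s)).
    by move=> a; apply: continuous_comp; [exact: c3|exact: c2].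
  exact: c4.
- move=> e ex; rewrite -gM //; congr realify; apply/esym/gE.
  rewrite pK // -ex; last by rewrite -surjective_pairing; exact: set_valP.
  exact: surjective_pairing.
Qed.

Lemma algebraic_mx_morphism n m (X Sigma Z : set V) (E Et : set (V * Fn n))
    (E' Et' : set (V * Fn m)) (M Mt : V -> 'M[R]_(n * d, m * d))
    (phi : set_type E -> set_type E') : Sigma `<=` X ->
  algebraic_extension Sigma (restriction E Sigma) Z Et ->
  algebraic_extension Sigma (restriction E' Sigma) Z Et' ->
  mx_map M phi ->
  (forall x, X x -> @scalar_linear R F n m (M x)) ->
  (forall x, X x -> entries (cont_at X x) M) ->
  (forall x, Sigma x -> M x = Mt x) ->
  (forall z, Z z -> @scalar_linear R F n m (Mt z)) ->
  (forall z, Z z -> entries (rational_on c [set z] Z) Mt) ->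
  (forall e, Et e -> Et' (e.1, mx_act (Mt e.1) e.2)) ->
  exists phiS : set_type (restriction E Sigma) ->
    set_type (restriction E' Sigma),
    algebraic_morphism Sigma phiS /\ agree phiS phi.
Proof.
move=> SX xE xE' hphi lM cM MMt lMt rMt EtE'.
have [|phiS hS] := @mx_map_exists R F V n m (restriction E Sigma)
    (restriction E' Sigma) M.
  move=> e [Ee [/= Se _]]; split=> //.
  have := hphi (SigSub (mem_set Ee)); rewrite /= => <-; exact: set_valP.
have [phit ht] := @mx_map_exists R F V n m Et Et' Mt EtE'.
have EtZ e : Et e -> Z e.1.
  by move=> Ee; have [_ [[+ _ _] _] _] := xE; apply.
exists phiS; split; last first.
  by move=> e et ee; rewrite hS hphi ee.
split.
  apply: (mx_map_morphism (X := Sigma) _ hS) => [e [_ []]//|x Sx|x Sx i j].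
    by apply: lM; exact: SX.
  exact: cont_at_sub SX (cM _ (SX x Sx) i j).
exists Z, Et, Et', phit; split=> //.
  split; last exact: (mx_map_regular hc EtZ ht).
  apply: (mx_map_morphism (X := Z) _ ht) => // x Zx i j.
  by apply: (rational_cont_at hc) => //; exact: rMt.
move=> e et ee; rewrite hS ht ee MMt // -ee.
by have [_ []] := set_valP e.
Qed.

(** As [f] is only locally a quotient on [Z], the open set is assembled from all principal open sets
    whose trace on [Z] avoids the zeros of [f]. *)
Lemma zariski_open_nonzero (Z : set V) f :
  (forall z, Z z -> rational_on c [set z] Z f) ->
  exists2 O, zariski_open O & forall z, Z z -> (O z <-> f z != 0).
Proof.
move=> rf; exists [set y | exists h, [/\ polynomial_in c h, h y != 0 &
  forall x, Z x -> h x != 0 -> f x != 0]].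
  by apply/hc.1 => y [h [ph hy hf]]; exists h; split=> // x hx; exists h.
move=> z Zz; split=> [[h [_ hz]]|fz]; first exact.
have [u [w [pu pw w0 fE]]] := rf z Zz.
exists (fun y => u y * w y); split; first exact: PolyMul.
  by move: fz; rewrite fE ?w0 // !mulf_eq0 invr_eq0.
move=> x Zx; rewrite mulf_eq0 negb_or => /andP[ux wx].
by rewrite fE // mulf_neq0 // invr_eq0.
Qed.

End Morphisms.

Section Uniqueness.
Context {R : realType} {F : scalar_kind} {V : function_space R} {N : nat}
  (c : 'I_N -> V -> R).
Hypothesis hc : presented_by c.
Local Notation d := (scalar_dim F).
Local Notation Fn n := 'rV[scalars R F]_n.

(** Matrices of weight zero are unconstrained, so only the bumps active at a point enter. *)
Lemma weighted_sum_lt (M : finType) (n m : nat) (l : M -> R)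
    (A : M -> 'M[R]_(n, m)) :
  (forall k, 0 <= l k) -> (exists k, 0 < l k) ->
  (forall k, 0 < l k -> sumnorm (A k) < 1) ->
  sumnorm (\sum_k l k *: A k) < \sum_k l k.
Proof.
move=> l0 [k0 lk0] A1.
apply: (@le_lt_trans _ _ (\sum_k l k * sumnorm (A k))).
  elim/big_rec2: _ => [|k x y _ xy]; first by rewrite sumnorm0.
  apply: (le_trans (ler_sumnormD _ _)); apply: lerD => //.
  by rewrite sumnormZ ger0_norm.
rewrite (bigD1 k0) //= [ltRHS](bigD1 k0) //=; apply: ltr_leD.
  by rewrite gtr_pMr // A1.
apply: ler_sum => k _; have := l0 k; rewrite le_eqVlt => /orP[/eqP <-|lk].
  by rewrite mul0r.
by rewrite ger_pMr // ltW // A1.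
Qed.

Lemma piecewise_algebraic_uniqueness n m (X : set V) (E : set (V * Fn n))
    (E' : set (V * Fn m)) : compact X ->
  piecewise_algebraic_bundle X E -> piecewise_algebraic_bundle X E' ->
  @topologically_isomorphic R F V (subfamily E) (subfamily E') ->
  piecewise_algebraically_isomorphic X E E'.
Proof.
move=> cX [S sS bS] [S' sS' bS'] [phi [psi [mphi mpsi phiK psiK]]].
have tE := bS.1; have tE' := bS'.1.
have EX e : E e -> X e.1 by case: tE => + _ _; apply.
have EX' e : E' e -> X e.1 by case: tE' => + _ _; apply.
pose p := fiber_proj E; pose p' := fiber_proj E'.
have [Phi PhiP] := morphism_matrix tE tE' mphi.
have [Phi' PhiP'] := morphism_matrix tE' tE mpsi.
have pP x : X x -> _ := fiber_projP tE.
have pP' x : X x -> _ := fiber_projP tE'.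
have base (e : set_type E) : (set_val (phi e)).1 = (set_val e).1.
  by have [_ + _ _] := mphi; apply.
have base' (e : set_type E') : (set_val (psi e)).1 = (set_val e).1.
  by have [_ + _ _] := mpsi; apply.
have inv x : X x -> Phi x *m Phi' x = p x.
  move=> Xx; have [_ pPhi _ _ ePhi] := PhiP x Xx; have [_ _ _ _ ePhi'] :=
    PhiP' x Xx.
  apply: eq_mx_rowmul => u; rewrite mulmxA -[in LHS]pPhi mulmxA.
  have [_ pp pE _ _] := pP x Xx.
  have Ee : E (x, unrealify (u *m p x)).
    by apply/pE; rewrite unrealifyK -mulmxA pp.
  pose e : set_type E := SigSub (mem_set Ee).
  have eE : realify (set_val e).2 = u *m p x by rewrite /= unrealifyK.
  rewrite -eE -(ePhi e erefl) -(ePhi' (phi e)); last by rewrite base.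
  by rewrite phiK.
have inv' x : X x -> Phi' x *m Phi x = p' x.
  move=> Xx; have [_ pPhi' _ _ ePhi'] := PhiP' x Xx; have [_ _ _ _ ePhi] :=
    PhiP x Xx.
  apply: eq_mx_rowmul => u; rewrite mulmxA -[in LHS]pPhi' mulmxA.
  have [_ pp pE _ _] := pP' x Xx.
  have Ee : E' (x, unrealify (u *m p' x)).
    by apply/pE; rewrite unrealifyK -mulmxA pp.
  pose e : set_type E' := SigSub (mem_set Ee).
  have eE : realify (set_val e).2 = u *m p' x by rewrite /= unrealifyK.
  rewrite -eE -(ePhi' e erefl) -(ePhi (psi e)); last by rewrite base'.
  by rewrite psiK.
(* The two smallness conditions of [near_iso_bijective] for [Psi = Phi a] and [L = 1]. Both norms
   are continuous in [x] and vanish at [x = a]. *)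
pose U a : set V := [set x | X x ->
  sumnorm (Phi' x *m (Phi a - Phi x) *m p' x) < 1 /\
  sumnorm (p x *m (Phi a - Phi x) *m Phi' x) < 1].
have nU a : X a -> nbhs a (U a).
  move=> Xa; have hA := @cont_at_algebra V R X a.
  have [_ _ _ _ cp] := pP a Xa; have [_ _ _ _ cp'] := pP' a Xa.
  have [_ _ _ cPhi _] := PhiP a Xa; have [_ _ _ cPhi' _] := PhiP' a Xa.
  have cd : entries (cont_at X a) (fun x => Phi a - Phi x).
    by apply: (entriesB hA) => //; exact: entries_cst.
  have c1 : cont_at X a (fun x => sumnorm (Phi' x *m (Phi a - Phi x) *m p' x)).
    by apply: cont_at_sumnorm; do 2?apply: (entriesM hA) => //.
  have c2 : cont_at X a (fun x => sumnorm (p x *m (Phi a - Phi x) *m Phi' x)).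
    by apply: cont_at_sumnorm; do 2?apply: (entriesM hA) => //.
  move: c1 c2 => /cvgr_lt /(_ 1) + /cvgr_lt /(_ 1).
  rewrite subrr !mulmx0 !mul0mx !sumnorm0 => /(_ ltr01) h1 /(_ ltr01) h2.
  have : \forall x \near within X (nbhs a),
      sumnorm (Phi' x *m (Phi a - Phi x) *m p' x) < 1 /\
      sumnorm (p x *m (Phi a - Phi x) *m Phi' x) < 1 by exact: filterI h1 h2.
  by rewrite near_withinE.
have [M [T [lam [f [a [pf lamP lam_cov aP [_ lam_piece]]]]]]] :=
  bump_functions hc cX nU.
have lam_ge0 k x : 0 <= lam k x by have [] := lamP k.
have lam_U k x : X x -> 0 < lam k x ->
    sumnorm (Phi' x *m (Phi (a k) - Phi x) *m p' x) < 1 /\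
    sumnorm (p x *m (Phi (a k) - Phi x) *m Phi' x) < 1.
  move=> Xx lk; have [_ /(_ x) [/(_ Xx) //|/nbhs_singleton l0]] := aP k.
  by move: lk; rewrite l0 ltxx.
(* The matrices [Phi (a k)] are constants; only the weights and the projectors vary with [x]. This
   makes [A] algebraic on pieces although [Phi] is merely continuous. *)
pose Psi x := \sum_k lam k x *: Phi (a k).
pose A x := p x *m Psi x *m p' x.
pose B x := image_inverse (p x) (A x).
have Abij x : X x -> (forall u : 'rV_(n * d), u *m p x = u -> u *m A x = 0 ->
  u = 0) /\
  (forall v : 'rV_(m * d), v *m p' x = v -> exists2 u,
    u *m p x = u & u *m A x = v).
  move=> Xx; have [_ pp _ _ _] := pP x Xx; have [_ pp' _ _ _] := pP' x Xx.
  have [_ pPhi Phip' _ _] := PhiP x Xx; have [_ p'Phi' Phi'p _ _] := PhiP' x Xx.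
  have PE : Psi x - (\sum_k lam k x) *: Phi x =
      \sum_k lam k x *: (Phi (a k) - Phi x).
    by rewrite scaler_suml -sumrB; apply: eq_bigr => k _; rewrite scalerBr.
  apply: (@near_iso_bijective _ _ _ _ _ (Phi x) _ (Phi' x) (\sum_k lam k x)) =>
    //.
  - exact: inv.
  - exact: inv'.
  - rewrite PE mulmx_sumr mulmx_suml.
    under eq_bigr do rewrite -scalemxAr -scalemxAl.
    apply: weighted_sum_lt => // [|k lk]; first exact: lam_cov.
    by have [] := lam_U k x Xx lk.
  - rewrite PE mulmx_sumr mulmx_suml.
    under eq_bigr do rewrite -scalemxAr -scalemxAl.
    apply: weighted_sum_lt => // [|k lk]; first exact: lam_cov.
    by have [] := lam_U k x Xx lk.
have pA x : X x -> p x *m A x = A x.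
  by move=> /pP[_ pp _ _ _]; rewrite /A !mulmxA pp.
have Ap' x : X x -> A x *m p' x = A x.
  by move=> /pP'[_ pp _ _ _]; rewrite /A -(mulmxA _ (p' x)) pp.
have uN x : X x -> A x *m (A x)^T + (1%:M - p x) \in unitmx.
  move=> Xx; have [pT pp _ _ _] := pP x Xx; have [inj _] := Abij x Xx.
  exact: gram_projector_unit.
have BP x : X x -> B x *m p x = B x /\
    forall u : 'rV_(n * d), u *m p x = u -> u *m A x *m B x = u.
  move=> Xx; have [pT pp _ _ _] := pP x Xx.
  exact: (image_inverseK pT pp (pA x Xx) (uN x Xx)).
(* [B] inverts [A] on one side by construction, and on the other because [A] maps onto the fiber. *)
have BA x (v : 'rV_(m * d)) : X x -> v *m p' x = v -> v *m B x *m A x = v.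
  move=> Xx vp; have [_ surj] := Abij x Xx; have [u up uA] := surj v vp.
  by have [_ AB] := BP x Xx; rewrite -{1}uA AB.
have lPhi x : X x -> @scalar_linear R F n m (Phi x) by move=> /PhiP[].
have lA x : X x -> @scalar_linear R F n m (A x).
  move=> Xx; have [_ _ _ lp _] := pP x Xx; have [_ _ _ lp' _] := pP' x Xx.
  apply: scalar_linearM => //; apply: scalar_linearM => //.
  apply: scalar_linear_sum => k _; apply: scalar_linearZ.
  by apply: lPhi; have [] := aP k.
have lin_inv q (C : 'M[R]_(n * d, m * d)) : @scalar_linear R F n n q ->
    @scalar_linear R F n m C -> @scalar_linear R F m n (image_inverse q C).
  move=> lq lC; have l1 := @scalar_linear1 R F n.
  apply: scalar_linearM; first exact: scalar_linear_tr.
  apply: scalar_linear_mx_inv; apply: scalar_linearD.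
    by apply: scalar_linearM => //; exact: scalar_linear_tr.
  by apply: scalar_linearD => //; exact: scalar_linearN.
have lB x : X x -> @scalar_linear R F m n (B x).
  by move=> Xx; apply: lin_inv; [have [] := pP x Xx|exact: lA].
have cA x : X x -> entries (cont_at X x) A.
  move=> Xx; have hA := @cont_at_algebra V R X x.
  have [_ _ _ _ cp] := pP x Xx; have [_ _ _ _ cp'] := pP' x Xx.
  apply: (entriesM hA) => //; apply: (entriesM hA) => //.
  apply: (entries_sum hA) => k; apply: (entriesZ hA); last exact: entries_cst.
  by apply: cont_at_continuous; have [_ cl] := lamP k; exact: cl.
have cB x : X x -> entries (cont_at X x) B.
  move=> Xx; have hA := @cont_at_algebra V R X x.
  have [_ _ _ _ cp] := pP x Xx.
  apply: entries_image_inverse => //; first exact: cA.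
  apply: cont_at_inv; first by have := uN x Xx; rewrite unitmxE unitfE.
  by apply: falg_gram_det => //; exact: cA.
have EA e : E e -> E' (e.1, mx_act (A e.1) e.2).
  move=> Ee; have Xe := EX e Ee; have [_ _ pE' _ _] := pP' _ Xe.
  by apply/pE'; rewrite realify_act -mulmxA Ap'.
have EB e : E' e -> E (e.1, mx_act (B e.1) e.2).
  move=> Ee; have Xe := EX' e Ee; have [_ _ pE _ _] := pP _ Xe.
  by apply/pE; rewrite realify_act -mulmxA; have [-> _] := BP _ Xe.
have [alpha hal] := @mx_map_exists R F V n m E E' A EA.
have [beta hbe] := @mx_map_exists R F V m n E' E B EB.
(* On its pieces [S] and [S'] make the projectors rational, and the zero strata make the weights
   polynomial. *)
pose S2 := common_refinement (common_refinement S S') (zero_strata f).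
have sS2 : stratification S2.
  apply: (stratification_refinement hc).
    exact: (stratification_refinement hc).
  exact: (stratification_zero hc).
have ref Sigma : piece S2 X Sigma -> [/\
    exists2 Sigma1, piece S X Sigma1 & Sigma `<=` Sigma1,
    exists2 Sigma1, piece S' X Sigma1 & Sigma `<=` Sigma1 &
    exists2 Sigma1, piece (zero_strata f) X Sigma1 & Sigma `<=` Sigma1].
  move=> /piece_refinement[[S1 /piece_refinement[[S3 p3 s3] [S4 p4 s4]] s1] h2].
  split=> //; [exists S3|exists S4] => //; exact: subset_trans s1 _.
have bS2 : piecewise_algebraic_bundle_for S2 X E.
  apply: (piecewise_refinement_sub hc _ bS) => Sigma /ref[h _ _]; exact: h.
have bS2' : piecewise_algebraic_bundle_for S2 X E'.
  apply: (piecewise_refinement_sub hc _ bS') => Sigma /ref[_ h _]; exact: h.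
(* Over a piece, both maps extend to the same Zariski neighborhood [Z], on which
   the inverse of [At] is regular because its Gram determinant does not vanish.
     *)
have pieces Sigma : piece S2 X Sigma -> exists Z Et Et' At,
    [/\ algebraic_extension Sigma (restriction E Sigma) Z Et /\
        algebraic_extension Sigma (restriction E' Sigma) Z Et',
      forall x, Sigma x -> A x = At x /\ B x = image_inverse (fiber_proj Et x)
        (At x),
      forall z, Z z -> @scalar_linear R F n m (At z) /\
        @scalar_linear R F m n (image_inverse (fiber_proj Et z) (At z)),
      forall z, Z z -> entries (rational_on c [set z] Z) At /\
        entries (rational_on c [set z] Z)
          (fun x => image_inverse (fiber_proj Et x) (At x)) &
      (forall e, Et e -> Et' (e.1, mx_act (At e.1) e.2)) /\
      (forall e, Et' e -> Et (e.1,
        mx_act (image_inverse (fiber_proj Et e.1) (At e.1)) e.2))].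
  move=> pS2; have SX := piece_sub pS2.
  have [[S1 p1 s1] [S3 p3 s3] [S4 p4 s4]] := ref _ pS2.
  have [_ [Z1 [Et1 x1]]] := bS.2 S1 p1; have [_ [Z3 [Et3 x3]]] := bS'.2 S3 p3.
  have [[S1Z1 [ O1 [zO1 Z1E]]] aE1 rE1] := x1.
  have [[S3Z3 [ O3 [zO3 Z3E]]] aE3 rE3] := x3.
  pose q := fiber_proj Et1; pose q' := fiber_proj Et3.
  have Eq x v : Sigma x -> (Et1 (x, v) <-> E (x, v)).
    move=> Sx; have : restriction Et1 S1 (x, v) <-> restriction E S1 (x, v).
      by rewrite rE1.
    rewrite /restriction /= => h; split=> h'.
      by have [] := h.1 (conj h' (conj (s1 x Sx) Logic.I)).
    by have [] := h.2 (conj h' (conj (s1 x Sx) Logic.I)).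
  have Eq' x v : Sigma x -> (Et3 (x, v) <-> E' (x, v)).
    move=> Sx; have : restriction Et3 S3 (x, v) <-> restriction E' S3 (x, v).
      by rewrite rE3.
    rewrite /restriction /= => h; split=> h'.
      by have [] := h.1 (conj h' (conj (s3 x Sx) Logic.I)).
    by have [] := h.2 (conj h' (conj (s3 x Sx) Logic.I)).
  have lam_alg k : (forall x, Sigma x -> lam k x = 0) \/
      exists2 g, polynomial_in c g &
        forall x, Sigma x -> 0 < lam k x /\ lam k x = g x.
    apply: lam_piece => [|t].
      by case: pS2 => C SC [x Cx ->]; exists x; exact: connected_component_refl.
    have [h|h|h] := piece_sign t hc pf p4.
    - by constructor 1 => x /s4; exact: h.
    - by constructor 2 => x /s4; exact: h.
    - by constructor 3 => x /s4; exact: h.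
  have /choice[g gP] k : exists g, polynomial_in c g /\
      forall x, Sigma x -> lam k x = g x.
    have [l0|[g pg lg]] := lam_alg k; first by exists (fun=> 0); split=> //;
      exact: PolyCst.
    by exists g; split=> // x /lg[].
  (* [A] with the weights replaced by polynomials and the projectors by those of the algebraic
     extensions: the two agree on [Sigma], but [At] is rational on a Zariski neighborhood in the
     closure. *)
  pose At x := q x *m (\sum_k g k x *: Phi (a k)) *m q' x.
  pose Z0 := zariski_closure Sigma `&` (O1 `&` O3).
  have Z01 : Z0 `<=` Z1.
    by move=> x [cx [u1 _]]; rewrite Z1E; split=> //; exact:
      zariski_closure_mono s1 _ cx.
  have Z03 : Z0 `<=` Z3.
    by move=> x [cx [_ o3]]; rewrite Z3E; split=> //; exact:
      zariski_closure_mono s3 _ cx.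
  have SZ0 : Sigma `<=` Z0.
    move=> x Sx; split; first exact: subset_zariski_closure.
    by have := S1Z1 x (s1 x Sx); have := S3Z3 x (s3 x Sx); rewrite Z1E Z3E =>
      -[_ o3] [].
  have qE x : Sigma x -> q x = p x.
    by move=> Sx; apply: fiber_proj_eq => v; exact: Eq.
  have qE' x : Sigma x -> q' x = p' x.
    by move=> Sx; apply: fiber_proj_eq => v; exact: Eq'.
  have AtE x : Sigma x -> A x = At x.
    move=> Sx; rewrite /A /At qE // qE' //; congr (_ *m _ *m _).
    by apply: eq_bigr => k _; have [_ ->] := gP k.
  have qP z (Z0z : Z0 z) := fiber_projP aE1.1 (Z01 z Z0z).
  have qP' z (Z0z : Z0 z) := fiber_projP aE3.1 (Z03 z Z0z).
  have rq (Z : set V) z : Z `<=` Z0 -> Z z ->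
    entries (rational_on c [set z] Z) q.
    move=> ZZ0 Zz i j; have :=
      algebraic_proj_fiber hc aE1 (Z01 z (ZZ0 z Zz)) i j.
    by apply: rational_sub => // y /ZZ0 /Z01.
  have rq' (Z : set V) z : Z `<=` Z0 -> Z z ->
    entries (rational_on c [set z] Z) q'.
    move=> ZZ0 Zz i j; have :=
      algebraic_proj_fiber hc aE3 (Z03 z (ZZ0 z Zz)) i j.
    by apply: rational_sub => // y /ZZ0 /Z03.
  have rAt (Z : set V) z : Z `<=` Z0 -> Z z ->
    entries (rational_on c [set z] Z) At.
    move=> ZZ0 Zz; have hA := rational_algebra c [set z] Z.
    apply: (entriesM hA); last exact: rq'.
    apply: (entriesM hA); first exact: rq.
    apply: (entries_sum hA) => k; apply: (entriesZ hA); last exact: entries_cst.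
    by apply: rational_polynomial; have [] := gP k.
  pose det z := \det (At z *m (At z)^T + (1%:M - q z)).
  have rdet (Z : set V) z : Z `<=` Z0 -> Z z -> rational_on c [set z] Z det.
    move=> ZZ0 Zz; have hA := rational_algebra c [set z] Z.
    by apply: (falg_gram_det hA); [exact: rq|exact: rAt].
  have [ O4 zO4 O4E] := zariski_open_nonzero hc (fun z =>
    @rdet Z0 z (@subset_refl _ _)).
  pose Z := Z0 `&` O4.
  have ZZ0 : Z `<=` Z0 by move=> z [].
  have SZ : Sigma `<=` Z.
    move=> x Sx; split; first exact: SZ0.
    apply/(O4E x (SZ0 x Sx)); rewrite /det qE // -AtE //.
    by have := uN x (SX x Sx); rewrite unitmxE unitfE.
  have nZ : zariski_neighborhood_in_closure Sigma Z.
    split=> //; exists ((O1 `&` O3) `&` O4); split;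
      last by rewrite /Z /Z0 -!setIA.
    apply/hc.1; apply: generated_openI; last exact/hc.1.
    by apply: generated_openI; exact/hc.1.
  have rqE z : Z z -> fiber_proj (restriction Et1 Z) z = q z.
    move=> Zz; apply: fiber_proj_eq => v; split=> [[]//|h]; by split.
  have Et1P z v : Z z -> (Et1 (z, v) <-> realify v *m q z = realify v).
    by move=> Zz; have [_ _ h _ _] := qP z (ZZ0 z Zz); exact: h.
  have Et3P z v : Z z -> (Et3 (z, v) <-> realify v *m q' z = realify v).
    by move=> Zz; have [_ _ h _ _] := qP' z (ZZ0 z Zz); exact: h.
  have lAt z : Z z -> @scalar_linear R F n m (At z).
    move=> Zz; have [_ _ _ lq _] := qP z (ZZ0 z Zz).
    have [_ _ _ lq' _] := qP' z (ZZ0 z Zz).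
    apply: scalar_linearM => //; apply: scalar_linearM => //.
    apply: scalar_linear_sum => k _; apply: scalar_linearZ.
    by apply: lPhi; have [] := aP k.
  have rB z : Z z -> entries (rational_on c [set z] Z)
      (fun x => image_inverse (q x) (At x)).
    move=> Zz; have hA := rational_algebra c [set z] Z.
    apply: (entries_image_inverse hA); [exact: rq|exact: rAt|].
    apply: rational_inv; [by move=> _ ->|exact: rdet|move=> _ ->].
    by apply/(O4E z (ZZ0 z Zz)); case: Zz.
  exists Z, (restriction Et1 Z), (restriction Et3 Z), At; split.
  - split; first exact: (extension_restriction hc x1 s1 (subset_trans ZZ0 Z01)).
    exact: (extension_restriction hc x3 s3 (subset_trans ZZ0 Z03)).
  - move=> x Sx; split; first exact: AtE.
    by rewrite rqE ?qE ?/B -?AtE //; exact: SZ.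
  - move=> z Zz; split; first exact: lAt.
    by rewrite rqE //; apply: lin_inv; [have [] := qP z (ZZ0 z Zz)|exact: lAt].
  - move=> z Zz; split; first exact: rAt.
    move=> i j; apply: rational_ext (rB z Zz i j) => y /set_mem Zy.
    by rewrite rqE.
  - split=> -[z v] [Ez [/= Zz _]]; split=> //=.
      apply/(Et3P _ _ Zz); rewrite realify_act -mulmxA.
      have [_ qq' _ _ _] := qP' z (ZZ0 z Zz).
      by rewrite -[At z *m q' z]mulmxA qq'.
    rewrite rqE //; apply/(Et1P _ _ Zz); rewrite realify_act -mulmxA.
    have [qT qq _ _ _] := qP z (ZZ0 z Zz).
    have qAt : q z *m At z = At z by rewrite /At !mulmxA qq.
    have uNt : At z *m (At z)^T + (1%:M - q z) \in unitmx.
      rewrite unitmxE unitfE; apply/(O4E z (ZZ0 z Zz)); by case: Zz.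
    by have [-> _] := image_inverseK qT qq qAt uNt.
exists alpha, beta; split.
- exists S2 => //; split=> //; split; first exact: (mx_map_morphism EX hal).
  move=> Sigma pS2; have [Z [Et [Et' [At [[x1 x3] AE lAt rAt [hE _]]]]]] :=
    pieces _ pS2.
  apply: (algebraic_mx_morphism hc (piece_sub pS2) x1 x3 hal lA cA _ _ _ hE).
  + by move=> x /AE[].
  + by move=> z /lAt[].
  + by move=> z /rAt[].
- exists S2 => //; split=> //; split; first exact: (mx_map_morphism EX' hbe).
  move=> Sigma pS2; have [Z [Et [Et' [At [[x1 x3] AE lAt rAt [_ hE]]]]]] :=
    pieces _ pS2.
  apply: (algebraic_mx_morphism (Mt := fun x =>
    image_inverse (fiber_proj Et x) (At x))
    hc (piece_sub pS2) x3 x1 hbe lB cB _ _ _ hE).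
  + by move=> x /AE[].
  + by move=> z /lAt[].
  + by move=> z /rAt[].
- move=> e; apply: val_inj; rewrite [LHS]hbe hal /=; have Ee := set_valP e.
  rewrite [RHS]surjective_pairing; congr (_, _); apply: realify_inj.
  rewrite !realify_act; have Xe := EX _ Ee; have [_ _ pE _ _] := pP _ Xe.
  have [_ AB] := BP _ Xe; apply: AB; apply/pE.
  by rewrite -surjective_pairing.
- move=> e; apply: val_inj; rewrite [LHS]hal hbe /=; have Ee := set_valP e.
  rewrite [RHS]surjective_pairing; congr (_, _); apply: realify_inj.
  rewrite !realify_act; have Xe := EX' _ Ee; have [_ _ pE' _ _] := pP' _ Xe.
  by apply: BA => //; apply/pE'; rewrite -surjective_pairing.
Qed.

End Uniqueness.

Lemma topologically_isomorphic_via (R : realType) (F : scalar_kind)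
    (B : topologicalType) (xi eta zeta : vector_family R F B) :
  topologically_isomorphic xi eta -> topologically_isomorphic xi zeta ->
  topologically_isomorphic eta zeta.
Proof.
move=> [f [f' [mf mf' fK fK']]] [g [g' [mg mg' gK gK']]].
exists (g \o f'), (f \o g'); split.
- exact: bundle_morphism_comp.
- exact: bundle_morphism_comp.
- exact: can_comp.
- exact: can_comp.
Qed.

Theorem theorem5p10 (R : realType) (F : scalar_kind) (V : function_space R)
    (hV : real_algebraic_variety V) (X : set V) (hX : compact X)
    (xi : vector_family R F V) (hxi : vector_bundle X xi) :
  exists (n : nat) (E : set (V * 'rV[scalars R F]_n)),
    [/\ piecewise_algebraic_bundle X E,
        topologically_isomorphic xi (subfamily E) &
        forall (p : nat) (E' : set (V * 'rV[scalars R F]_p)),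
          piecewise_algebraic_bundle X E' ->
          topologically_isomorphic xi (subfamily E') ->
          piecewise_algebraically_isomorphic X E E'].
Proof.
have [N [c hc]] := variety_presented hV.
have [n [E [aE iE]]] := piecewise_algebraization hc hX hxi.
exists n, E; split=> // m E' aE' iE'.
apply: (piecewise_algebraic_uniqueness hc hX aE aE').
exact: topologically_isomorphic_via iE iE'.
Qed.
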